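(* Let $r:(\hat{\mathbb{C}},q)\to(\hat{\mathbb{C}},q)$ be a non-constant rational function. Then $\dim_N X=\dim_N r(X)$ for every $X\subset\hat{\mathbb{C}}$. Moreover, a nonconstant meromorphic function $f:\mathbb{C}\to\hat{\mathbb{C}}$ is rational if and only if it preserves the Nagata dimension of every subset of $\mathbb{C}$, i.e. $\dim_N X=\dim_N f(X)$ for every $X\subset\mathbb{C}$.
   Context: $\hat{\mathbb{C}}=\mathbb{C}\cup\{\infty\}$ is the Riemann sphere with the spherical metric $q(z,w)=\frac{|z-w|}{\sqrt{(1+|z|^2)(1+|w|^2)}}$ for $z,w\in\mathbb{C}$, $q(z,\infty)=q(\infty,z)=\frac{1}{\sqrt{1+|z|^2}}$, $q(\infty,\infty)=0$. Nagata dimensions of subsets of $\hat{\mathbb{C}}$ are computed with respect to $q$; for subsets of $\mathbb{C}$ the Euclidean metric and $q$ give the same Nagata dimension, so either may be used. Nagata dimension: let $(X,d)$ be a metric space. A family $\mathcal{B}$ of subsets of $X$ is $s$-bounded if every member has diameter at most $s$. For $s>0$, the $s$-multiplicity of $\mathcal{B}$ is the infimum of all integers $n\ge 0$ such that every subset of $X$ of diameter $\le s$ meets at most $n$ members of $\mathcal{B}$. The Nagata dimension $\dim_N X$ is the infimum of all integers $n$ with the following property: there exists $c>0$ such that for all $s>0$, $X$ admits a $cs$-bounded covering with $s$-multiplicity at most $n+1$. *)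

(* Defs.v *)
From mathcomp Require Import all_boot all_order all_algebra.
From mathcomp Require Import all_classical all_reals all_analysis.
From mathcomp Require Import complex.

Set Implicit Arguments.
Unset Strict Implicit.
Unset Printing Implicit Defensive.

Import Order.TTheory GRing.Theory Num.Theory.
Import numFieldNormedType.Exports.

Local Open Scope classical_set_scope.
Local Open Scope ring_scope.
Local Open Scope complex_scope.

Section Nagata.
Context {R : realType} {T : Type} (d : T -> T -> R).

(* diam set0 = -oo; diameters are only ever compared with positive bounds. *)
Definition diam (A : set T) : \bar R :=
  ereal_sup [set (d p.1 p.2)%:E | p in A `*` A].

Definition bounded_family (s : R) (F : set (set T)) : Prop :=
  forall B, F B -> (diam B <= s%:E)%E.

(* The ambient metric space is the subset X with the restriction of d; the
   infimum is +oo when no n works. *)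
Definition multiplicity (X : set T) (s : R) (F : set (set T)) : \bar R :=
  ereal_inf [set (n%:R)%:E | n in [set n : nat |
    forall A : set T, A `<=` X -> (diam A <= s%:E)%E ->
      ([set B | F B /\ B `&` A !=set0] #<= `I_n)%card]].

(* Coverings of X consist of subsets of X.  The infimum ranges over integers,
   so the empty space has dimension -1; it is +oo when no n works. *)
Definition nagata_dim (X : set T) : \bar R :=
  ereal_inf [set (n%:~R)%:E | n in [set n : int |
    exists2 c : R, 0 < c & forall s : R, 0 < s ->
      exists F : set (set T),
        [/\ \bigcup_(B in F) B = X,
            bounded_family (c * s) F &
            (multiplicity X s F <= ((n + 1)%:~R)%:E)%E]]].

End Nagata.

Section Sphere.
Context {R : realType}.

(* None is the point at infinity. *)
Definition sphere : Type := option R[i].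

Let norm (z : R[i]) : R := ComplexField.Normc.normc z.

Definition qdist (x y : sphere) : R :=
  match x, y with
  | Some z, Some w =>
      norm (z - w) / Num.sqrt ((1 + norm z ^+ 2) * (1 + norm w ^+ 2))
  | Some z, None | None, Some z => 1 / Num.sqrt (1 + norm z ^+ 2)
  | None, None => 0
  end.

(* The self-map of the sphere induced by p / q for coprime p and q; at
   infinity it takes the limit of p / q, recalling size = degree + 1. *)
Definition ratfun (p q : {poly R[i]}) (x : sphere) : sphere :=
  match x with
  | Some z => if q.[z] == 0 then None else Some (p.[z] / q.[z])
  | None => if (size q < size p)%N then None
            else Some (p`_(size q).-1 / lead_coef q)
  end.

Definition rational_map (r : sphere -> sphere) : Prop :=
  exists p q : {poly R[i]},
    [/\ q != 0, coprimep p q & forall x, r x = ratfun p q x].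

Definition rational_on_plane (f : R[i] -> sphere) : Prop :=
  exists2 r : sphere -> sphere,
    rational_map r & forall z : R[i], f z = r (Some z).

(* The value 0 at poles is junk: finite_part is only used near points where f
   is finite. *)
Definition finite_part (f : R[i] -> sphere) (z : R[i]^o) : R[i]^o :=
  odflt 0 (f z).

(* The normed module R[i]^o has scalar field R[i], so derivable is complex
   differentiability. *)
Definition regular_at (f : R[i] -> sphere) (z : R[i]^o) : Prop :=
  (\forall w \near z, f w <> None) /\ derivable (finite_part f) z 1.

Definition pole_at (f : R[i] -> sphere) (z : R[i]^o) : Prop :=
  [/\ f z = None,
      \forall w \near z^', f w <> None &
      qdist (f w) None @[w --> z^'] --> (0 : R)].

(* Poles are isolated and regular_at holds at every other point, so f is
   holomorphic off its poles. *)
Definition meromorphic (f : R[i] -> sphere) : Prop :=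
  forall z : R[i], regular_at f z \/ pole_at f z.

End Sphere.

Arguments sphere R : clear implicits.

Definition nonconstant {A B : Type} (f : A -> B) : Prop :=
  ~ exists b, forall a, f a = b.

(* Main.v *)
Require Import Defs.
From mathcomp Require Import all_boot all_order all_algebra.
From mathcomp Require Import all_classical all_reals all_analysis.
From mathcomp Require Import complex ring lra.

(** For a rational map r = (P : Q) the chordal distance of r(z) and r(w) is
    |P(z) Q(w) - P(w) Q(z)| up to the norms of (P, Q), and near a point a of local
    degree k, for z and w in a small sector at a, this is comparable to
    |z - w| max(|z - a|, |w - a|)^(k-1). On dyadic shells around a the map is thus a
    similarity up to bounded distortion, and the Nagata dimension can be transferred
    shell by shell; finitely many sectors and points a suffice, and the Nagata
    dimension of a finite union is the maximum.

    If a meromorphic f on the plane maps every neighbourhood of infinity to a dense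
    set, some lacunary sequence, of Nagata dimension 0, has a dense image, of positive
    dimension. Otherwise f stays away from some disc near infinity. By Sard's theorem
    the disc contains a value w1 taken only with nonzero derivative, so 1 / (f - w1) has
    only simple poles, lying in a bounded set and removed by a polynomial factor A; as
    A / (f - w1) grows polynomially, Liouville's theorem makes f rational. The complex
    analysis is derived from integrals over rectangles, without assuming f' continuous. *)

Set Implicit Arguments.
Unset Strict Implicit.
Unset Printing Implicit Defensive.

Import Order.TTheory GRing.Theory Num.Theory.
Import numFieldNormedType.Exports.

Local Open Scope classical_set_scope.
Local Open Scope ring_scope.
Local Open Scope complex_scope.

(** The obstacle is that one constant must serve all scales: near a critical point the ratio of
    distances after and before the map tends to 0, so the map is not bi-Lipschitz there. At a fixed
    scale [s], however, a shell whose image is large compared with [s] is more than [s] away from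
    every other shell of its parity and can be labelled at its own source scale, while all smaller
    shells together form one class. All compactness arguments are instances of one bisection
    principle for rectangles, applied to directions, to the unit square, to contour integrals, to
    critical values and to poles. The integral of [1 / (z - p)] is never evaluated: Cauchy's formula
    serves only to show that a value vanishes or that a derivative does not, and for this a positive
    lower bound on the norm of that integral suffices. The regular value [w1] replaces a theory of
    orders of zeros: where the derivative is nonzero the divided difference is invertible, so a
    linear factor cancels the pole. *)

Local Notation N := (@ComplexField.Normc.normc _).

(** * Complex norm and subdivision of rectangles *)

Section ComplexNorm.
Context {R : realType}.
Implicit Types z w : R[i].

Lemma normc_ge0 z : 0 <= N z.
Proof. by case: z => a b; exact: sqrtr_ge0. Qed.

Lemma normc_eq0 z : (N z == 0) = (z == 0).
Proof.
apply/eqP/eqP => [/ComplexField.Normc.eq0_normc//|->].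
by rewrite /= expr0n /= addr0 sqrtr0.
Qed.

Lemma normc0E : N (0 : R[i]) = 0.
Proof. by apply/eqP; rewrite normc_eq0. Qed.

Lemma normc1E : N (1 : R[i]) = 1.
Proof. exact: ComplexField.Normc.normc1. Qed.

Lemma normc_gt0 z : (0 < N z) = (z != 0).
Proof. by rewrite lt_def normc_ge0 andbT normc_eq0. Qed.

Lemma normc_sqr z : N z ^+ 2 = complex.Re z ^+ 2 + complex.Im z ^+ 2.
Proof. by case: z => a b /=; rewrite sqr_sqrtr// addr_ge0// sqr_ge0. Qed.

Lemma normcZ (a : R) : N a%:C = `|a|.
Proof. by rewrite /= expr0n /= addr0 sqrtr_sqr. Qed.

Lemma normcM' z w : N (z * w) = N z * N w.
Proof. exact: ComplexField.Normc.normcM. Qed.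

Lemma normcV' z : N z^-1 = (N z)^-1.
Proof. exact: ComplexField.Normc.normcV. Qed.

Lemma normc_div z w : N (z / w) = N z / N w.
Proof. by rewrite normcM' normcV'. Qed.

Lemma normcX z n : N (z ^+ n) = N z ^+ n.
Proof.
elim: n => [|n IH]; last by rewrite !exprS normcM' IH.
by rewrite !expr0 normc1E.
Qed.

Lemma normc_opp z : N (- z) = N z.
Proof. exact: normcN. Qed.

Lemma normc_sub z w : N (z - w) = N (w - z).
Proof. by rewrite -opprB normc_opp. Qed.

Lemma normc_add z w : N (z + w) <= N z + N w.
Proof. exact: le_normcD. Qed.

Lemma normc_tri v z w : N (z - w) <= N (z - v) + N (v - w).
Proof. by rewrite (_ : z - w = (z - v) + (v - w)) ?normc_add//; ring. Qed.

Lemma normc_triB z w : N z - N w <= N (z - w).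
Proof. by have := normc_add (z - w) w; rewrite subrK; lra. Qed.

Lemma normc_Re z : `|complex.Re z| <= N z.
Proof.
rewrite -(ler_pXn2r (n := 2))// ?nnegrE ?normc_ge0//.
by rewrite normc_sqr -normrX ger0_norm ?sqr_ge0// lerDl sqr_ge0.
Qed.

Lemma normc_Im z : `|complex.Im z| <= N z.
Proof.
rewrite -(ler_pXn2r (n := 2))// ?nnegrE ?normc_ge0//.
by rewrite normc_sqr -normrX ger0_norm ?sqr_ge0// lerDr sqr_ge0.
Qed.

Lemma normc_ReIm z : N z <= `|complex.Re z| + `|complex.Im z|.
Proof.
rewrite -(ler_pXn2r (n := 2))// ?nnegrE ?normc_ge0 ?addr_ge0//.
rewrite normc_sqr sqrrD !real_normK ?num_real//.
have : 0 <= `|complex.Re z| * `|complex.Im z| by rewrite mulr_ge0.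
by lra.
Qed.

Lemma normc_conj z : N (conjc z) = N z.
Proof. by case: z => a b /=; rewrite sqrrN. Qed.

Lemma mulc_conj z : z * conjc z = (N z ^+ 2)%:C.
Proof.
rewrite normc_sqr; case: z => a b /=.
by apply/eqP; rewrite eq_complex /=; apply/andP; split; apply/eqP; ring.
Qed.

Lemma normc_sum (I : Type) (r : seq I) (P : pred I) (F : I -> R[i]) :
  N (\sum_(i <- r | P i) F i) <= \sum_(i <- r | P i) N (F i).
Proof.
elim/big_ind2 : _ => //; first by rewrite (_ : N 0 = 0)//; apply/eqP; rewrite normc_eq0.
by move=> z a w b Ha Hb; apply: le_trans (normc_add _ _) _; apply: lerD.
Qed.

End ComplexNorm.

Section Cousin.
Context {R : realType}.

Lemma nested_limit (a b : nat -> R) :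
  (forall n, a n <= a n.+1) -> (forall n, b n.+1 <= b n) -> (forall n, a n <= b n) ->
  exists x, forall n, a n <= x <= b n.
Proof.
move=> Ha Hb Hab.
have Ham m n : (m <= n)%N -> a m <= a n.
  by move/subnK <-; elim: (n - m)%N => [//|k IH]; rewrite addSn (le_trans IH).
have Hbm m n : (m <= n)%N -> b n <= b m.
  by move/subnK <-; elim: (n - m)%N => [//|k IH]; rewrite addSn (le_trans _ IH).
have Hb' n : ubound [set a k | k in setT] (b n).
  move=> _ [k _ <-]; apply: (le_trans (Ham _ _ (leq_maxl k n))).
  exact: (le_trans (Hab _) (Hbm _ _ (leq_maxr k n))).
exists (sup [set a k | k in setT]) => n; apply/andP; split.
  by apply: ub_le_sup; [exists (b 0)|exists n].
by apply: ge_sup => //; exists (a 0), 0.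
Qed.

Lemma half_pow_lt (c e : R) : 0 < e -> exists n, c / 2 ^+ n < e.
Proof.
move=> e0; exists (Num.truncn (`|c| / e)).+1.
rewrite ltr_pdivrMr ?exprn_gt0//.
apply: le_lt_trans (ler_norm c) _; rewrite mulrC -ltr_pdivrMr//.
apply: lt_le_trans (Num.Theory.truncnS_gt _) _.
by rewrite -natrX ler_nat; apply/ltnW/ltn_expl.
Qed.

(** The arguments of [P] are the left, right, bottom and top sides. The quarters share their edges,
    so nothing is lost on the cut lines. *)
Definition quarter_stable (P : R -> R -> R -> R -> Prop) :=
  forall a b c d, a <= b -> c <= d ->
    P a ((a + b) / 2) c ((c + d) / 2) -> P ((a + b) / 2) b c ((c + d) / 2) ->
    P a ((a + b) / 2) ((c + d) / 2) d -> P ((a + b) / 2) b ((c + d) / 2) d ->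
    P a b c d.

(* Cousin's lemma: a rectangle violating P would have a violating quarter, and
   iterating produces rectangles shrinking to a point where P fails locally. *)
Lemma cousin (P : R -> R -> R -> R -> Prop) (x0 x1 y0 y1 : R) :
  x0 <= x1 -> y0 <= y1 -> quarter_stable P ->
  (forall x y, x0 <= x <= x1 -> y0 <= y <= y1 -> exists2 e, 0 < e &
     forall a b c d, x0 <= a -> a <= x <= b -> b <= x1 ->
       y0 <= c -> c <= y <= d -> d <= y1 -> b - a < e -> d - c < e -> P a b c d) ->
  P x0 x1 y0 y1.
Proof.
move=> Hx Hy Hq Hloc; apply: contrapT => nP.
pose bad (q : R * R * R * R) :=
  [/\ q.1.1.1 <= q.1.1.2, q.1.2 <= q.2 & ~ P q.1.1.1 q.1.1.2 q.1.2 q.2].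
pose sub (q q' : R * R * R * R) := [/\ q.1.1.1 <= q'.1.1.1, q'.1.1.2 <= q.1.1.2,
  q.1.2 <= q'.1.2, q'.2 <= q.2 & q'.1.1.2 - q'.1.1.1 = (q.1.1.2 - q.1.1.1) / 2 /\
  q'.2 - q'.1.2 = (q.2 - q.1.2) / 2].
(* A rectangle that is not bad is sent to itself as a junk value, which makes [f] total and
   iterable. *)
have /choice[f Hf] : forall q, exists q', bad q -> bad q' /\ sub q q'.
  move=> q.
  case: (pselect (bad q)) => [bq|]; last by exists q.
  case: q bq => [[[a b] c] d] [/= Hab Hcd nPq].
  apply: contrapT => /forallNP H; apply: nPq; apply: Hq => //.
  - apply: contrapT => nP'; apply: (H (a, (a+b)/2, c, (c+d)/2)) => _.
    by split; split => //=; try split; lra.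
  - apply: contrapT => nP'; apply: (H ((a+b)/2, b, c, (c+d)/2)) => _.
    by split; split => //=; try split; lra.
  - apply: contrapT => nP'; apply: (H (a, (a+b)/2, (c+d)/2, d)) => _.
    by split; split => //=; try split; lra.
  - apply: contrapT => nP'; apply: (H ((a+b)/2, b, (c+d)/2, d)) => _.
    by split; split => //=; try split; lra.
pose g n := iter n f (x0, x1, y0, y1).
have Hb n : bad (g n).
  by elim: n => [//|n IH]; have [] := Hf _ IH.
have Hs n : sub (g n) (g n.+1) by have [] := Hf _ (Hb n).
have [x Hx'] : exists x, forall n, (g n).1.1.1 <= x <= (g n).1.1.2.
  by apply: nested_limit => n; [have [] := Hs n|have [] := Hs n|have [] := Hb n].
have [y Hy'] : exists y, forall n, (g n).1.2 <= y <= (g n).2.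
  by apply: nested_limit => n; [have [] := Hs n|have [] := Hs n|have [] := Hb n].
have Hin n : [/\ x0 <= (g n).1.1.1, (g n).1.1.2 <= x1, y0 <= (g n).1.2 & (g n).2 <= y1].
  elim: n => [//|n [A B C D]]; have [A' B' C' D' _] := Hs n.
  by split; [exact: le_trans A A'|exact: le_trans B' B|exact: le_trans C C'|exact: le_trans D' D].
have Hwx n : (g n).1.1.2 - (g n).1.1.1 = (x1 - x0) / 2 ^+ n.
  elim: n => [|n IH]; first by rewrite expr0 divr1.
  by have [_ _ _ _ [-> _]] := Hs n; rewrite IH exprSr invfM mulrA.
have Hwy n : (g n).2 - (g n).1.2 = (y1 - y0) / 2 ^+ n.
  elim: n => [|n IH]; first by rewrite expr0 divr1.
  by have [_ _ _ _ [_ ->]] := Hs n; rewrite IH exprSr invfM mulrA.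
have [e e0 He] := Hloc x y (Hx' 0) (Hy' 0).
have [n Hn] := half_pow_lt (Num.max (x1 - x0) (y1 - y0)) e0.
have [_ _ nPn] := Hb n; apply: nPn; have [A B C D] := Hin n.
apply: He => //; rewrite ?Hwx ?Hwy; apply: le_lt_trans Hn;
  by rewrite ler_pM2r ?invr_gt0 ?exprn_gt0// le_max lexx ?orbT.
Qed.

End Cousin.

(** * Nagata dimension *)

Section Cardinals.
Local Open Scope card_scope.

(** Extracts from a failed cardinality bound, for finite and infinite sets alike, the distinct
    members from which contradicting points are chosen. *)
Lemma card_leNII {U : pointedType} (S : set U) k :
  ~ (S #<= `I_k) -> exists2 g : 'I_k.+1 -> U, injective g & forall i, S (g i).
Proof.
move=> H.
have /pcard_leP/unsquash f : `I_k.+1 #<= S.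
  case: (pselect (finite_set S)) => [[m Hm]|].
    apply: (card_le_trans (B := `I_m)); last by rewrite (card_le_eqr Hm).
    rewrite card_le_II ltnNge; apply/negP => mk; apply: H.
    by rewrite (card_le_eql Hm) card_le_II.
  by move/infiniteP; apply: card_le_trans; exact: card_leT.
exists (fun i : 'I_k.+1 => f i) => [i j fij|i]; last by apply: funS; exact: ltn_ord.
by apply/val_inj/(@inj _ _ _ f) => //; rewrite inE; exact: ltn_ord.
Qed.

Lemma card_ge_inj {U : Type} (S : set U) k m (g : 'I_k -> U) :
  injective g -> (forall i, S (g i)) -> S #<= `I_m -> (k <= m)%N.
Proof.
move=> ginj Sg Sm; rewrite -card_le_II; apply: card_le_trans Sm.
have : g @` [set: 'I_k] #<= S by apply: subset_card_le => _ [i _ <-].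
apply: card_le_trans; rewrite (card_le_eql (@card_II k)).
have /card_eqPle[] // : g @` [set: 'I_k] #= [set: 'I_k].
by apply: inj_card_eq => i j _ _; exact: ginj.
Qed.
End Cardinals.

Section Labels.
Context {R : realType} {T : Type} (d : T -> T -> R).
Implicit Types (X Y : set T) (n : nat).

Lemma diam_le (A : set T) (s : R) :
  (diam d A <= s%:E)%E <-> forall x y, A x -> A y -> d x y <= s.
Proof.
split=> [H x y Ax Ay|H].
  by rewrite -lee_fin; apply: le_trans H; apply: ereal_sup_ubound; exists (x, y).
by apply: ge_ereal_sup => _ [[x y] [/= Ax Ay] <-]; rewrite lee_fin; exact: H.
Qed.

(* A partition-like reformulation of a cover: each point is labelled by a member
   containing it. Multiplicity at most n + 1 becomes the absence of n + 2 points
   with pairwise distances at most s and distinct labels. *)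
Definition labelling X n (s b : R) (L : Type) (phi : T -> L) :=
  (forall x y, X x -> X y -> phi x = phi y -> d x y <= b) /\
  (forall g : 'I_n.+2 -> T, (forall i, X (g i)) -> (forall i j, d (g i) (g j) <= s) ->
     ~ injective (phi \o g)).

(** The label type is fixed to [set T], so a label can be a member of a cover or a fibre. Only
    [n >= 0] is expressed; the value -1 of the empty set is handled by [nagata_cover_negz]. *)
Definition nagata_le X n := exists2 c : R, 0 < c &
  forall s, 0 < s -> exists phi : T -> set T, labelling X n s (c * s) phi.

(** Labels of any type can be replaced by their fibres in [X], so a labelling may be built with
    whatever type is convenient. *)
Lemma labelling_class X n s b (L : Type) (phi : T -> L) :
  labelling X n s b phi ->
  labelling X n s b (fun x => [set y | X y /\ phi y = phi x]).
Proof.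
have E x y : X x -> [set z | X z /\ phi z = phi x] = [set z | X z /\ phi z = phi y] ->
    phi x = phi y.
  by move=> Xx /seteqP[/(_ x) + _]; case.
move=> [Hb Hm]; split=> [x y Xx Xy /E e|g Xg dg ginj]; first by apply: Hb => //; exact: e.
apply: (Hm g) => // i j /= e; apply: ginj => /=.
by rewrite e.
Qed.

Definition nagata_cover X (n : int) := exists2 c : R, 0 < c & forall s : R, 0 < s ->
  exists F : set (set T),
    [/\ \bigcup_(B in F) B = X, bounded_family d (c * s) F &
        (multiplicity d X s F <= ((n + 1)%:~R)%:E)%E].

(** An infimum of natural numbers is attained: a value below [k + 1] gives a witness at most [k],
    and larger bounds follow from smaller ones. *)
Lemma multiplicity_le X s F (k : nat) : (multiplicity d X s F <= (k%:R)%:E)%E <->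
  forall A : set T, A `<=` X -> (diam d A <= s%:E)%E ->
      ([set B | F B /\ B `&` A !=set0] #<= `I_k)%card.
Proof.
split=> [H A AX dA|H]; last by apply: ereal_inf_lbound; exists k.
have : (multiplicity d X s F < (k.+1%:R)%:E)%E.
  by apply: le_lt_trans H _; rewrite lte_fin ltr_nat.
case/ereal_inf_lt => _ [m Hm <-]; rewrite lte_fin ltr_nat ltnS => mk.
by apply: card_le_trans (Hm _ AX dA) _; rewrite card_le_II.
Qed.

Lemma multiplicity_ge0 X s F : (0 <= multiplicity d X s F)%E.
Proof. by apply: le_ereal_inf_tmp => _ [m _ <-]; rewrite lee_fin ler0n. Qed.

(** Given a cover, a point is labelled by a chosen member containing it; [n + 2] close points with
    distinct labels are a small set meeting too many members. Conversely the fibres form a cover,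
    and the members met by a small set yield points with distinct labels. *)
Lemma nagata_coverP X n : nagata_cover X n <-> nagata_le X n.
Proof.
have nat1 : ((n : int) + 1)%:~R = (n.+1%:R : R) by rewrite -addn1 natrD intrD.
split=> -[c c0 H]; exists c => // s s0.
- have [F [FX Fb Fm]] := H s s0.
  have /choice[phi Hphi] x : exists B, X x -> F B /\ B x.
    case: (pselect (X x)) => [|nx]; last by exists set0.
    by rewrite -FX => -[B FB Bx]; exists B.
  exists phi; split=> [x y Xx Xy exy|g Xg dg ginj].
    have [Fx xx] := Hphi x Xx; have [_ yy] := Hphi y Xy.
    by have /diam_le h := Fb _ Fx; apply: h => //; rewrite exy.
  move: Fm; rewrite nat1 => /multiplicity_le/(_ (range g)) Hm.
  suff : (n.+2 <= n.+1)%N by rewrite ltnn.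
  apply: (card_ge_inj ginj _ (Hm _ _)).
  + by move=> i /=; have [] := Hphi _ (Xg i); split => //; exists (g i); split=> //; exists i.
  + by move=> _ [i _ <-].
  + by apply/diam_le => _ _ [i _ <-] [j _ <-].
- have [phi [Hb Hm]] := H s s0.
  pose fib y := [set x | X x /\ phi x = phi y].
  exists [set fib y | y in X]; split.
  + apply/seteqP; split=> [x [_ [y Xy <-]] []//|x Xx].
    by exists (fib x) => //; exists x.
  + move=> _ [y Xy <-]; apply/diam_le => x x' [Xx ex] [Xx' ex'].
    by apply: Hb => //; rewrite ex ex'.
  + rewrite nat1; apply/multiplicity_le => A AX /diam_le dA.
    apply: contrapT => /card_leNII[g ginj Hg].
    have /choice[h Hh] i : exists x, A x /\ g i = fib x.
      have [[y Xy <-] [x [[Xx exy] Ax]]] := Hg i; exists x; split=> //.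
      by rewrite /fib exy.
    apply: (Hm h) => [i|i j|i j /= eij].
    * by apply: AX; have [] := Hh i.
    * by apply: dA; [have [] := Hh i|have [] := Hh j].
    * by apply: ginj; have [_ ->] := Hh i; have [_ ->] := Hh j; rewrite /fib eij.
Qed.

(** [Negz n] is [-(n + 1)]. Multiplicities are nonnegative, which leaves only -1, and multiplicity 0
    fails as soon as a one-point set can be tested. *)
Lemma nagata_cover_negz X (n : nat) : (forall x, d x x = 0) ->
  nagata_cover X (Negz n) <-> n = 0%N /\ X = set0.
Proof.
move=> dxx; split=> [[c c0 /(_ 1 ltr01)[F [FX Fb Fm]]]|[-> ->]].
  have n0 : n = 0%N.
    case: n Fm => // n; rewrite leNgt => /negP; case.
    apply: lt_le_trans (multiplicity_ge0 _ _ _).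
    by rewrite lte_fin ltrz0.
  split=> //; apply: contrapT => /eqP/set0P[x Xx]; move: Fm; rewrite n0.
  rewrite (_ : (Negz 0 + 1)%:~R = 0%:R) //.
  move/multiplicity_le/(_ [set x]); rewrite II0 => H.
  have [B FB Bx] : (\bigcup_(B in F) B) x by rewrite FX.
  have /card_le0P/seteqP[+ _] : ([set B | F B /\ B `&` [set x] !=set0] #<= @set0 nat)%card.
    by apply: H => [_ ->//|]; apply/diam_le => _ _ -> ->; rewrite dxx.
  by move/(_ B); apply; split=> //; exists x.
exists 1 => // s s0; exists set0; split.
- by rewrite bigcup_set0.
- by [].
- rewrite (_ : (Negz 0 + 1)%:~R = 0%:R) //; apply/multiplicity_le => A _ _.
  rewrite (_ : [set B | _] = set0) ?card_ge0//.
  by apply/seteqP; split=> // B [].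
Qed.
End Labels.

(** [nagata_le] sees only the integers [n >= 0]; the hypothesis on emptiness decides about -1. *)
Lemma nagata_dim_eq {R : realType} {T T' : Type} (d : T -> T -> R) (d' : T' -> T' -> R)
    (X : set T) (Y : set T') :
  (forall x, d x x = 0) -> (forall x, d' x x = 0) ->
  (X = set0 <-> Y = set0) -> (forall n : nat, nagata_le d X n <-> nagata_le d' Y n) ->
  nagata_dim d X = nagata_dim d' Y.
Proof.
move=> dxx d'xx XY H; rewrite /nagata_dim; congr (ereal_inf (_ @` _)).
apply/seteqP; split=> -[] n /=; rewrite -/(nagata_cover _ _ _).
- by move/nagata_coverP/H/nagata_coverP.
- by move/(nagata_cover_negz _ _ dxx) => [-> /XY ->]; apply/nagata_cover_negz.
- by move/nagata_coverP/H/nagata_coverP.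
- by move/(nagata_cover_negz _ _ d'xx) => [-> /XY ->]; apply/nagata_cover_negz.
Qed.

(** * Stability of the labelling condition under subsets and unions *)

Section Nagata.
Context {R : realType} {T : Type} (d : T -> T -> R).
Hypothesis dxx : forall x, d x x = 0.
Hypothesis dC : forall x y, d x y = d y x.
Hypothesis dtri : forall y x z, d x z <= d x y + d y z.
Implicit Types (X Y : set T) (n : nat).

Lemma nagata_le_sub X Y n : X `<=` Y -> nagata_le d Y n -> nagata_le d X n.
Proof.
move=> XY [c c0 H]; exists c => // s s0; have [phi [Hb Hm]] := H s s0.
exists phi; split=> [x y Xx Xy|g Xg]; first by apply: Hb; exact: XY.
by apply: Hm => i; exact: XY.
Qed.

(* Classes of X at distance at most s from Y are absorbed by the class of a
   nearby point of Y, for a labelling of Y at a larger scale. *)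
Lemma nagata_le_setU X Y n :
  nagata_le d X n -> nagata_le d Y n -> nagata_le d (X `|` Y) n.
Proof.
move=> [c1 c10 HX] [c2 c20 HY].
(* Points of [X] get replaced by points of [Y] at distance at most [(1 + c1) s]; two points within
   [s] then have replacements within [s + 2 (1 + c1) s = k s]. *)
pose k : R := 3 + 2 * c1.
have k0 : 0 < k by rewrite /k; lra.
exists (c1 + c2 * k + 2 * (1 + c1)) => [|s s0].
  by have := mulr_gt0 c20 k0; lra.
have [phi [Pb Pm]] := HX s s0.
have [psi [Qb Qm]] := HY (k * s) (mulr_gt0 k0 s0).
have c1s : 0 < c1 * s by rewrite mulr_gt0.
have c2s : 0 < c2 * (k * s) by rewrite !mulr_gt0.
pose near l y := Y y /\ exists a, [/\ X a, phi a = l & d a y <= s].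
(* One nearby point of [Y] is chosen per class and not per point, so that off [Y] the new label is a
   function of the old one. *)
have /choice[h Hh] l : exists o : option T, forall y, (o = Some y -> near l y) /\
    (o = None -> ~ near l y).
  case: (pselect (exists y, near l y)) => [[y ny]|nn].
    by exists (Some y) => z; split=> // -[<-].
  by exists None => y; split=> // _ ny; apply: nn; exists y.
pose chi x : set T + set T := if pselect (Y x) then inr (psi x) else
  if h (phi x) is Some y then inr (psi y) else inl (phi x).
have Hr x m : (X `|` Y) x -> chi x = inr m ->
    exists y, [/\ Y y, psi y = m & d x y <= (1 + c1) * s].
  rewrite /chi; case: pselect => [Yx _ [<-]|nY [Xx|//]].
    by exists x; split=> //; rewrite dxx mulr_ge0//; lra.
  case E : (h (phi x)) => [y|//] [<-].
  have [/(_ E)[Yy [a [Xa pa da]]] _] := Hh (phi x) y.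
  exists y; split=> //; have := Pb _ _ Xx Xa (esym pa); have := dtri a x y.
  by lra.
have Hl x l : (X `|` Y) x -> chi x = inl l ->
    [/\ X x, ~ Y x, phi x = l & forall y, ~ near l y].
  rewrite /chi; case: pselect => [//|nY [Xx|//]].
  case E : (h (phi x)) => [//|] [<-]; split=> // y.
  by have [_ /(_ E)] := Hh (phi x) y.
eexists; apply: (@labelling_class _ _ _ _ _ _ _ _ chi); split=> [x y XYx XYy|g XYg dg ginj].
  case Ex : (chi x) => [l|m]; case Ey : (chi y) => [l'|m'] // [e]; subst.
    have [Xx _ ex _] := Hl _ _ XYx Ex; have [Xy _ ey _] := Hl _ _ XYy Ey.
    have := Pb _ _ Xx Xy; rewrite ex ey => /(_ erefl); lra.
  have [x' [Yx' ex dx]] := Hr _ _ XYx Ex; have [y' [Yy' ey dy]] := Hr _ _ XYy Ey.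
  have := Qb _ _ Yx' Yy'; rewrite ex ey => /(_ erefl).
  by have := dtri x' x y; have := dtri y' x' y; rewrite (dC y' y); lra.
(* If some point keeps its label from [X], its class has no point of [Y] within [s]; so no point of
   [g] lies in [Y], and the new labels are functions of [phi]. Otherwise every point can be replaced
   by a point of [Y]. *)
case: (pselect (exists i l, chi (g i) = inl l)) => [[i [l Ei]]|nl].
  have [Xi nYi ei ni] := Hl _ _ (XYg i) Ei.
  have nY j : ~ Y (g j).
    by move=> Yj; apply: (ni (g j)); split=> //; exists (g i); split.
  have Xg j : X (g j) by case: (XYg j) => // /nY.
  apply: (Pm g Xg dg) => j1 j2 /= e; apply: ginj => /=.
  have chiE j : chi (g j) = if h (phi (g j)) is Some y then inr (psi y) else inl (phi (g j)).
    by rewrite /chi; case: pselect => // Yj; case: (nY j Yj).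
  by rewrite !chiE e.
have /choice[g' Hg'] i : exists y, [/\ Y y, chi (g i) = inr (psi y) & d (g i) y <= (1 + c1) * s].
  case E : (chi (g i)) => [l|m]; first by exfalso; apply: nl; exists i, l.
  by have [y [Yy <- dy]] := Hr _ _ (XYg i) E; exists y.
apply: (Qm g') => [i|i j|i j /= e].
- by have [] := Hg' i.
- have [_ _ di] := Hg' i; have [_ _ dj] := Hg' j; have := dg i j.
  have := dtri (g i) (g' i) (g j); have := dtri (g j) (g' i) (g' j).
  by rewrite (dC (g' i) (g i)) /k; lra.
- by apply: ginj; have [_ /= -> _] := Hg' i; have [_ -> _] := Hg' j; rewrite e.
Qed.

Lemma nagata_le_setUE X Y n :
  nagata_le d (X `|` Y) n <-> nagata_le d X n /\ nagata_le d Y n.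
Proof.
split=> [H|[HX HY]]; last exact: nagata_le_setU.
by split; apply: nagata_le_sub H; [exact: subsetUl|exact: subsetUr].
Qed.

Lemma nagata_le_set1 x n : nagata_le d [set x] n.
Proof.
exists 1 => // s s0; eexists; apply: (@labelling_class _ _ _ _ _ _ _ _ (fun=> tt)); split=> [_ _ -> -> _|g _ _ ginj].
  by rewrite dxx mul1r ltW.
by have /(congr1 val) := ginj ord0 (lift ord0 ord0) erefl.
Qed.

End Nagata.

(** Moves comparisons to the common domain, where two maps become two distance functions on one set;
    a point of the image is labelled through a chosen preimage. *)
Lemma nagata_le_image {R : realType} {T T' : Type} (d : T' -> T' -> R) (f : T -> T')
    (X : set T) n :
  nagata_le d (f @` X) n <-> nagata_le (fun x y => d (f x) (f y)) X n.
Proof.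
split=> -[c c0 H]; exists c => // s s0; have [phi [Hb Hm]] := H s s0.
  eexists; apply: (@labelling_class _ _ _ _ _ _ _ _ (phi \o f)); split=> [x y Xx Xy e|g Xg dg ginj].
    by apply: Hb => //.
  by apply: (Hm (f \o g)) => // i; exists (g i).
case: (pselect (exists x, X x)) => [[x0 Xx0]|nX]; last first.
  eexists; apply: (@labelling_class _ _ _ _ _ _ _ _ (fun=> tt)); split=> [a b [x Xx]|g /(_ ord0)[x Xx]];
  by exfalso; apply: nX; exists x.
have /choice[k Hk] y : exists x, (f @` X) y -> X x /\ f x = y.
  by case: (pselect ((f @` X) y)) => [[x Xx <-]|nXy]; [exists x|exists x0].
eexists; apply: (@labelling_class _ _ _ _ _ _ _ _ (phi \o k)); split=> [x y Xx Xy e|g Xg dg ginj].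
  have [Xkx <-] := Hk _ Xx; have [Xky <-] := Hk _ Xy.
  by apply: Hb.
apply: (Hm (k \o g)) => // [i|i j] /=; first by have [] := Hk _ (Xg i).
by have [_ ->] := Hk _ (Xg i); have [_ ->] := Hk _ (Xg j).
Qed.

(* Two metrics which on a family of shells are similar with ratio rho' / rho, and
   between distinct shells comparable to the larger weight: shells of small weight
   form one class, the others are too far apart to interact. *)
Lemma nagata_le_shells {R : realType} {T : Type} (d d' : T -> T -> R)
    (rho rho' : T -> R) (k C : R) (X : set T) n :
  0 < k -> 0 < C ->
  (forall x, X x -> 0 < rho x /\ 0 < rho' x) ->
  (forall x y, X x -> X y -> rho x = rho y -> rho' x = rho' y) ->
  (forall x y, X x -> X y -> d' x y <= C * Num.max (rho' x) (rho' y)) ->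
  (forall x y, X x -> X y -> rho x <> rho y -> k * Num.max (rho' x) (rho' y) <= d' x y) ->
  (forall x y, X x -> X y -> rho x = rho y ->
     d' x y * rho x <= C * (d x y * rho' x) /\ d x y * rho' x <= C * (d' x y * rho x)) ->
  nagata_le d X n -> nagata_le d' X n.
Proof.
move=> k0 C0 rho0 rhoE dub dlb dd [c c0 H].
(* The first term bounds the class of small weight, where [rho' <= s / k]. The second bounds a class
   inside one shell: it is labelled at scale [C s rho / rho'] for [d], has diameter at most [c]
   times that, and returning to [d'] costs a factor [C rho' / rho]. *)
exists (C / k + C * (c * C)) => [|s s0].
  by rewrite addr_gt0// ?divr_gt0// !mulr_gt0.
(* The scale for [d] that matches scale [s] for [d'] on a shell with weights [t] and [t']; the
   default 1 keeps it positive for all arguments. *)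
pose sc t t' := if (0 < t) && (0 < t') then C * s * t / t' else 1.
have sc0 t t' : 0 < sc t t'.
  by rewrite /sc; case: ifP => // /andP[t0 t'0]; rewrite divr_gt0// !mulr_gt0.
have /choice[F HF] (tt : R * R) : exists phi : T -> set T,
    labelling d X n (sc tt.1 tt.2) (c * sc tt.1 tt.2) phi by exact: H.
pose big x := s < k * rho' x.
pose chi x : option (R * R * set T) := if big x then
  Some (rho x, rho' x, F (rho x, rho' x) x) else None.
eexists; apply: (@labelling_class _ _ _ _ _ _ _ _ chi); split=> [x y Xx Xy|g Xg dg ginj].
  rewrite /chi /big; case: ltP => bx; case: ltP => b_y // e; last first.
    have := dub _ _ Xx Xy; rewrite maxEle => dxy.
    have : Num.max (rho' x) (rho' y) <= s / k.
      by rewrite ge_max !ler_pdivlMr// ![_ * k]mulrC bx b_y.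
    rewrite maxEle => hm.
    have := ler_wpM2l (ltW C0) hm.
    have : 0 < C * (c * C) * s by rewrite !mulr_gt0.
    by rewrite (_ : C * (s / k) = C / k * s); [lra|rewrite mulrA mulrAC].
  have [rx r'x] := rho0 _ Xx.
  case: e => er er'; rewrite -er -er' => eF.
  have := (HF (rho x, rho' x)).1 _ _ Xx Xy eF.
  rewrite /sc rx r'x /=.
  have [+ _] := dd _ _ Xx Xy er => h1 h2.
  have {}h2 : d x y * rho' x <= c * C * s * rho x.
    have := ler_wpM2r (ltW r'x) h2; congr (_ <= _); field; exact: lt0r_neq0.
  have {h1 h2} : d' x y * rho x <= (C * (c * C) * s) * rho x.
    by apply: le_trans h1 _; have := ler_wpM2l (ltW C0) h2; lra.
  rewrite ler_pM2r// => h.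
  have : 0 < C / k * s by rewrite !mulr_gt0// invr_gt0.
  by lra.
(* Points of different shells within [s] of each other both have small weight, hence the common
   label [None]; distinct labels thus force a single shell. *)
have core i j : rho (g i) <> rho (g j) -> chi (g i) = None /\ chi (g j) = None.
  move=> nij; have := le_trans (dlb _ _ (Xg i) (Xg j) nij) (dg i j).
  rewrite -ler_pdivlMl// ge_max !ler_pdivlMl// => /andP[h1 h2].
  by rewrite /chi /big !ltNge h1 h2.
have nij : ord0 != lift ord0 ord0 :> 'I_n.+2 by [].
case: (pselect (exists i j, rho (g i) <> rho (g j))) => [[i [j /[dup] eij /core[ei ej]]]|same].
  by apply: eij; congr (rho (g _)); apply: ginj; rewrite /= ei ej.
have {}same i : rho (g i) = rho (g ord0).
  by apply: contrapT => h; apply: same; exists i, ord0.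
have same' i : rho' (g i) = rho' (g ord0) by exact: rhoE.
case: (boolP (big (g ord0))) => b0; last first.
  move/eqP: nij; apply; apply: ginj.
  by rewrite /= /chi /big !same' -/(big _) (negbTE b0).
have [r0 r'0] := rho0 _ (Xg ord0).
apply: ((HF (rho (g ord0), rho' (g ord0))).2 g) => // [i j|i j /= e].
  have eij : rho (g i) = rho (g j) by rewrite !same.
  rewrite /= /sc r0 r'0 /= ler_pdivlMr//.
  have [_] := dd _ _ (Xg i) (Xg j) eij; rewrite same same' => h.
  apply: le_trans h _; rewrite -mulrA ler_pM2l// ler_pM2r//.
apply: ginj => /=.
by rewrite /chi /big !same' !same -/(big _) b0 e.
Qed.

(** * The chordal metric *)

Section Chordal.
Context {R : realType}.
Implicit Types (a b z w : R[i]) (x y : sphere R).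

(** The point with homogeneous coordinates [(a : b)]; the pair [(0, 0)] gives infinity as junk. *)
Definition hpt a b : sphere R := if b == 0 then None else Some (a / b).
Definition nrm a b : R := Num.sqrt (N a ^+ 2 + N b ^+ 2).

Lemma nrm_ge0 a b : 0 <= nrm a b. Proof. exact: sqrtr_ge0. Qed.

Lemma nrm_sqr a b : nrm a b ^+ 2 = N a ^+ 2 + N b ^+ 2.
Proof. by rewrite sqr_sqrtr// addr_ge0// sqr_ge0. Qed.

Lemma nrm_gt0 a b : (a != 0) || (b != 0) -> 0 < nrm a b.
Proof.
rewrite sqrtr_gt0 -!normc_gt0 => /orP[] h.
  by rewrite ltr_wpDr ?sqr_ge0// exprn_gt0.
by rewrite ltr_wpDl ?sqr_ge0// exprn_gt0.
Qed.

Lemma nrmC a b : nrm a b = nrm b a.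
Proof. by rewrite /nrm addrC. Qed.

Lemma nrm_conj a b : nrm (conjc a) (conjc b) = nrm a b.
Proof. by rewrite /nrm !normc_conj. Qed.

Lemma nrm_le a b : nrm a b <= N a + N b.
Proof.
rewrite -(ler_pXn2r (n := 2))// ?nnegrE ?nrm_ge0 ?addr_ge0 ?normc_ge0//.
rewrite nrm_sqr sqrrD.
by have := mulr_ge0 (normc_ge0 a) (normc_ge0 b); lra.
Qed.

Lemma nrm_ger a b : N b <= nrm a b.
Proof.
rewrite -(ler_pXn2r (n := 2))// ?nnegrE ?nrm_ge0 ?normc_ge0//.
by rewrite nrm_sqr lerDr sqr_ge0.
Qed.

Lemma cauchy_schwarz2 a b z w : N (a * z + b * w) <= nrm a b * nrm z w.
Proof.
apply: (le_trans (normc_add _ _)); rewrite !normcM'.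
rewrite -(ler_pXn2r (n := 2))// ?nnegrE ?addr_ge0 ?mulr_ge0 ?normc_ge0 ?nrm_ge0//.
rewrite exprMn !nrm_sqr; have := sqr_ge0 (N a * N w - N b * N z).
by lra.
Qed.

Lemma hptK x : exists a b, x = hpt a b /\ ((a != 0) || (b != 0)).
Proof.
case: x => [z|]; rewrite /hpt.
  by exists z, 1; rewrite oner_eq0 divr1 orbT.
by exists 1, 0; rewrite eqxx oner_eq0.
Qed.

Lemma hpt_Some z : Some z = hpt z 1.
Proof. by rewrite /hpt oner_eq0 divr1. Qed.

Lemma hpt_scale z a b : z != 0 -> hpt (z * a) (z * b) = hpt a b.
Proof.
by move=> z0; rewrite /hpt mulf_eq0 (negbTE z0) /=; case: eqP => // /eqP b0; rewrite -mulf_div divff// mul1r.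
Qed.

(** The determinant formula absorbs the four cases at infinity in [qdist]; the metric axioms and the
    later estimates are read off from it. *)
Lemma qdist_hpt a b z w : (a != 0) || (b != 0) -> (z != 0) || (w != 0) ->
  qdist (hpt a b) (hpt z w) = N (a * w - z * b) / (nrm a b * nrm z w).
Proof.
move=> ab zw.
have E u v : v != 0 -> Num.sqrt (1 + N (u / v) ^+ 2) = nrm u v / N v.
  move=> v0; have Nv : N v != 0 by rewrite normc_eq0.
  apply/eqP; rewrite -(eqrXn2 (n := 2))// ?sqrtr_ge0 ?divr_ge0 ?nrm_ge0 ?normc_ge0//.
  rewrite sqr_sqrtr ?addr_ge0 ?sqr_ge0// exprMn nrm_sqr normc_div.
  by apply/eqP; field.
have E0 u : nrm u 0 = N u.
  by rewrite /nrm (_ : N 0 = 0) ?expr0n ?addr0 ?sqrtr_sqr ?ger0_norm ?normc_ge0//; apply/eqP; rewrite normc_eq0.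
have Nn0 u v : (u != 0) || (v != 0) -> nrm u v != 0 by move=> h; rewrite gt_eqF ?nrm_gt0.
rewrite /hpt /qdist.
case: (eqVneq b 0) ab => [->|b0] ab; case: (eqVneq w 0) zw => [->|w0] zw.
- by rewrite !mulr0 subrr -[N 0]/(N 0) (_ : N 0 = 0) ?mul0r//; apply/eqP; rewrite normc_eq0.
- rewrite /= ?eqxx orbF in ab.
  rewrite E// mulr0 subr0 E0 normcM' div1r invfM invrK.
  have := Nn0 z w (introT orP (or_intror w0)); have : N a != 0 by rewrite normc_eq0.
  by move=> ? ?; field; apply/andP.
- rewrite /= ?eqxx orbF in zw.
  rewrite E// mulr0 sub0r normc_opp E0 normcM' div1r invfM invrK.
  have := Nn0 a b (introT orP (or_intror b0)); have : N z != 0 by rewrite normc_eq0.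
  by move=> ? ?; field; apply/andP.
- rewrite sqrtrM ?addr_ge0 ?sqr_ge0// !E//.
  have -> : a / b - z / w = (a * w - z * b) / (b * w) by field; apply/andP.
  rewrite normc_div normcM'.
  have := Nn0 a b (introT orP (or_intror b0)); have := Nn0 z w (introT orP (or_intror w0)).
  have : N b != 0 by rewrite normc_eq0.
  have : N w != 0 by rewrite normc_eq0.
  by move=> ? ? ? ?; field; apply/and4P.
Qed.

Lemma qdistxx x : qdist x x = 0.
Proof.
have [a [b [-> ab]]] := hptK x; rewrite qdist_hpt// subrr (_ : N 0 = 0) ?mul0r//.
by apply/eqP; rewrite normc_eq0.
Qed.

Lemma qdistC x y : qdist x y = qdist y x.
Proof.
have [a [b [-> ab]]] := hptK x; have [z [w [-> zw]]] := hptK y.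
by rewrite !qdist_hpt// normc_sub [nrm _ _ * _]mulrC.
Qed.

Lemma qdist_ge0 x y : 0 <= qdist x y.
Proof.
have [a [b [-> ab]]] := hptK x; have [z [w [-> zw]]] := hptK y.
by rewrite qdist_hpt// divr_ge0 ?mulr_ge0 ?nrm_ge0 ?normc_ge0.
Qed.

Lemma qdist_eq0 x y : qdist x y = 0 -> x = y.
Proof.
have [a [b [-> ab]]] := hptK x; have [z [w [-> zw]]] := hptK y.
rewrite qdist_hpt// => /eqP; rewrite mulf_eq0 invr_eq0 mulf_eq0.
rewrite !(gt_eqF (nrm_gt0 _))// !orbF normc_eq0 subr_eq0 => /eqP e.
rewrite /hpt; case: (eqVneq b 0) ab e => [->|b0] ab e; case: (eqVneq w 0) zw e => [->|w0] zw //.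
- rewrite /= ?eqxx orbF in ab; move=> /eqP.
  by rewrite mulr0 mulf_eq0 (negbTE ab) (negbTE w0).
- rewrite /= ?eqxx orbF in zw; move=> /eqP.
  by rewrite mulr0 eq_sym mulf_eq0 (negbTE zw) (negbTE b0).
- by move=> e; congr Some; apply/eqP; rewrite eqr_div// e mulrC.
Qed.

(* <v, v> (x ^ y) = <y, v> (x ^ v) + <x, v> (v ^ y) in homogeneous coordinates,
   where |<x, v>| <= |x| |v|. *)
Lemma qdist_tri y x (z : sphere R) : qdist x z <= qdist x y + qdist y z.
Proof.
have [a [b [-> ab]]] := hptK x; have [c [d [-> cd]]] := hptK y; have [e [f [-> ef]]] := hptK z.
rewrite !qdist_hpt//.
have A0 := nrm_gt0 ab; have C0 := nrm_gt0 cd; have E0 := nrm_gt0 ef.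
have H : N (a * f - e * b) * nrm c d ^+ 2 <=
    N (a * d - c * b) * (nrm e f * nrm c d) + N (c * f - e * d) * (nrm a b * nrm c d).
  rewrite -(nrm_conj c d).
  apply: le_trans (lerD (ler_wpM2l (normc_ge0 _) (cauchy_schwarz2 e f (conjc c) (conjc d)))
                        (ler_wpM2l (normc_ge0 _) (cauchy_schwarz2 a b (conjc c) (conjc d)))).
  rewrite -!normcM'; apply: le_trans _ (normc_add _ _).
  rewrite [X in _ <= N X](_ : _ = (a * f - e * b) * (c * conjc c + d * conjc d)); last by ring.
  by rewrite !mulc_conj -raddfD /= normcM' normcZ nrm_conj nrm_sqr ger0_norm// addr_ge0// sqr_ge0.
rewrite -(ler_pM2r (_ : 0 < nrm a b * nrm e f * nrm c d ^+ 2)); last by rewrite !mulr_gt0.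
have -> : N (a * f - e * b) / (nrm a b * nrm e f) * (nrm a b * nrm e f * nrm c d ^+ 2) =
   N (a * f - e * b) * nrm c d ^+ 2 by field; rewrite !gt_eqF.
apply: le_trans H _; rewrite le_eqVlt; apply/orP; left; apply/eqP; field.
by rewrite !gt_eqF.
Qed.

Lemma qdist_le_dist (z w : R[i]) : qdist (Some z) (Some w) <= N (z - w).
Proof.
rewrite !hpt_Some qdist_hpt ?oner_eq0 ?orbT// !mulr1.
have n1 u : 1 <= nrm u (1 : R[i]).
  by apply: le_trans (nrm_ger _ _); rewrite normc1E.
have h : 1 <= nrm z 1 * nrm w 1 by have := ler_pM ler01 ler01 (n1 z) (n1 w); rewrite mulr1.
by rewrite ler_pdivrMr ?(lt_le_trans ltr01)// ler_peMr// normc_ge0.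
Qed.

Definition sinv x : sphere R :=
  if x is Some z then (if z == 0 then None else Some z^-1) else Some 0.

Lemma sinv_hpt a b : (a != 0) || (b != 0) -> sinv (hpt a b) = hpt b a.
Proof.
rewrite /hpt /sinv; case: (eqVneq b 0) => [->|b0] ab.
  by rewrite /= ?eqxx orbF in ab; rewrite (negbTE ab) mul0r.
by rewrite mulf_eq0 invr_eq0 (negbTE b0) orbF; case: eqP => // _; rewrite invf_div.
Qed.

(** Exchanging the coordinates changes the determinant only by a sign. This isometry carries the
    analysis near 0 to infinity. *)
Lemma qdist_sinv x y : qdist (sinv x) (sinv y) = qdist x y.
Proof.
have [a [b [-> ab]]] := hptK x; have [z [w [-> zw]]] := hptK y.
rewrite !sinv_hpt// (qdist_hpt ab zw) qdist_hpt; [|by rewrite orbC|by rewrite orbC].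
rewrite [nrm b a]nrmC [nrm w z]nrmC normc_sub.
by rewrite [b * z]mulrC [w * a]mulrC.
Qed.

End Chordal.

(** * Maps preserving the Nagata dimension of every subset *)

Section Good.
Context {R : realType}.
Local Notation d := (@qdist R).

(** Two maps from one domain are compared, rather than a set with its image, so that [e] can be
    either chart of the sphere and the property can be checked on finitely many pieces. *)
Definition good {T : Type} (e f : T -> sphere R) (S : set T) :=
  forall X n, X `<=` S -> nagata_le d (e @` X) n <-> nagata_le d (f @` X) n.

Lemma good_sub {T : Type} (e f : T -> sphere R) (S S' : set T) :
  S' `<=` S -> good e f S -> good e f S'.
Proof. by move=> SS H X n XS; apply: H; exact: subset_trans SS. Qed.

Lemma good_setU {T : Type} (e f : T -> sphere R) (S S' : set T) :
  good e f S -> good e f S' -> good e f (S `|` S').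
Proof.
move=> HS HS' X n XS.
have -> : X = (X `&` S) `|` (X `&` S') by rewrite -setIUr; apply/esym/setIidPl.
rewrite !image_setU !(nagata_le_setUE (@qdistxx R) (@qdistC R) (@qdist_tri R)).
by rewrite (HS _ n (@subIsetr _ X S)) (HS' _ n (@subIsetr _ X S')).
Qed.

Lemma good_set1 {T : Type} (e f : T -> sphere R) x : good e f [set x].
Proof.
move=> X n Xx; case: (pselect (X x)) => [xX|nX].
  have -> : X = [set x] by apply/seteqP; split=> // _ ->.
  by rewrite !image_set1; split=> _; apply: nagata_le_set1; exact: qdistxx.
have -> : X = set0 by apply/seteqP; split=> // y Xy; apply: nX; rewrite -(Xx _ Xy).
by rewrite !image_set0.
Qed.

Lemma good_preimage {T T' : Type} (g : T -> T') (e f : T' -> sphere R) S :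
  good (e \o g) (f \o g) S -> good e f (g @` S).
Proof.
move=> H X n XS.
have -> : X = g @` (S `&` (g @^-1` X)).
  apply/seteqP; split=> [x Xx|_ [x [_ gx] <-]//].
  by have [y Sy yx] := XS _ Xx; exists y => //; split=> //=; rewrite yx.
by rewrite !image_comp; apply: H; exact: subIsetl.
Qed.

Lemma nagata_le_eqd {T : Type} (d1 d2 : T -> T -> R) (X : set T) n :
  (forall x y, d1 x y = d2 x y) -> nagata_le d1 X n -> nagata_le d2 X n.
Proof. by move=> H; congr (nagata_le _ _ _); do 2 apply/funext => ?. Qed.

Lemma good_isometry {T : Type} (e e' f : T -> sphere R) S :
  (forall x y, d (e x) (e y) = d (e' x) (e' y)) -> good e f S -> good e' f S.
Proof.
move=> H He X n XS; rewrite -(He X n XS) !nagata_le_image.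
by split; apply: nagata_le_eqd.
Qed.

Lemma dyadic (t : R) : 0 < t <= 1 -> exists m, (1/2) ^+ m.+1 < t <= (1/2) ^+ m.
Proof.
move=> /andP[t0 t1].
have ex : exists m, (1/2) ^+ m.+1 < t.
  have [m Hm] := half_pow_lt 1 t0; exists m; apply: le_lt_trans Hm.
  rewrite exprS expr_div_n expr1n.
  have : 0 < 1 / 2 ^+ m :> R by rewrite divr_gt0// exprn_gt0.
  by lra.
exists (ex_minn ex); case: ex_minnP => m -> Hm /=.
case: m Hm => [|m] Hm; first by rewrite expr0.
by rewrite leNgt; apply/negP => /Hm; rewrite ltnn.
Qed.

(* the shells 2^-(m+1) < |x - a| <= 2^-m with m of fixed parity are pairwise far *)
Lemma good_annuli (e f : R[i] -> sphere R) (S : set R[i]) (a : R[i]) (j : nat) (c C : R) :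
  0 < c -> 0 < C ->
  (forall x, S x -> 0 < N (x - a) <= 1) ->
  (forall x y, S x -> S y -> c * N (x - y) <= d (e x) (e y) <= C * N (x - y)) ->
  (forall x y, S x -> S y ->
    c * (N (x - y) * Num.max (N (x - a)) (N (y - a)) ^+ j) <= d (f x) (f y) <=
    C * (N (x - y) * Num.max (N (x - a)) (N (y - a)) ^+ j)) ->
  good e f S.
Proof.
move=> c0 C0 S1 He Hf.
have /choice[m Hm] x : exists m, S x -> (1/2) ^+ m.+1 < N (x - a) <= (1/2) ^+ m.
  case: (pselect (S x)) => [Sx|]; last by exists 0%N.
  by have [m Hm] := dyadic (S1 _ Sx); exists m.
suff H b : good e f (S `&` [set x | odd (m x) = b]).
  apply: good_sub (good_setU (H true) (H false)) => x Sx.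
  by case E : (odd (m x)); [left|right].
pose rho x : R := (1/2) ^+ m x.
have rho0 x : 0 < rho x by rewrite exprn_gt0//; lra.
have S_rho x : S x -> rho x / 2 < N (x - a) <= rho x.
  by move/Hm; rewrite /rho exprS; lra.
have gap x y : odd (m x) = odd (m y) -> (m x < m y)%N -> rho y <= rho x / 4.
  move=> pxy mxy; have {}mxy : ((m x).+2 <= m y)%N.
    by rewrite ltn_neqAle mxy andbT; apply/eqP => mE; move: pxy; rewrite -mE /=; case: odd.
  have : rho y <= (1/2) ^+ (m x).+2 by apply: ler_wiXn2l mxy => //; lra.
  by rewrite /rho !exprS; lra.
have rhoE x y : m x = m y -> rho x = rho y by rewrite /rho => ->.
pose M x y := Num.max (rho x) (rho y).
(* The farther point has distance above [M / 2] from [a], the other at most [M / 4], by the factor 4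
   between distinct shells of equal parity. *)
have far x y : S x -> S y -> odd (m x) = odd (m y) -> rho x <> rho y ->
    M x y / 4 <= N (x - y).
  move=> Sx Sy pxy nxy; have := S_rho _ Sx; have := S_rho _ Sy; rewrite /M.
  have : N (x - a) - N (y - a) <= N (x - y) /\ N (y - a) - N (x - a) <= N (x - y).
    split; first by apply: le_trans (normc_triB _ _) _; rewrite (_ : _ - (y - a) = x - y)//; ring.
    by rewrite [N (x - y)]normc_sub; apply: le_trans (normc_triB _ _) _; rewrite (_ : _ - (x - a) = y - x)//; ring.
  move: (rho0 x) (rho0 y); case: (ltngtP (m x) (m y)) => h.
  - by have := gap _ _ pxy h => ? ? ?; rewrite max_l; lra.
  - by have := gap _ _ (esym pxy) h => ? ? ?; rewrite max_r; lra.
  - by have := nxy (rhoE _ _ h).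
have maxN x y : S x -> S y ->
    M x y / 2 <= Num.max (N (x - a)) (N (y - a)) <= M x y.
  move=> /S_rho/andP[h1 h2] /S_rho/andP[h3 h4]; rewrite /M.
  rewrite ler_pdivrMr// !ge_max !le_max; apply/andP; split; last first.
    by rewrite h2 h4 orbT.
  have -> : rho x <= Num.max (N (x - a)) (N (y - a)) * 2.
    by rewrite -ler_pdivrMr// le_max (ltW h1).
  by rewrite -ler_pdivrMr// le_max (ltW h3) orbT.
have dist x y : S x -> S y -> N (x - y) <= 2 * M x y.
  move=> Sx Sy; have := normc_tri a x y; rewrite (normc_sub a).
  have /andP[_] := maxN _ _ Sx Sy; rewrite ge_max => /andP[]; lra.
have M0 x y : 0 < M x y by rewrite /M lt_max rho0.
have MX x y k : M x y ^+ k = Num.max (rho x ^+ k) (rho y ^+ k).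
  rewrite /M; case: (leP (rho x) (rho y)) => h.
    by rewrite max_r// lerXn2r// nnegrE ltW.
  by rewrite max_l// lerXn2r ?nnegrE// ltW.
have E4 : (4 : R) ^+ j.+1 = 4 * 4 ^+ j by rewrite exprS.
have E4' : (1 : R) <= 4 ^+ j by rewrite exprn_ege1//; lra.
have E42 : (2 : R) ^+ j <= 4 ^+ j by rewrite lerXn2r ?nnegrE//; lra.
(* The term [2 C] reflects [|x - y| <= 2 M]; the other absorbs the quotient of the constants and the
   loss [2 ^ j] from replacing the maximum by the radius of the shell. *)
pose K := C / c * 4 ^+ j.+1 + 2 * C.
have Cc : 0 < C / c by rewrite divr_gt0.
have E40 : 0 < 4 ^+ j.+1 :> R by rewrite exprn_gt0.
have K0 : 0 < K by rewrite /K; have := mulr_gt0 Cc E40; lra.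
(* Between different shells [|x - y| >= M / 4] and the maximum is at least [M / 2], so the lower
   bound loses at most [4 ^ (j + 1)]. *)
pose k := c / 4 ^+ j.+1.
have k0 : 0 < k by rewrite divr_gt0// exprn_gt0.
have C2K : 2 * C <= K by rewrite lerDr mulr_ge0 ?exprn_ge0// ltW.
have kc : k <= c / 4.
  rewrite /k; apply: ler_wpM2l; first exact: ltW.
  by rewrite lef_pV2 ?posrE ?exprn_gt0// E4; lra.
have eub x y : S x -> S y -> d (e x) (e y) <= K * M x y.
  move=> Sx Sy; have /andP[_ h] := He _ _ Sx Sy; apply: (le_trans h).
  apply: (@le_trans _ _ (2 * C * M x y)); last by rewrite ler_pM2r.
  by rewrite (mulrC 2) -mulrA ler_pM2l// dist.
have fub x y : S x -> S y -> d (f x) (f y) <= K * M x y ^+ j.+1.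
  move=> Sx Sy; have /andP[_ h] := Hf _ _ Sx Sy; apply: (le_trans h).
  apply: (@le_trans _ _ (2 * C * M x y ^+ j.+1)); last by rewrite ler_pM2r ?exprn_gt0.
  rewrite (mulrC 2) -mulrA ler_pM2l// exprS mulrA.
  apply: ler_pM; rewrite ?normc_ge0 ?dist// ?exprn_ge0 ?le_max ?normc_ge0//.
  have /andP[_ h'] := maxN _ _ Sx Sy.
  by apply: lerXn2r; rewrite ?nnegrE// ?le_max ?normc_ge0// ltW.
have elb x y : S x -> S y -> odd (m x) = odd (m y) -> rho x <> rho y ->
    k * M x y <= d (e x) (e y).
  move=> Sx Sy pxy nxy; have /andP[h _] := He _ _ Sx Sy; apply: le_trans h.
  apply: (@le_trans _ _ (c / 4 * M x y)); first by rewrite ler_pM2r.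
  by rewrite mulrAC -mulrA ler_pM2l// far.
have max_lb x y : S x -> S y -> M x y ^+ j <= 2 ^+ j * Num.max (N (x - a)) (N (y - a)) ^+ j.
  move=> Sx Sy; rewrite -exprMn; have /andP[h' _] := maxN _ _ Sx Sy.
  have mx0 : 0 <= Num.max (N (x - a)) (N (y - a)) by rewrite le_max normc_ge0.
  apply: lerXn2r; [by rewrite nnegrE ltW|by rewrite nnegrE mulr_ge0|].
  by rewrite mulrC -ler_pdivrMr.
have flb x y : S x -> S y -> odd (m x) = odd (m y) -> rho x <> rho y ->
    k * M x y ^+ j.+1 <= d (f x) (f y).
  move=> Sx Sy pxy nxy; have /andP[h _] := Hf _ _ Sx Sy; apply: le_trans h.
  rewrite (_ : k * _ = c * (M x y ^+ j.+1 / 4 ^+ j.+1)); last by rewrite /k mulrAC mulrA.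
  rewrite ler_pM2l// ler_pdivrMr ?exprn_gt0// E4 exprS [leRHS]mulrACA [_ * 4]mulrC.
  have mx0 : 0 <= Num.max (N (x - a)) (N (y - a)) by rewrite le_max normc_ge0.
  apply: ler_pM; rewrite ?exprn_ge0 ?(ltW (M0 _ _))//.
    by have := far _ _ Sx Sy pxy nxy; lra.
  apply: le_trans (max_lb _ _ Sx Sy) _.
  by rewrite mulrC; apply: ler_wpM2l => //; rewrite exprn_ge0.
(* On one shell the two metrics differ, up to constants, by the factor [rho ^ j], the ratio of the
   weights [rho ^ (j + 1)] and [rho]. *)
have sim x y : S x -> S y -> rho x = rho y ->
    d (f x) (f y) * rho x <= K * (d (e x) (e y) * rho x ^+ j.+1) /\
    d (e x) (e y) * rho x ^+ j.+1 <= K * (d (f x) (f y) * rho x).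
  move=> Sx Sy exy; rewrite exprSr !mulrA !ler_pM2r//.
  have Mx : M x y = rho x by rewrite /M -exy maxxx.
  have mx0 : 0 <= Num.max (N (x - a)) (N (y - a)) by rewrite le_max normc_ge0.
  have [/andP[e1 e2] /andP[f1 f2]] := (He _ _ Sx Sy, Hf _ _ Sx Sy).
  have /andP[_ hm] := maxN _ _ Sx Sy; have hm' := max_lb _ _ Sx Sy.
  rewrite Mx in hm hm'.
  have rj : 0 < rho x ^+ j by rewrite exprn_gt0.
  have CcK : C / c <= K.
    have : C / c <= C / c * 4 ^+ j.+1 by rewrite ler_peMr ?(ltW Cc)// E4; lra.
    by rewrite /K; lra.
  have CcK2 : C / c * 2 ^+ j <= K.
    have : C / c * 2 ^+ j <= C / c * 4 ^+ j.+1 by rewrite ler_pM2l// E4; lra.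
    by rewrite /K; lra.
  split.
    apply: (le_trans f2).
    apply: (@le_trans _ _ (C / c * d (e x) (e y) * rho x ^+ j)).
      rewrite mulrA; apply: ler_pM; rewrite ?exprn_ge0 ?mulr_ge0 ?normc_ge0 ?(ltW C0)//.
        by rewrite -mulrA ler_pM2l// mulrC ler_pdivlMr// mulrC.
      by apply: lerXn2r; rewrite ?nnegrE// ltW.
    by rewrite ler_pM2r// ler_wpM2r// qdist_ge0.
  apply: (@le_trans _ _ (C / c * 2 ^+ j * d (f x) (f y))); last first.
    by rewrite ler_wpM2r// qdist_ge0.
  apply: (@le_trans _ _ (C * N (x - y) * (2 ^+ j * Num.max (N (x - a)) (N (y - a)) ^+ j))).
    by apply: ler_pM; rewrite ?qdist_ge0 ?(ltW rj).
  rewrite [leLHS](_ : _ = C / c * 2 ^+ j * (c * (N (x - y) * Num.max (N (x - a)) (N (y - a)) ^+ j))).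
    by rewrite ler_pM2l// mulr_gt0// exprn_gt0.
  by field; exact: lt0r_neq0.
move=> X n XS.
have XS1 x : X x -> S x by move=> /XS[].
have par x y : X x -> X y -> odd (m x) = odd (m y) by move=> /XS[_ /= ->] /XS[_ /= ->].
have rhoX0 k' x : 0 < rho x ^+ k' by rewrite exprn_gt0.
rewrite !nagata_le_image; split.
- apply: (@nagata_le_shells _ _ _ _ rho (fun x => rho x ^+ j.+1) k K) => //.
  + by move=> x y _ _ ->.
  + by move=> x y /XS1 Sx /XS1 Sy; rewrite -MX; exact: fub.
  + by move=> x y Xx Xy nxy; rewrite -MX; apply: flb => //; [exact: XS1|exact: XS1|exact: par].
  + by move=> x y /XS1 Sx /XS1 Sy; exact: sim.
- have rhoX_inj x y : rho x ^+ j.+1 = rho y ^+ j.+1 -> rho x = rho y.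
    by move/eqP; rewrite eqrXn2// ?ltW// => /eqP.
  apply: (@nagata_le_shells _ _ _ _ (fun x => rho x ^+ j.+1) rho k K) => //.
  + by move=> x y _ _; exact: rhoX_inj.
  + by move=> x y /XS1 Sx /XS1 Sy; exact: eub.
  + move=> x y Xx Xy nxy; apply: elb => //; [exact: XS1|exact: XS1|exact: par|].
    by move=> exy; apply: nxy; rewrite exy.
  + by move=> x y /XS1 Sx /XS1 Sy /rhoX_inj/(sim _ _ Sx Sy)[].
Qed.
End Good.

(** * Local structure of rational functions *)

Section Powers.
Context {R : realType}.
Implicit Types (z w : R[i]).

Lemma normc_subX z w (M : R) n : N z <= M -> N w <= M ->
  N (z ^+ n.+1 - w ^+ n.+1) <= n.+1%:R * (N (z - w) * M ^+ n).
Proof.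
move=> zM wM; have M0 : 0 <= M by apply: le_trans zM; exact: normc_ge0.
rewrite subrXX normcM' mulrCA; apply: ler_wpM2l; first exact: normc_ge0.
apply: (le_trans (normc_sum _ _ _)).
rewrite mulr_natl -[X in _ *+ X]card_ord -sumr_const.
apply: ler_sum => i _; rewrite normcM' !normcX.
have -> : M ^+ n = M ^+ (n - i) * M ^+ i by rewrite -exprD subnK// -ltnS ltn_ord.
by apply: ler_pM; rewrite ?exprn_ge0 ?normc_ge0//; apply: lerXn2r; rewrite ?nnegrE ?normc_ge0.
Qed.

Definition dir z := z / (N z)%:C.

Lemma dir_norm z : z != 0 -> N (dir z) = 1.
Proof.
move=> z0; rewrite normc_div normcZ ger0_norm ?normc_ge0// divff//.
by rewrite normc_eq0.
Qed.

Lemma dirK z : z = (N z)%:C * dir z.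
Proof.
have [->|z0] := eqVneq z 0; first by rewrite /dir mul0r mulr0.
rewrite /dir mulrCA divff ?mulr1//.
by apply: contra_neq z0 => /complexI/eqP; rewrite normc_eq0 => /eqP.
Qed.

(* for nearly parallel z and w the terms z^(j-i) w^i nearly have the direction
   of z^j, so there is no cancellation in (z^(j+1) - w^(j+1)) / (z - w) *)
Lemma sector_pow z w j (eta : R) : z != 0 -> w != 0 -> N (dir z - dir w) <= eta ->
  j%:R * eta <= 1 / 2 ->
  1 / 2 * (N (z - w) * Num.max (N z) (N w) ^+ j) <= N (z ^+ j.+1 - w ^+ j.+1).
Proof.
move=> z0 w0 zw jeta.
rewrite subrXX normcM' mulrCA; apply: ler_wpM2l; first exact: normc_ge0.
pose t := N z; pose s := N w.
have [[th Eth] [ph Eph]] : (exists u, u = dir z) /\ (exists u, u = dir w).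
  by split; eexists.
have t0 : 0 < t by rewrite normc_gt0.
have s0 : 0 < s by rewrite normc_gt0.
pose c (i : 'I_j.+1) : R := t ^+ (j - i) * s ^+ i.
have c0 i : 0 <= c i by rewrite mulr_ge0// exprn_ge0// ltW.
pose S := \sum_i c i.
have S0 : 0 <= S by apply: sumr_ge0.
(* The summands have moduli [c i]; turning the direction of [w] into that of [z] in all of them
   gives the main part [S th^j], and the errors add up to at most [S / 2]. *)
have -> : \sum_(i < j.+1) z ^+ (j.+1.-1 - i) * w ^+ i =
   S%:C * th ^+ j + \sum_(i < j.+1) (c i)%:C * (th ^+ (j - i) * (ph ^+ i - th ^+ i)).
  rewrite /S rmorph_sum /= mulr_suml -big_split /=; apply: eq_bigr => i _.
  rewrite {1}(dirK z) {1}(dirK w) -/t -/s -Eth -Eph !exprMn.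
  have -> : th ^+ j = th ^+ (j - i) * th ^+ i by rewrite -exprD subnK// -ltnS ltn_ord.
  by rewrite rmorphM /= !rmorphXn /=; ring.
have thn : N th = 1 by rewrite Eth dir_norm.
have phn : N ph = 1 by rewrite Eph dir_norm.
have Hi i : (i <= j)%N -> N (ph ^+ i - th ^+ i) <= j%:R * eta.
  case: i => [|i] ij; first by rewrite !expr0 subrr normc0E mulr_ge0// (le_trans _ zw)// normc_ge0.
  have := @normc_subX ph th 1 i; rewrite phn thn expr1n mulr1 => /(_ (lexx _) (lexx _)) h.
  apply: (le_trans h); apply: ler_pM; rewrite ?ler0n ?normc_ge0 ?ler_nat//.
  by rewrite normc_sub Eth Eph.
have H1 : N (\sum_(i < j.+1) (c i)%:C * (th ^+ (j - i) * (ph ^+ i - th ^+ i))) <= S * (1/2).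
  apply: (le_trans (normc_sum _ _ _)); rewrite mulr_suml.
  apply: ler_sum => i _; rewrite !normcM' normcZ ger0_norm// normcX thn expr1n mul1r.
  apply: ler_wpM2l => //; apply: le_trans jeta.
  by apply: Hi; rewrite -ltnS.
have H2 : N (S%:C * th ^+ j) = S by rewrite normcM' normcZ normcX thn expr1n mulr1 ger0_norm.
have H3 : Num.max t s ^+ j <= S.
  have sub i : c i <= S by rewrite /S (bigD1 i)//= lerDl sumr_ge0.
  case: (leP t s) => _.
    by apply: le_trans (sub ord_max); rewrite /c /= subnn expr0 mul1r.
  by apply: le_trans (sub ord0); rewrite /c /= subn0 expr0 mulr1.
have := normc_triB (S%:C * th ^+ j) (- \sum_(i < j.+1) (c i)%:C * (th ^+ (j - i) * (ph ^+ i - th ^+ i))).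
by rewrite opprK normc_opp H2; lra.
Qed.

(** Induction along Horner's scheme, with one constant for the size and the Lipschitz bound. *)
Lemma poly_local_bound (p : {poly R[i]}) a : exists2 B : R, 0 < B &
  forall z w, N (z - a) <= 1 -> N (w - a) <= 1 ->
   N p.[z] <= B /\ N (p.[z] - p.[w]) <= B * N (z - w).
Proof.
elim/poly_ind: p => [|p c [B B0 H]].
  exists 1 => // z w _ _; rewrite !horner0 subrr normc0E//.
  by rewrite mul1r normc_ge0.
have a1 : 0 < N a + 1 by have := normc_ge0 a; lra.
exists (B * (N a + 1) + B + N c) => [|z w Hz Hw].
  by have := mulr_gt0 B0 a1; have := normc_ge0 c; lra.
have [H1 H2] := H _ _ Hz Hw; have [H3 _] := H _ _ Hw Hz.
have za : N z <= N a + 1 by have := normc_triB z a; lra.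
have Bz u : u <= B -> 0 <= u -> u * N z <= B * (N a + 1).
  by move=> uB u0; apply: ler_pM => //; exact: normc_ge0.
rewrite !hornerE; split.
  apply: (le_trans (normc_add _ _)); rewrite normcM'.
  by have := Bz _ H1 (normc_ge0 _); lra.
rewrite (_ : _ - _ = (p.[z] - p.[w]) * z + p.[w] * (z - w)); last by ring.
apply: (le_trans (normc_add _ _)); rewrite !normcM'.
have zw0 := normc_ge0 (z - w).
have : N (p.[z] - p.[w]) * N z <= B * N (z - w) * (N a + 1).
  by apply: ler_pM; rewrite ?normc_ge0.
have : N p.[w] * N (z - w) <= B * N (z - w) by apply: ler_wpM2r.
by have := mulr_ge0 (normc_ge0 c) zw0; lra.
Qed.

Lemma poly_local_lb (p : {poly R[i]}) a : p.[a] != 0 -> exists2 e : R, 0 < e <= 1 &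
  exists2 b : R, 0 < b & forall z, N (z - a) < e -> b <= N p.[z].
Proof.
rewrite -normc_gt0 => pa; have [B B0 H] := poly_local_bound p a.
exists (Num.min 1 (N p.[a] / (2 * B))).
  by rewrite lt_min ge_min lexx ltr01 /= andbT divr_gt0// mulr_gt0.
exists (N p.[a] / 2); first by lra.
move=> z; rewrite lt_min => /andP[z1 z2].
have aa : N (a - a) <= 1 by rewrite subrr normc0E.
have [_ h] := H _ _ aa (ltW z1); have := normc_triB p.[a] p.[z].
rewrite ltr_pdivlMr ?mulr_gt0// in z2.
by rewrite [N (a - z)]normc_sub in h; lra.
Qed.

Lemma nrm_local_lb (p q : {poly R[i]}) a : (p.[a] != 0) || (q.[a] != 0) ->
  exists2 e : R, 0 < e <= 1 &
    exists2 v : R, 0 < v & forall z, N (z - a) < e -> v <= nrm p.[z] q.[z].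
Proof.
case/orP=> h; have [e e0 [b b0 H]] := poly_local_lb h; exists e => //; exists b => // z /H h'.
  by rewrite nrmC (le_trans h') ?nrm_ger.
by rewrite (le_trans h') ?nrm_ger.
Qed.

(* the second summand of the expansion below is of higher order in w *)
Lemma cross_estimate z w (u u' q q' : R[i]) j (eta b1 b2 Bu BQ : R) :
  z != 0 -> w != 0 -> N (dir z - dir w) <= eta -> j%:R * eta <= 1 / 2 ->
  0 < b1 <= N u -> 0 < b2 <= N q' -> N u <= Bu -> N u' <= Bu -> N q <= BQ -> N q' <= BQ ->
  N (u - u') <= Bu * N (z - w) -> N (q' - q) <= BQ * N (z - w) ->
  N w <= 1 -> N w * (8 * (Bu * BQ)) <= b1 * b2 ->
  b1 * b2 / 4 * (N (z - w) * Num.max (N z) (N w) ^+ j)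
    <= N (z ^+ j.+1 * u * q' - w ^+ j.+1 * u' * q)
    <= (j.+1%:R + 2) * (Bu * BQ) * (N (z - w) * Num.max (N z) (N w) ^+ j).
Proof.
move=> z0 w0 dzw jeta /andP[b10 ub] /andP[b20 qb] uB u'B qB q'B du dq w1 wsmall.
have Bu0 : 0 < Bu by apply: lt_le_trans b10 (le_trans ub uB).
have BQ0 : 0 < BQ by apply: lt_le_trans b20 (le_trans qb q'B).
have m0 : 0 <= Num.max (N z) (N w) by rewrite le_max normc_ge0.
have X0 : 0 <= N (z - w) * Num.max (N z) (N w) ^+ j by rewrite mulr_ge0 ?normc_ge0 ?exprn_ge0.
have rem : N (w ^+ j.+1 * ((u - u') * q' + u' * (q' - q)))
    <= N w * (2 * (Bu * BQ)) * (N (z - w) * Num.max (N z) (N w) ^+ j).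
  rewrite normcM' normcX exprS.
  rewrite [leRHS](_ : _ = (N w * Num.max (N z) (N w) ^+ j) * (2 * (Bu * BQ) * N (z - w))); last by ring.
  apply: ler_pM; rewrite ?mulr_ge0 ?exprn_ge0 ?normc_ge0//.
    by apply: ler_wpM2l; rewrite ?normc_ge0// lerXn2r ?nnegrE ?normc_ge0// le_max lexx orbT.
  apply: (le_trans (normc_add _ _)); rewrite !normcM'.
  have h1 : N (u - u') * N q' <= Bu * N (z - w) * BQ by apply: ler_pM; rewrite ?normc_ge0.
  have h2 : N u' * N (q' - q) <= Bu * (BQ * N (z - w)) by apply: ler_pM; rewrite ?normc_ge0.
  by clear -h1 h2; lra.
have up : N (z ^+ j.+1 - w ^+ j.+1) <= j.+1%:R * (N (z - w) * Num.max (N z) (N w) ^+ j).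
  by apply: normc_subX; rewrite le_max lexx ?orbT.
have low := sector_pow z0 w0 dzw jeta.
rewrite (_ : _ - w ^+ j.+1 * u' * q = (z ^+ j.+1 - w ^+ j.+1) * (u * q') +
   w ^+ j.+1 * ((u - u') * q' + u' * (q' - q))); last by ring.
move: up low rem X0; set X := _ * _ ^+ j; set D := z ^+ j.+1 - w ^+ j.+1.
set E := w ^+ j.+1 * _ => up low rem X0.
have uq : N (u * q') <= Bu * BQ by rewrite normcM'; apply: ler_pM; rewrite ?normc_ge0.
have uq' : b1 * b2 <= N (u * q') by rewrite normcM'; apply: ler_pM => //; exact: ltW.
have BB0 : 0 < Bu * BQ by rewrite mulr_gt0.
have bb0 : 0 < b1 * b2 by rewrite mulr_gt0.
apply/andP; split.
  have h1 : 1 / 2 * X * (b1 * b2) <= N (D * (u * q')).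
    by rewrite normcM'; apply: ler_pM => //; [rewrite mulr_ge0|exact: ltW].
  have h2 := ler_wpM2r X0 wsmall.
  have := normc_triB (D * (u * q')) (- E); rewrite opprK normc_opp => h3.
  by clear -h1 h2 h3 rem; lra.
apply: (le_trans (normc_add _ _)).
have h1 : N (D * (u * q')) <= j.+1%:R * X * (Bu * BQ).
  by rewrite normcM'; apply: ler_pM; rewrite ?normc_ge0.
have h2 : N w * (2 * (Bu * BQ) * X) <= 1 * (2 * (Bu * BQ) * X).
  by apply: ler_wpM2r => //; apply: mulr_ge0 => //; have := ltW BB0; lra.
by clear -h1 h2 rem; lra.
Qed.

Lemma qdist_near z w (a : R[i]) : N (z - a) <= 1 -> N (w - a) <= 1 ->
  1 / ((N a + 2) * (N a + 2)) * N (z - w) <= qdist (Some z) (Some w) <= N (z - w).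
Proof.
move=> z1 w1; rewrite qdist_le_dist andbT !hpt_Some qdist_hpt ?oner_eq0 ?orbT// !mulr1.
have A0 : 0 < N a + 2 by have := normc_ge0 a; lra.
have nb t : N (t - a) <= 1 -> 0 < nrm t 1 <= N a + 2.
  move=> t1; rewrite nrm_gt0 ?oner_eq0 ?orbT//=; apply: (le_trans (nrm_le _ _)).
  rewrite normc1E.
  by have := normc_triB t a; lra.
have /andP[z2 z3] := nb _ z1; have /andP[w2 w3] := nb _ w1.
rewrite mulrC; apply: ler_wpM2l; first exact: normc_ge0.
rewrite div1r lef_pV2 ?posrE ?mulr_gt0//.
by apply: ler_pM => //; exact: ltW.
Qed.

End Powers.

Section LocalRational.
Context {R : realType}.
Local Notation d := (@qdist R).
Variables (P Q : {poly R[i]}).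
(** Without common zeros and with [P], [Q] linearly independent, [(P : Q)] is defined everywhere and
    not constant. *)
Hypothesis PQ0 : forall z, (P.[z] != 0) || (Q.[z] != 0).
Hypothesis PQ_free : forall al be : R[i], (al != 0) || (be != 0) -> al *: P + be *: Q != 0.

Definition ratpoint z := hpt P.[z] Q.[z].

(** A change of target coordinates sends the value at [a] to 0: the first coordinate
    [Q(a) P - P(a) Q] vanishes at [a] to order [j + 1], the local degree, and the second, [Q1],
    equals [D] at [a]. The determinant of the change is also [D], the squared norm of
    [(P(a), Q(a))]. *)
Lemma ratpoint_local_form (a : R[i]) : exists (j : nat) (u Q1 : {poly R[i]}) (D : R[i]),
  [/\ D != 0, u.[a] != 0, Q1.[a] != 0 &
    forall z w, D * (P.[z] * Q.[w] - P.[w] * Q.[z]) =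
      (z - a) ^+ j.+1 * u.[z] * Q1.[w] - (w - a) ^+ j.+1 * u.[w] * Q1.[z]].
Proof.
have fr : (Q.[a] != 0) || (- P.[a] != 0) by rewrite oppr_eq0 orbC.
have [m [u ua Eu]] := multiplicity_XsubC (Q.[a] *: P - P.[a] *: Q) a.
rewrite -scaleNr (PQ_free fr) /= in ua.
have {fr} P1a : (Q.[a] *: P - P.[a] *: Q).[a] = 0 by rewrite !hornerE mulrC subrr.
case: m Eu => [|j] Eu.
  by move: P1a ua; rewrite Eu expr0 mulr1 => /eqP h; rewrite /root h.
pose Q1 := conjc P.[a] *: P + conjc Q.[a] *: Q.
pose D : R[i] := (nrm P.[a] Q.[a] ^+ 2)%:C.
have ED : D = P.[a] * conjc P.[a] + Q.[a] * conjc Q.[a].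
  by rewrite !mulc_conj -raddfD /= /D nrm_sqr.
have D0 : D != 0.
  by rewrite -normc_eq0 normcZ normr_eq0 expf_eq0 /= gt_eqF ?nrm_gt0.
exists j, u, Q1, D; split => //.
  by rewrite /Q1 !hornerE mulrC [_ * Q.[a]]mulrC -ED.
move=> z w; have E v : (v - a) ^+ j.+1 * u.[v] = Q.[a] * P.[v] - P.[a] * Q.[v].
  by have := congr1 (fun p : {poly _} => p.[v]) Eu; rewrite /= !hornerE => ->; rewrite mulrC.
by rewrite !E /Q1 !hornerE ED; ring.
Qed.

(** The punctured disc is cut by directions: bisecting the square that contains all unit directions
    leaves sectors so narrow that [cross_estimate] applies, and each sector is handled by
    [good_annuli]. *)
Lemma good_local a : exists2 e : R, 0 < e & good Some ratpoint [set z | N (z - a) < e].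
Proof.
have [j [u [Q1 [D [D0 ua Q1a EW]]]]] := ratpoint_local_form a.
have [Bu Bu0 Hu] := poly_local_bound u a.
have [BQ BQ0 HQ] := poly_local_bound Q1 a.
have [e1 /andP[e10 e11] [b1 b10 Hb1]] := poly_local_lb ua.
have [e2 /andP[e20 e21] [b2 b20 Hb2]] := poly_local_lb Q1a.
have [BP BP0 HP] := poly_local_bound P a.
have [BQ' BQ'0 HQ'] := poly_local_bound Q a.
have [e3 /andP[e30 e31] [v v0 Hv]] := nrm_local_lb (PQ0 a).
(* The radius below which the higher-order term in [cross_estimate] is at most half of the lower
   bound for the main one. *)
pose e4 := b1 * b2 / (8 * (Bu * BQ)).
have B0 : 0 < Bu * BQ by rewrite mulr_gt0.
have e40 : 0 < e4 by rewrite divr_gt0 ?mulr_gt0.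
exists (Num.min (Num.min e1 e2) (Num.min e3 e4)).
  by rewrite !lt_min e10 e20 e30 e40.
set e := Num.min _ _.
have eP z : N (z - a) < e -> [/\ N (z - a) < e1, N (z - a) < e2, N (z - a) < e3, N (z - a) < e4 & N (z - a) <= 1].
  rewrite /e !lt_min => /andP[/andP[h1 h2] /andP[h3 h4]]; split=> //.
  exact: le_trans (ltW h1) e11.
(* Directions in a rectangle with sides below [eta] differ by at most [2 eta], and
   [j (2 eta) <= 1 / 2]. *)
pose eta : R := 1 / (4 * j.+1%:R).
have eta0 : 0 < eta by rewrite divr_gt0// mulr_gt0// ltr0Sn.
pose box x0 x1 y0 y1 := [set z | [/\ N (z - a) < e, z != a,
   x0 <= complex.Re (dir (z - a)) <= x1 & y0 <= complex.Im (dir (z - a)) <= y1]].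
suff H : good Some ratpoint (box (-1) 1 (-1) 1).
  (* The centre has no direction and is added as a single point. *)
  have G := good_setU H (@good_set1 _ _ Some ratpoint a).
  apply: (good_sub _ G) => z /= ze.
  have [->|za] := eqVneq z a; [by right|left; split=> //].
    by have := normc_Re (dir (z - a)); rewrite dir_norm ?subr_eq0// ler_norml.
  by have := normc_Im (dir (z - a)); rewrite dir_norm ?subr_eq0// ler_norml.
apply: (@cousin _ (fun x0 x1 y0 y1 => good Some ratpoint (box x0 x1 y0 y1))) => //; try by lra.
  move=> x0 x1 y0 y1 x01 y01 /= G1 G2 G3 G4.
  have G := good_setU (good_setU G1 G2) (good_setU G3 G4).
  apply: (good_sub _ G) => z [ze za /andP[x1' x2'] /andP[y1' y2']].
  case: (leP (complex.Im (dir (z - a))) ((y0 + y1) / 2)) => hy;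
  case: (leP (complex.Re (dir (z - a))) ((x0 + x1) / 2)) => hx.
  - by left; left; split=> //; apply/andP; split.
  - by left; right; split=> //; apply/andP; split=> //; exact: ltW.
  - by right; left; split=> //; apply/andP; split=> //; exact: ltW.
  - by right; right; split=> //; apply/andP; split=> //; exact: ltW.
have U0 : 0 < BP + BQ' by rewrite addr_gt0.
have A0 : 0 < N a + 2 by rewrite ltr_wpDl ?normc_ge0.
have ND : 0 < N D by rewrite normc_gt0.
pose K := (j.+1%:R + 2) * (Bu * BQ).
have K0 : 0 < K by rewrite /K mulr_gt0// ltr_wpDl ?ler0n.
move=> x y _ _; exists eta => // x0 x1 y0 y1 _ _ _ _ _ _ hx hy.
apply: (@good_annuli _ _ _ _ a j
    (Num.min (1 / ((N a + 2) * (N a + 2))) (b1 * b2 / 4 / (N D * ((BP + BQ') * (BP + BQ')))))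
    (Num.max 1 (K / (N D * (v * v))))).
- by rewrite lt_min !divr_gt0// ?mulr_gt0.
- by rewrite lt_max ltr01.
- by move=> z [/eP[_ _ _ _ ->] za _ _]; rewrite normc_gt0 subr_eq0 za.
- move=> z w [/eP[_ _ _ _ z1] _ _ _] [/eP[_ _ _ _ w1] _ _ _].
  have /andP[h1 h2] := qdist_near z1 w1; apply/andP; split.
    by apply: le_trans h1; rewrite ler_wpM2r ?normc_ge0// ge_min lexx.
  by apply: (le_trans h2); rewrite ler_peMl ?normc_ge0// le_max lexx.
- move=> z w [ze za zx zy] [we wa wx wy].
  have [z1 z2 z3 z4 z5] := eP _ ze; have [w1 w2 w3 w4 w5] := eP _ we.
  rewrite qdist_hpt//; set W := P.[z] * Q.[w] - P.[w] * Q.[z].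
  have nb t : N (t - a) < e3 -> N (t - a) <= 1 -> v <= nrm P.[t] Q.[t] <= BP + BQ'.
    move=> t3 t1; rewrite Hv//=; apply: (le_trans (nrm_le _ _)).
    by apply: lerD; [have [] := HP _ _ t1 t1|have [] := HQ' _ _ t1 t1].
  have /andP[n1 n2] := nb _ z3 z5; have /andP[n3 n4] := nb _ w3 w5.
  set n := nrm P.[z] Q.[z] * nrm P.[w] Q.[w].
  have nv : v * v <= n by apply: ler_pM => //; exact: ltW.
  have nU : n <= (BP + BQ') * (BP + BQ') by apply: ler_pM => //; exact: nrm_ge0.
  have vv0 : 0 < v * v by rewrite mulr_gt0.
  have n0 : 0 < n := lt_le_trans vv0 nv.
  pose m := Num.max (N (z - a)) (N (w - a)).
  pose X := N (z - w) * m ^+ j.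
  have X0 : 0 <= X by rewrite mulr_ge0 ?exprn_ge0 ?le_max ?normc_ge0.
  have [uz1 uz2] := Hu _ _ z5 w5; have [uw1 _] := Hu _ _ w5 z5.
  have [qz1 _] := HQ _ _ z5 w5; have [qw1 qw2] := HQ _ _ w5 z5.
  have EzW : z - w = (z - a) - (w - a) by ring.
  have dzw : N (dir (z - a) - dir (w - a)) <= 2 * eta.
    apply: (le_trans (normc_ReIm _)); rewrite !raddfB /=.
    have d1 : `|complex.Re (dir (z - a)) - complex.Re (dir (w - a))| <= eta.
      by rewrite ler_norml; move: zx wx hx; clear; lra.
    have d2 : `|complex.Im (dir (z - a)) - complex.Im (dir (w - a))| <= eta.
      by rewrite ler_norml; move: zy wy hy; clear; lra.
    by clear -d1 d2; lra.
  have /andP[low up] : b1 * b2 / 4 * X <= N W * N D <= K * X.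
    rewrite [N W * N D]mulrC -normcM' /W EW /X /m EzW.
    apply: (@cross_estimate _ (z - a) (w - a) _ _ _ _ j (2 * eta)) => //; rewrite ?subr_eq0 ?b10 ?b20 -?EzW//.
    + have half (J : R) : 0 < J -> 2 * (1 / (4 * J)) = 1 / 2 / J by move=> J0; field; rewrite gt_eqF.
      rewrite /eta half ?ltr0Sn// mulrCA ler_piMr ?divr_ge0//.
      by rewrite ler_pdivrMr ?ltr0Sn// mul1r ler_nat.
    + exact: Hb1.
    + exact: Hb2.
    + by rewrite normc_sub [N (z - w)]normc_sub -normc_sub.
    + by move: w4; rewrite /e4 ltr_pdivlMr ?mulr_gt0// => /ltW.
  have E1 : N W / n = N W * N D / (N D * n) by field; rewrite !gt_eqF.
  have Dn0 : 0 < N D * n by rewrite mulr_gt0.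
  have Duu0 : 0 < N D * ((BP + BQ') * (BP + BQ')) by rewrite !mulr_gt0.
  have Dvv0 : 0 < N D * (v * v) by rewrite mulr_gt0.
  have bb0 : 0 < b1 * b2 / 4 by rewrite !mulr_gt0.
  rewrite E1 -/m -/X; apply/andP; split.
    rewrite ler_pdivlMr//; apply: le_trans low.
    apply: (@le_trans _ _ (b1 * b2 / 4 / (N D * ((BP + BQ') * (BP + BQ'))) * X * (N D * n))).
      by rewrite ler_pM2r// ler_wpM2r// ge_min lexx orbT.
    rewrite mulrAC ler_wpM2r// mulrAC ler_pdivrMr//.
    by rewrite ler_pM2l// ler_pM2l.
  rewrite ler_pdivrMr//; apply: (le_trans up).
  apply: (@le_trans _ _ (K / (N D * (v * v)) * X * (N D * n))); last first.
    by rewrite ler_pM2r// ler_wpM2r// le_max lexx orbT.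
  rewrite [leRHS]mulrAC ler_wpM2r// [leRHS]mulrAC ler_pdivlMr//.
  by rewrite ler_pM2l// ler_pM2l.
Qed.

Lemma good_ratpoint_unit : good Some ratpoint
  [set z | -1 <= complex.Re z <= 1 /\ -1 <= complex.Im z <= 1].
Proof.
pose box x0 x1 y0 y1 := [set z : R[i] | x0 <= complex.Re z <= x1 /\ y0 <= complex.Im z <= y1].
apply: (@cousin _ (fun x0 x1 y0 y1 => good Some ratpoint (box x0 x1 y0 y1))) => //; try by lra.
  move=> x0 x1 y0 y1 x01 y01 /= G1 G2 G3 G4.
  have G := good_setU (good_setU G1 G2) (good_setU G3 G4).
  apply: (good_sub _ G) => z [/andP[x1' x2'] /andP[y1' y2']].
  case: (leP (complex.Im z) ((y0 + y1) / 2)) => hy;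
  case: (leP (complex.Re z) ((x0 + x1) / 2)) => hx.
  - by left; left; split=> //; apply/andP; split.
  - by left; right; split=> //; apply/andP; split=> //; exact: ltW.
  - by right; left; split=> //; apply/andP; split=> //; exact: ltW.
  - by right; right; split=> //; apply/andP; split=> //; exact: ltW.
move=> x y _ _; have [e e0 G] := good_local (x +i* y).
exists (e / 2) => [|x0 x1 y0 y1 _ /andP[? ?] _ _ /andP[? ?] _ ? ?]; first by rewrite divr_gt0.
apply: (good_sub _ G) => z [/andP[? ?] /andP[? ?]] /=.
apply: (le_lt_trans (normc_ReIm _)); rewrite !raddfB /=.
have : `|complex.Re z - x| < e / 2 by rewrite ltr_norml; lra.
have : `|complex.Im z - y| < e / 2 by rewrite ltr_norml; lra.
by lra.
Qed.
End LocalRational.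

(** * Rational maps on the whole sphere, with the chart at infinity *)

Section Rational.
Context {R : realType}.
Local Notation d := (@qdist R).
Implicit Types p q : {poly R[i]}.

Lemma poly_eq0_off0 p : (forall z, z != 0 -> p.[z] = 0) -> p = 0.
Proof.
move=> H; apply/eqP; apply: contraT => p0.
have /closed_nonrootP[z] : p * 'X != 0 by rewrite mulf_neq0 ?polyX_eq0.
rewrite /root hornerM hornerX mulf_eq0 negb_or => /andP[pz z0].
by rewrite H ?eqxx in pz.
Qed.

(** The polynomial [z^n p(1/z)]. The exponent is a parameter because numerator and denominator must
    be reversed with the same one. *)
Definition rev_poly n p := \poly_(i < n.+1) p`_(n - i).

Lemma horner_rev n p z : (size p <= n.+1)%N -> z != 0 ->
  (rev_poly n p).[z] = z ^+ n * p.[z^-1].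
Proof.
move=> pn z0; rewrite horner_poly (horner_coef_wide _ pn) mulr_sumr.
rewrite (reindex_inj rev_ord_inj); apply: eq_bigr => i _ /=.
rewrite subSS mulrCA; have ni : (i <= n)%N by rewrite -ltnS.
congr (p`_ _ * _); first by rewrite subKn.
rewrite [RHS](_ : _ = z ^+ (n - i + i) * z^-1 ^+ i); last by rewrite subnK.
by rewrite exprD exprVn mulfK// expf_neq0.
Qed.

Lemma horner_rev0 n p : (rev_poly n p).[0] = p`_n.
Proof. by rewrite horner_coef0 coef_poly subn0. Qed.

(** A linear relation makes [p] a multiple of [q], and coprimality then forces [q] to be
    constant. *)
Lemma ratfun_const p q (al be : R[i]) : q != 0 -> coprimep p q ->
  (al != 0) || (be != 0) -> al *: p + be *: q = 0 -> exists b, forall x, ratfun p q x = b.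
Proof.
move=> q0 cpq ab E.
have al0 : al != 0.
  apply: contraTneq ab => a0; move: E; rewrite a0 scale0r add0r => /eqP.
  by rewrite scaler_eq0 (negbTE q0) orbF => /eqP ->; rewrite eqxx.
pose c := - (be / al).
have Ep : p = c *: q.
  apply: (scalerI al0); rewrite scalerA /c mulrN mulrC divfK// scaleNr.
  by apply/eqP; rewrite -addr_eq0 E.
have sq : size q = 1%N.
  apply/eqP; have [c0|c0] := eqVneq c 0.
    by move: cpq; rewrite Ep c0 scale0r coprime0p => /eqp_size ->; rewrite size_poly1.
  by move: cpq; rewrite Ep coprimepZl// coprimepp.
have /size_poly1P[k k0 Eq] : size q == 1%N by rewrite sq.
exists (Some c); case => [z|] /=.
  by rewrite Ep hornerZ Eq hornerC (negbTE k0) mulfK.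
rewrite ifF ?Ep; last by apply/negbTE; rewrite -leqNgt size_scale_leq.
by rewrite coefZ -/(lead_coef q) mulfK// lead_coef_eq0.
Qed.

(** The unit square and its image under inversion cover the sphere. Inversion is an isometric chart
    in which [r] is given by the reversed polynomials, so [good_ratpoint_unit] applies twice. *)
Lemma rational_good (r : sphere R -> sphere R) : rational_map r -> nonconstant r ->
  good id r setT.
Proof.
move=> [p [q [q0 cpq Er]]] nr.
have free (al be : R[i]) : (al != 0) || (be != 0) -> al *: p + be *: q != 0.
  move=> ab; apply/eqP => E; apply: nr; have [b Hb] := ratfun_const q0 cpq ab E.
  by exists b => x; rewrite Er.
have pq0 z : (p.[z] != 0) || (q.[z] != 0).
  by case: (eqVneq p.[z] 0) => //= /eqP; exact: (coprimep_root cpq).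
(* With [n] the larger degree, the coefficients of index [n] do not both vanish, so the reversed
   polynomials have no common zero at 0. *)
pose n := (maxn (size p) (size q)).-1.
have sq : (0 < size q)%N by rewrite size_poly_gt0.
have nE : n.+1 = maxn (size p) (size q) by rewrite prednK// leq_max sq orbT.
have pn : (size p <= n.+1)%N by rewrite nE leq_maxl.
have qn : (size q <= n.+1)%N by rewrite nE leq_maxr.
have inf0 : ((rev_poly n p).[0] != 0) || ((rev_poly n q).[0] != 0).
  rewrite !horner_rev0 /n; case: (ltnP (size q) (size p)) => h.
    by rewrite -/(lead_coef p) lead_coef_eq0 -size_poly_gt0 (leq_trans _ h).
  by rewrite -/(lead_coef q) lead_coef_eq0 q0 orbT.
have rpq0 z : ((rev_poly n p).[z] != 0) || ((rev_poly n q).[z] != 0).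
  have [->//|z0] := eqVneq z 0.
  by rewrite !horner_rev// !mulf_eq0 !expf_eq0 (negbTE z0) !andbF /=.
have rfree (al be : R[i]) : (al != 0) || (be != 0) ->
    al *: rev_poly n p + be *: rev_poly n q != 0.
  move=> ab; apply: contra (free _ _ ab) => /eqP E; apply/eqP/poly_eq0_off0 => z z0.
  have zV : z^-1 != 0 by rewrite invr_eq0.
  have := congr1 (fun s : {poly _} => s.[z^-1]) E.
  rewrite /= !hornerE !horner_rev// invrK => /eqP.
  rewrite [_ * _ + _](_ : _ = z^-1 ^+ n * (al * p.[z] + be * q.[z])); last by ring.
  by rewrite mulf_eq0 expf_eq0 (negbTE zV) andbF /= => /eqP.
pose box := [set z : R[i] | -1 <= complex.Re z <= 1 /\ -1 <= complex.Im z <= 1].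
have G1 : good id r (Some @` box).
  apply: good_preimage; have := good_ratpoint_unit pq0 free.
  by congr (good _ _ _); apply/funext => z; rewrite /= Er.
have G2 : good id r ((sinv \o Some) @` box).
  apply: good_preimage; apply: (@good_isometry _ _ Some).
    by move=> x y; exact/esym/qdist_sinv.
  have := good_ratpoint_unit rpq0 rfree; congr (good _ _ _); apply/funext => z.
  rewrite /ratpoint /= Er; have [->|z0] := eqVneq z 0.
    rewrite /= /hpt !horner_rev0 /n; case: (ltnP (size q) (size p)) => h.
      rewrite nth_default ?eqxx//.
      by rewrite -ltnS prednK// (leq_trans _ h).
    by rewrite -/(lead_coef q) lead_coef_eq0 (negbTE q0).
  by rewrite !horner_rev// hpt_scale ?expf_neq0.
apply: (good_sub _ (good_setU G1 G2)) => -[z _|_]; last first.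
  by right; exists 0; rewrite /= ?eqxx//; split; rewrite lerN10 ler01.
have [z1|z1] := leP (N z) 1.
  left; exists z => //; split; rewrite -ler_norml; apply: le_trans z1.
    exact: normc_Re.
  exact: normc_Im.
have z0 : z != 0 by rewrite -normc_gt0; lra.
right; exists z^-1; last by rewrite /= invr_eq0 (negbTE z0) invrK.
have zV : N z^-1 <= 1 by rewrite normcV' invf_le1; lra.
by split; rewrite -ler_norml; apply: le_trans zV; [exact: normc_Re|exact: normc_Im].
Qed.

Lemma good_dim {T : Type} (e f : T -> sphere R) S X : good e f S -> X `<=` S ->
  nagata_dim d (e @` X) = nagata_dim d (f @` X).
Proof.
move=> G XS; apply: nagata_dim_eq; [exact: qdistxx|exact: qdistxx| |by move=> n; exact: G].
by split=> /image_set0_set0 ->; rewrite image_set0.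
Qed.

Lemma rational_dim (r : sphere R -> sphere R) X : rational_map r -> nonconstant r ->
  nagata_dim d X = nagata_dim d (r @` X).
Proof.
by move=> rr nr; rewrite -(good_dim (rational_good rr nr) (@subsetT _ X)) image_id.
Qed.

End Rational.

(** * Integrals along segments *)

Section RealIntegral.
Context {R : realType}.
Local Notation mu := (@lebesgue_measure R).
Implicit Types (g : R -> R) (a b c : R).

Definition rcont g a b := forall t, a <= t <= b -> forall e, 0 < e ->
  exists2 dl, 0 < dl & forall u, a <= u <= b -> `|u - t| < dl -> `|g u - g t| < e.

Definition rint g a b : R := (\int[mu]_(t in `[a, b]) g t)%R.

Lemma rcont_integrable g a b : rcont g a b -> mu.-integrable `[a, b] (EFin \o g).
Proof.
move=> gc; apply: (@continuous_compact_integrable R g `[a, b]); first exact: segment_compact.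
apply/subspace_continuousP => t; rewrite /= in_itv /= => tab.
apply/cvgrPdist_lt => e e0; have [dl dl0 H] := gc t tab e e0.
apply/nbhs_ballP; exists dl => // u /=; rewrite /ball /= => ut.
rewrite in_itv /= => uab; rewrite distrC; apply: H => //.
by rewrite distrC.
Qed.

Lemma rintD g h a b : rcont g a b -> rcont h a b ->
  rint (fun t => g t + h t) a b = rint g a b + rint h a b.
Proof. by move=> gc hc; apply: RintegralD => //; exact: rcont_integrable. Qed.

Lemma rintZ g (r : R) a b : rcont g a b -> rint (fun t => r * g t) a b = r * rint g a b.
Proof. by move=> gc; apply: RintegralZl => //; exact: rcont_integrable. Qed.

Lemma rint_cst (r : R) a b : a <= b -> rint (fun=> r) a b = r * (b - a).
Proof.
move=> ab; rewrite /rint Rintegral_cst//.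
have /= -> := lebesgue_measure_itv `[a, b].
rewrite lte_fin.
case: ltP => [//|ba]; rewrite (_ : b - a = 0)//.
by apply/eqP; rewrite subr_eq0 eq_le ab ba.
Qed.

Lemma rint_cat g a b c : a <= b -> b <= c -> rcont g a c ->
  rint g a c = rint g a b + rint g b c.
Proof.
move=> ab bc gc; have gi := rcont_integrable gc.
have := @Rintegral_itvB R g (BLeft a) (BRight c) b gi.
rewrite !bnd_simp => /(_ ab bc) E; apply/eqP; rewrite addrC -subr_eq; apply/eqP.
rewrite /rint E Rintegral_itv_obnd_cbnd//.
apply: integrableS gi => //; apply: subset_itv; rewrite bnd_simp//.
Qed.

Lemma rint_bound g (M : R) a b : a <= b -> rcont g a b ->
  (forall t, a <= t <= b -> `|g t| <= M) -> `|rint g a b| <= M * (b - a).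
Proof.
move=> ab gc gM; have gi := rcont_integrable gc.
rewrite -(rint_cst M ab) /rint; apply: (le_trans (le_normr_Rintegral _ gi)) => //.
apply: le_Rintegral => //.
- by have := integrable_norm gi; apply: eq_integrable.
- apply: rcont_integrable => t _ e e0; exists 1 => // u _ _.
  by rewrite subrr normr0.
Qed.

End RealIntegral.

Section ComplexIntegral.
Context {R : realType}.
Implicit Types (g h : R -> R[i]) (a b c : R).

Definition pcont g a b := forall t, a <= t <= b -> forall e, 0 < e ->
  exists2 dl, 0 < dl & forall u, a <= u <= b -> `|u - t| < dl -> N (g u - g t) < e.

Definition cint g a b : R[i] :=
  rint (fun t => complex.Re (g t)) a b +i* rint (fun t => complex.Im (g t)) a b.

Lemma pcont_Re g a b : pcont g a b -> rcont (fun t => complex.Re (g t)) a b.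
Proof.
move=> gc t tab e e0; have [dl dl0 H] := gc t tab e e0; exists dl => // u uab ut.
by apply: le_lt_trans (H u uab ut); rewrite -raddfB; exact: normc_Re.
Qed.

Lemma pcont_Im g a b : pcont g a b -> rcont (fun t => complex.Im (g t)) a b.
Proof.
move=> gc t tab e e0; have [dl dl0 H] := gc t tab e e0; exists dl => // u uab ut.
by apply: le_lt_trans (H u uab ut); rewrite -raddfB; exact: normc_Im.
Qed.

Lemma rcontZ (f : R -> R) (r a b : R) : rcont f a b -> rcont (fun t => r * f t) a b.
Proof.
move=> fc t tab e e0.
have r0 : 0 < `|r| + 1 by have := normr_ge0 r; lra.
have [dl dl0 H] := fc t tab (e / (`|r| + 1)) (divr_gt0 e0 r0); exists dl => // u uab ut.
have := H u uab ut; rewrite ltr_pdivlMr// => h.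
rewrite -mulrBr normrM mulrC; apply: le_lt_trans h.
by apply: ler_wpM2l => //; lra.
Qed.

Lemma cintD g h a b : pcont g a b -> pcont h a b ->
  cint (fun t => g t + h t) a b = cint g a b + cint h a b.
Proof.
move=> gc hc; rewrite /cint.
rewrite -[RHS]/((rint (fun t => complex.Re (g t)) a b + rint (fun t => complex.Re (h t)) a b)
   +i* (rint (fun t => complex.Im (g t)) a b + rint (fun t => complex.Im (h t)) a b)).
rewrite -!rintD; try exact: pcont_Re; try exact: pcont_Im.
by congr (rint _ _ _ +i* rint _ _ _); apply/funext => t; rewrite raddfD.
Qed.

Lemma cintZ g (r : R[i]) a b : pcont g a b ->
  cint (fun t => r * g t) a b = r * cint g a b.
Proof.
move=> gc; case: r => x y; rewrite /cint.
have gR := pcont_Re gc; have gI := pcont_Im gc.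
rewrite -[RHS]/((x * rint (fun t => complex.Re (g t)) a b - y * rint (fun t => complex.Im (g t)) a b)
   +i* (x * rint (fun t => complex.Im (g t)) a b + y * rint (fun t => complex.Re (g t)) a b)).
rewrite -mulNr -!rintZ// -!rintD; try exact: rcontZ.
by congr (rint _ _ _ +i* rint _ _ _); apply/funext => t; case: (g t) => u v /=; rewrite ?mulNr.
Qed.

Lemma eq_cint g h a b : (forall t, a <= t <= b -> g t = h t) -> cint g a b = cint h a b.
Proof.
move=> gh; rewrite /cint /rint; congr (_ +i* _); apply: eq_Rintegral => t;
  by rewrite inE /= in_itv /= => /gh ->.
Qed.

Lemma cintB g h a b : pcont g a b -> pcont h a b ->
  cint (fun t => g t - h t) a b = cint g a b - cint h a b.
Proof.
move=> gc hc; rewrite -mulN1r -cintZ// -cintD//.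
  by apply: eq_cint => t _; rewrite mulN1r.
move=> t tx e e0; have [dl dl0 H] := hc t tx e e0; exists dl => // u ux ut.
by rewrite -mulrBr mulN1r normc_opp; exact: H.
Qed.

Lemma cint_cst (r : R[i]) a b : a <= b -> cint (fun=> r) a b = r * (b - a)%:C.
Proof.
move=> ab; case: r => x y; rewrite /cint !rint_cst//=.
by apply/eqP; rewrite eq_complex /=; apply/andP; split; apply/eqP; ring.
Qed.

Lemma cint_cat g a b c : a <= b -> b <= c -> pcont g a c ->
  cint g a c = cint g a b + cint g b c.
Proof.
move=> ab bc gc; rewrite /cint (rint_cat ab bc (pcont_Re gc)) (rint_cat ab bc (pcont_Im gc)).
by [].
Qed.

(** The factor 2 comes from estimating real and imaginary parts separately; later constants allow
    for it. *)
Lemma cint_bound g (M : R) a b : a <= b -> pcont g a b ->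
  (forall t, a <= t <= b -> N (g t) <= M) -> N (cint g a b) <= 2 * M * (b - a).
Proof.
move=> ab gc gM; apply: (le_trans (normc_ReIm _)); rewrite /cint /=.
have := rint_bound ab (pcont_Re gc) (fun t tab => le_trans (normc_Re _) (gM t tab)).
have := rint_bound ab (pcont_Im gc) (fun t tab => le_trans (normc_Im _) (gM t tab)).
by lra.
Qed.

End ComplexIntegral.

(** * Complex differentiability *)

Section Differentiability.
Context {R : realType}.
Implicit Types (f g h : R[i] -> R[i]) (z w p l : R[i]).

Definition ccont h z := forall e : R, 0 < e ->
  exists2 dl : R, 0 < dl & forall w, N (w - z) < dl -> N (h w - h z) < e.

Definition cderiv h z l := forall e : R, 0 < e ->
  exists2 dl : R, 0 < dl & forall w, N (w - z) < dl ->
    N (h w - h z - l * (w - z)) <= e * N (w - z).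

Definition cdiff h z := exists l, cderiv h z l.

(* Continuity at z is kept instead of differentiability so that the class is stable
   under divided differences without a removable singularity theorem. *)
Definition holK h z := ccont h z /\
  exists2 dl : R, 0 < dl & forall w, 0 < N (w - z) < dl -> cdiff h w.

Lemma ccont_near g h z (dl : R) : 0 < dl -> (forall w, N (w - z) < dl -> g w = h w) ->
  ccont g z -> ccont h z.
Proof.
move=> dl0 E gc e e0; have [d1 d10 H] := gc e e0.
exists (Num.min dl d1); first by rewrite lt_min dl0.
move=> w; rewrite lt_min => /andP[w1 w2]; rewrite -!E ?subrr ?normc0E//.
exact: H.
Qed.

Lemma cderiv_near g h z l (dl : R) : 0 < dl -> (forall w, N (w - z) < dl -> g w = h w) ->
  cderiv g z l -> cderiv h z l.
Proof.
move=> dl0 E gc e e0; have [d1 d10 H] := gc e e0.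
exists (Num.min dl d1); first by rewrite lt_min dl0.
move=> w; rewrite lt_min => /andP[w1 w2]; rewrite -!E ?subrr ?normc0E//.
exact: H.
Qed.

Lemma ccont_bound h z : ccont h z ->
  exists2 dl : R, 0 < dl & forall w, N (w - z) < dl -> N (h w) < N (h z) + 1.
Proof.
move=> /(_ _ ltr01)[dl dl0 H]; exists dl => // w /H h1.
by have := normc_triB (h w) (h z); lra.
Qed.

Lemma ccont_cst c z : ccont (fun=> c) z.
Proof. by move=> e e0; exists 1 => // w _; rewrite subrr normc0E. Qed.

Lemma ccont_id z : ccont id z.
Proof. by move=> e e0; exists e. Qed.

Lemma ccontD g h z : ccont g z -> ccont h z -> ccont (fun w => g w + h w) z.
Proof.
move=> gc hc e e0; have e2 : 0 < e / 2 by lra.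
have [d1 d10 H1] := gc _ e2; have [d2 d20 H2] := hc _ e2.
exists (Num.min d1 d2); first by rewrite lt_min d10.
move=> w; rewrite lt_min => /andP[/H1 h1 /H2 h2].
rewrite (_ : _ - _ = (g w - g z) + (h w - h z)); last by ring.
by have := normc_add (g w - g z) (h w - h z); lra.
Qed.

Lemma ccontM g h z : ccont g z -> ccont h z -> ccont (fun w => g w * h w) z.
Proof.
move=> gc hc e e0; have [d0 d00 H0] := ccont_bound hc.
have hz := normc_ge0 (h z); have gz := normc_ge0 (g z).
have e1 : 0 < e / (2 * (N (h z) + 1)) by rewrite divr_gt0 ?mulr_gt0//; lra.
have e2 : 0 < e / (2 * (N (g z) + 1)) by rewrite divr_gt0 ?mulr_gt0//; lra.
have [d1 d10 H1] := gc _ e1; have [d2 d20 H2] := hc _ e2.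
exists (Num.min d0 (Num.min d1 d2)); first by rewrite !lt_min d10 d00.
move=> w; rewrite !lt_min => /andP[/H0 h0 /andP[/H1 + /H2 +]].
rewrite !ltr_pdivlMr ?mulr_gt0//; [move=> h1 h2|lra|lra].
rewrite (_ : _ - _ = (g w - g z) * h w + g z * (h w - h z)); last by ring.
apply: (le_lt_trans (normc_add _ _)); rewrite !normcM'.
have : N (g w - g z) * N (h w) <= N (g w - g z) * (N (h z) + 1).
  by apply: ler_wpM2l; rewrite ?normc_ge0// ltW.
have : N (g z) * N (h w - h z) <= (N (g z) + 1) * N (h w - h z).
  by apply: ler_wpM2r; rewrite ?normc_ge0//; lra.
by lra.
Qed.

Lemma ccontN h z : ccont h z -> ccont (fun w => - h w) z.
Proof.
move=> hc; apply: (@ccont_near (fun w => -1 * h w) _ _ 1) => //.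
  by move=> w _; rewrite mulN1r.
by apply: ccontM => //; exact: ccont_cst.
Qed.

Lemma ccontB g h z : ccont g z -> ccont h z -> ccont (fun w => g w - h w) z.
Proof. by move=> gc hc; apply: ccontD => //; exact: ccontN. Qed.

Lemma ccont_neq0 h z : ccont h z -> h z != 0 ->
  exists2 dl : R, 0 < dl & forall w, N (w - z) < dl -> N (h z) / 2 < N (h w).
Proof.
rewrite -normc_gt0 => hc hz; have h2 : 0 < N (h z) / 2 by lra.
have [dl dl0 H] := hc _ h2; exists dl => // w /H.
by rewrite normc_sub; have := normc_triB (h z) (h w); lra.
Qed.

Lemma ccontV h z : ccont h z -> h z != 0 -> ccont (fun w => (h w)^-1) z.
Proof.
move=> hc hz e e0; have [d1 d10 H1] := ccont_neq0 hc hz.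
have h0 : 0 < N (h z) by rewrite normc_gt0.
have e1 : 0 < e * (N (h z) * (N (h z) / 2)) by rewrite !mulr_gt0.
have [d2 d20 H2] := hc _ e1.
exists (Num.min d1 d2); first by rewrite lt_min d10.
move=> w; rewrite lt_min => /andP[/H1 h1 /H2 h2].
have hw0 : 0 < N (h w) by lra.
have hw : h w != 0 by rewrite -normc_gt0.
rewrite (_ : _ - _ = (h z - h w) / (h z * h w)); last by field; rewrite ?hz ?hw.
rewrite normc_div normcM' ltr_pdivrMr ?mulr_gt0// normc_sub.
apply: (lt_trans h2); rewrite ltr_pM2l// ltr_pM2l//.
Qed.

Lemma cderiv_ccont h z l : cderiv h z l -> ccont h z.
Proof.
move=> /(_ _ ltr01)[dl dl0 H] e e0.
have l0 := normc_ge0 l.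
exists (Num.min dl (e / (N l + 2))); first by rewrite lt_min dl0 divr_gt0//; lra.
move=> w; rewrite lt_min => /andP[/H h1]; rewrite ltr_pdivlMr; last by lra.
have := normc_add (h w - h z - l * (w - z)) (l * (w - z)).
by rewrite subrK normcM' => ? ?; have := normc_ge0 (w - z); lra.
Qed.

Lemma cdiff_ccont h z : cdiff h z -> ccont h z.
Proof. by case=> l; exact: cderiv_ccont. Qed.

Lemma cderiv_cst c z : cderiv (fun=> c) z 0.
Proof. by move=> e e0; exists 1 => // w _; rewrite subrr mul0r subrr normc0E (mulr_ge0 (ltW e0) (normc_ge0 _)). Qed.

Lemma cderiv_id z : cderiv id z 1.
Proof. by move=> e e0; exists 1 => // w _; rewrite mul1r subrr normc0E (mulr_ge0 (ltW e0) (normc_ge0 _)). Qed.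

Lemma cderivD g h z l m : cderiv g z l -> cderiv h z m -> cderiv (fun w => g w + h w) z (l + m).
Proof.
move=> gc hc e e0; have e2 : 0 < e / 2 by lra.
have [d1 d10 H1] := gc _ e2; have [d2 d20 H2] := hc _ e2.
exists (Num.min d1 d2); first by rewrite lt_min d10.
move=> w; rewrite lt_min => /andP[/H1 h1 /H2 h2].
rewrite [X in N X](_ : _ = (g w - g z - l * (w - z)) + (h w - h z - m * (w - z))); last by ring.
by apply: (le_trans (normc_add _ _)); lra.
Qed.

Lemma cderivM g h z l m : cderiv g z l -> cderiv h z m ->
  cderiv (fun w => g w * h w) z (l * h z + g z * m).
Proof.
move=> gc hc e e0; have [d0 d00 H0] := ccont_bound (cderiv_ccont hc).
have hz := normc_ge0 (h z); have gz := normc_ge0 (g z); have l0 := normc_ge0 l.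
have e1 : 0 < e / (3 * (N (h z) + 1)) by rewrite divr_gt0 ?mulr_gt0//; lra.
have e2 : 0 < e / (3 * (N (g z) + 1)) by rewrite divr_gt0 ?mulr_gt0//; lra.
have e3 : 0 < e / (3 * (N l + 1)) by rewrite divr_gt0 ?mulr_gt0//; lra.
have [d1 d10 H1] := gc _ e1; have [d2 d20 H2] := hc _ e2.
have [d3 d30 H3] := cderiv_ccont hc e3.
exists (Num.min (Num.min d0 d3) (Num.min d1 d2)); first by rewrite !lt_min d10 d00 d20 d30.
move=> w; rewrite !lt_min => /andP[/andP[/H0 h0 /H3 h3] /andP[/H1 h1 /H2 h2]].
rewrite [X in N X](_ : _ = (g w - g z - l * (w - z)) * h w + l * (w - z) * (h w - h z)
   + g z * (h w - h z - m * (w - z))); last by ring.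
have n0 := normc_ge0 (w - z).
apply: (le_trans (normc_add _ _)); apply: (le_trans (lerD (normc_add _ _) (lexx _))).
rewrite !normcM'.
have D (a b : R) : 0 <= b -> 0 < 3 * (b + 1) -> e / (3 * (b + 1)) * a * (b + 1) = e / 3 * a.
  by move=> b0 b1; field; rewrite gt_eqF//; lra.
have k1 : N (g w - g z - l * (w - z)) * N (h w) <= e / 3 * N (w - z).
  rewrite -(D _ (N (h z)))//; last by lra.
  by apply: ler_pM; rewrite ?normc_ge0// ltW.
have k2 : N l * N (w - z) * N (h w - h z) <= e / 3 * N (w - z).
  rewrite -(D _ (N l))//; last by lra.
  rewrite mulrC [leRHS]mulrAC [N l * _]mulrC [leRHS]mulrAC -[leRHS]mulrA.
  by apply: ler_pM; rewrite ?normc_ge0 ?mulr_ge0 ?normc_ge0//; [exact: ltW|apply: ler_wpM2l => //; lra].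
have k3 : N (g z) * N (h w - h z - m * (w - z)) <= e / 3 * N (w - z).
  rewrite -(D _ (N (g z)))//; last by lra.
  rewrite mulrC.
  by apply: ler_pM; rewrite ?normc_ge0//; lra.
by lra.
Qed.

Lemma cderivN h z l : cderiv h z l -> cderiv (fun w => - h w) z (- l).
Proof.
move=> hc e e0; have [dl dl0 H] := hc e e0; exists dl => // w /H.
by rewrite -normc_opp; congr (N _ <= _); ring.
Qed.

Lemma cderivV h z l : cderiv h z l -> h z != 0 ->
  cderiv (fun w => (h w)^-1) z (- l / (h z ^+ 2)).
Proof.
move=> hd hz e e0; have hc := cderiv_ccont hd.
have [d1 d10 H1] := ccont_neq0 hc hz.
have n0 : 0 < N (h z) by rewrite normc_gt0.
have l0 := normc_ge0 l.
pose K := N (h z) ^+ 2 / 2.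
have K0 : 0 < K by rewrite divr_gt0// exprn_gt0.
have e1 : 0 < e / 2 * K by rewrite mulr_gt0//; lra.
have e2 : 0 < e / 2 * (K * N (h z)) / (N l + 1) by rewrite divr_gt0 ?mulr_gt0//; lra.
have [d2 d20 H2] := hd _ e1; have [d3 d30 H3] := hc _ e2.
exists (Num.min d1 (Num.min d2 d3)); first by rewrite !lt_min d10 d20.
move=> w; rewrite !lt_min => /andP[/H1 h1 /andP[/H2 h2 /H3 h3]].
have hw0 : 0 < N (h w) by lra.
have hw : h w != 0 by rewrite -normc_gt0.
have m0 := normc_ge0 (w - z).
rewrite [X in N X](_ : _ = - (h w - h z - l * (w - z)) / (h z * h w) +
    l * (w - z) * (h w - h z) / (h z ^+ 2 * h w)); last by field; rewrite ?hz ?hw.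
apply: (le_trans (normc_add _ _)); rewrite !normc_div !normcM' normc_opp -?expr2.
have A : K <= N (h z) * N (h w).
  by rewrite /K expr2 -mulrA ler_pM2l// ltW.
have k1 : N (h w - h z - l * (w - z)) / (N (h z) * N (h w)) <= e / 2 * N (w - z).
  rewrite ler_pdivrMr ?mulr_gt0//; apply: (le_trans h2).
  have e2m : 0 <= e / 2 * N (w - z) by apply: mulr_ge0 => //; lra.
  by have := ler_wpM2l e2m A; lra.
have k2 : N l * N (w - z) * N (h w - h z) / (N (h z) ^+ 2 * N (h w)) <= e / 2 * N (w - z).
  rewrite ler_pdivrMr ?mulr_gt0 ?exprn_gt0//.
  move/ltW: h3; rewrite ler_pdivlMr; last by lra.
  move=> h3.
  have B : K * N (h z) <= N (h z) ^+ 2 * N (h w).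
    by have := ler_wpM2l (ltW n0) A; lra.
  have C : N (h w - h z) * (N l + 1) <= e / 2 * (N (h z) ^+ 2 * N (h w)).
    by apply: (le_trans h3); apply: ler_wpM2l => //; lra.
  have := ler_wpM2r m0 C.
  have : 0 <= N (h w - h z) * N (w - z) by rewrite mulr_ge0 ?normc_ge0.
  by lra.
by lra.
Qed.

Lemma cdiffD g h z : cdiff g z -> cdiff h z -> cdiff (fun w => g w + h w) z.
Proof. by move=> [l gl] [m hm]; exists (l + m); exact: cderivD. Qed.
Lemma cdiffN h z : cdiff h z -> cdiff (fun w => - h w) z.
Proof. by move=> [l hl]; exists (- l); exact: cderivN. Qed.
Lemma cdiffB g h z : cdiff g z -> cdiff h z -> cdiff (fun w => g w - h w) z.
Proof. by move=> gd hd; apply: cdiffD => //; exact: cdiffN. Qed.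
Lemma cdiffM g h z : cdiff g z -> cdiff h z -> cdiff (fun w => g w * h w) z.
Proof. by move=> [l gl] [m hm]; exists (l * h z + g z * m); exact: cderivM. Qed.
Lemma cdiffV h z : cdiff h z -> h z != 0 -> cdiff (fun w => (h w)^-1) z.
Proof. by move=> [l gl] hz; exists (- l / (h z ^+ 2)); exact: cderivV. Qed.
Lemma cdiff_cst c z : cdiff (fun=> c) z.
Proof. by exists 0; exact: cderiv_cst. Qed.
Lemma cdiff_id z : cdiff id z.
Proof. by exists 1; exact: cderiv_id. Qed.
Lemma cdiff_near g h z (dl : R) : 0 < dl -> (forall w, N (w - z) < dl -> g w = h w) ->
  cdiff g z -> cdiff h z.
Proof. by move=> dl0 E [l gl]; exists l; apply: cderiv_near dl0 E gl. Qed.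

Lemma cdiff_poly (p : {poly R[i]}) z : cdiff (fun w => p.[w]) z.
Proof.
elim/poly_ind: p => [|p c IH].
  by apply: (cdiff_near ltr01 _ (cdiff_cst 0 z)) => w _; rewrite horner0.
apply: (cdiff_near ltr01 _ (cdiffD (cdiffM IH (cdiff_id z)) (cdiff_cst c z))) => w _.
by rewrite !hornerE.
Qed.

Lemma holKM g h z : holK g z -> holK h z -> holK (fun w => g w * h w) z.
Proof.
move=> [gc [d1 d10 gd]] [hc [d2 d20 hd]]; split; first exact: ccontM.
exists (Num.min d1 d2); first by rewrite lt_min d10.
move=> w; rewrite lt_min => /andP[w0 /andP[w1 w2]].
by apply: cdiffM; [apply: gd|apply: hd]; apply/andP.
Qed.

Lemma holKD g h z : holK g z -> holK h z -> holK (fun w => g w + h w) z.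
Proof.
move=> [gc [d1 d10 gd]] [hc [d2 d20 hd]]; split; first exact: ccontD.
exists (Num.min d1 d2); first by rewrite lt_min d10.
move=> w; rewrite lt_min => /andP[w0 /andP[w1 w2]].
by apply: cdiffD; [apply: gd|apply: hd]; apply/andP.
Qed.

Lemma holK_cdiff h z (dl : R) : 0 < dl -> (forall w, N (w - z) < dl -> cdiff h w) -> holK h z.
Proof.
move=> dl0 H; split; last by exists dl => // w /andP[_ /H].
by apply/cdiff_ccont/H; rewrite subrr normc0E.
Qed.

Lemma holK_poly (p : {poly R[i]}) z : holK (fun w => p.[w]) z.
Proof. by apply: (holK_cdiff ltr01) => w _; exact: cdiff_poly. Qed.

Lemma holKV h z : holK h z -> h z != 0 -> holK (fun w => (h w)^-1) z.
Proof.
move=> [hc [d2 d20 hd]] hz; split; first exact: ccontV.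
have [d1 d10 H1] := ccont_neq0 hc hz.
exists (Num.min d1 d2); first by rewrite lt_min d10.
move=> w; rewrite lt_min => /andP[w0 /andP[/H1 w1 w2]].
apply: cdiffV; first by apply: hd; rewrite w0.
by rewrite -normc_gt0; apply: le_lt_trans w1; rewrite divr_ge0 ?normc_ge0.
Qed.

Lemma holK_near g h z (dl : R) : 0 < dl -> (forall w, N (w - z) < dl -> g w = h w) ->
  holK g z -> holK h z.
Proof.
move=> dl0 E [gc [d1 d10 gd]]; split; first exact: ccont_near dl0 E gc.
exists (Num.min dl d1); first by rewrite lt_min dl0.
move=> w; rewrite lt_min => /andP[w0 /andP[w1 w2]].
have ww : 0 < dl - N (w - z) by lra.
apply: (cdiff_near ww) (gd w _); last by rewrite w0.
by move=> v vw; apply: E; have := normc_tri w v z; lra.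
Qed.

End Differentiability.

(** * Boundary integrals of rectangles *)

Section Rectangles.
Context {R : realType}.
Implicit Types (f g h : R[i] -> R[i]) (z w p l : R[i]) (x y a b c d m : R).

Definition inR x0 x1 y0 y1 z := x0 <= complex.Re z <= x1 /\ y0 <= complex.Im z <= y1.

Definition onB x0 x1 y0 y1 z := inR x0 x1 y0 y1 z /\
  [\/ complex.Re z = x0, complex.Re z = x1, complex.Im z = y0 | complex.Im z = y1].

Lemma hline h x0 x1 y : (forall t, x0 <= t <= x1 -> ccont h (t +i* y)) ->
  pcont (fun t => h (t +i* y)) x0 x1.
Proof.
move=> H t tx e e0; have [dl dl0 Hd] := H t tx e e0; exists dl => // u _ ut.
by apply: Hd; rewrite /= subrr expr0n addr0 sqrtr_sqr.
Qed.

Lemma vline h x y0 y1 : (forall t, y0 <= t <= y1 -> ccont h (x +i* t)) ->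
  pcont (fun t => h (x +i* t)) y0 y1.
Proof.
move=> H t tx e e0; have [dl dl0 Hd] := H t tx e e0; exists dl => // u _ ut.
by apply: Hd; rewrite /= subrr expr0n add0r sqrtr_sqr.
Qed.

(** The contour integral along the boundary, counterclockwise. *)
Definition rectint h x0 x1 y0 y1 : R[i] :=
  (cint (fun t => h (t +i* y0)) x0 x1 - cint (fun t => h (t +i* y1)) x0 x1)
  + (0 +i* 1) * (cint (fun t => h (x1 +i* t)) y0 y1 - cint (fun t => h (x0 +i* t)) y0 y1).

Section Fixed.
Variables (x0 x1 y0 y1 : R).
Hypotheses (x01 : x0 <= x1) (y01 : y0 <= y1).
Local Notation B := (onB x0 x1 y0 y1).

Lemma onB_sides : [/\ forall t, x0 <= t <= x1 -> B (t +i* y0),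
  forall t, x0 <= t <= x1 -> B (t +i* y1), forall t, y0 <= t <= y1 -> B (x0 +i* t) &
  forall t, y0 <= t <= y1 -> B (x1 +i* t)].
Proof.
by split=> t tx; split; try (split => //=; rewrite lexx ?x01 ?y01//); constructor.
Qed.

Lemma sides_pcont h : (forall z, B z -> ccont h z) ->
  [/\ pcont (fun t => h (t +i* y0)) x0 x1, pcont (fun t => h (t +i* y1)) x0 x1,
      pcont (fun t => h (x0 +i* t)) y0 y1 & pcont (fun t => h (x1 +i* t)) y0 y1].
Proof.
have [B1 B2 B3 B4] := onB_sides => H.
by split; [apply: hline|apply: hline|apply: vline|apply: vline] => t /[dup] tx ?; apply: H;
  [exact: B1|exact: B2|exact: B3|exact: B4].
Qed.

Lemma rectintD g h : (forall z, B z -> ccont g z) -> (forall z, B z -> ccont h z) ->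
  rectint (fun z => g z + h z) x0 x1 y0 y1 = rectint g x0 x1 y0 y1 + rectint h x0 x1 y0 y1.
Proof.
move=> /sides_pcont[g1 g2 g3 g4] /sides_pcont[h1 h2 h3 h4].
by rewrite /rectint !cintD//; ring.
Qed.

Lemma rectintZ l h : (forall z, B z -> ccont h z) ->
  rectint (fun z => l * h z) x0 x1 y0 y1 = l * rectint h x0 x1 y0 y1.
Proof.
by move=> /sides_pcont[h1 h2 h3 h4]; rewrite /rectint !cintZ//; ring.
Qed.

Lemma eq_rectint g h : (forall z, B z -> g z = h z) -> rectint g x0 x1 y0 y1 = rectint h x0 x1 y0 y1.
Proof.
have [B1 B2 B3 B4] := onB_sides => gh; rewrite /rectint.
rewrite (@eq_cint _ (fun t => g (t +i* y0)) (fun t => h (t +i* y0))); last by move=> t /B1/gh.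
rewrite (@eq_cint _ (fun t => g (t +i* y1)) (fun t => h (t +i* y1))); last by move=> t /B2/gh.
rewrite (@eq_cint _ (fun t => g (x0 +i* t)) (fun t => h (x0 +i* t))); last by move=> t /B3/gh.
by rewrite (@eq_cint _ (fun t => g (x1 +i* t)) (fun t => h (x1 +i* t)))// => t /B4/gh.
Qed.

Lemma rectint_bound h (M : R) : (forall z, B z -> ccont h z) ->
  (forall z, B z -> N (h z) <= M) ->
  N (rectint h x0 x1 y0 y1) <= 4 * M * ((x1 - x0) + (y1 - y0)).
Proof.
have [B1 B2 B3 B4] := onB_sides => /sides_pcont[h1 h2 h3 h4] hM.
have i1 : N (0 +i* 1 : R[i]) = 1 by rewrite /= expr0n expr1n add0r sqrtr1.
rewrite /rectint; apply: (le_trans (normc_add _ _)); rewrite normcM' i1 mul1r.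
apply: (le_trans (lerD (normc_add _ _) (normc_add _ _))); rewrite !normc_opp.
have b1 := cint_bound x01 h1 (fun t tx => hM _ (B1 t tx)).
have b2 := cint_bound x01 h2 (fun t tx => hM _ (B2 t tx)).
have b3 := cint_bound y01 h3 (fun t tx => hM _ (B3 t tx)).
have b4 := cint_bound y01 h4 (fun t tx => hM _ (B4 t tx)).
by lra.
Qed.

Lemma rectint_xcut h m : x0 <= m <= x1 -> (forall z, B z -> ccont h z) ->
  rectint h x0 x1 y0 y1 = rectint h x0 m y0 y1 + rectint h m x1 y0 y1.
Proof.
move=> /andP[m0 m1] /sides_pcont[h1 h2 h3 h4].
by rewrite /rectint (cint_cat m0 m1 h1) (cint_cat m0 m1 h2); ring.
Qed.

Lemma rectint_ycut h m : y0 <= m <= y1 -> (forall z, B z -> ccont h z) ->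
  rectint h x0 x1 y0 y1 = rectint h x0 x1 y0 m + rectint h x0 x1 m y1.
Proof.
move=> /andP[m0 m1] /sides_pcont[h1 h2 h3 h4].
by rewrite /rectint (cint_cat m0 m1 h3) (cint_cat m0 m1 h4); ring.
Qed.

Lemma cint_point (g : R -> R[i]) a : cint g a a = 0.
Proof.
have z0 (k : R -> R) : rint k a a = 0.
  rewrite /rint (_ : (`[a, a]%classic) = [set a]); first by rewrite Rintegral_set1.
  by rewrite set_itv1.
by rewrite /cint !z0.
Qed.

Lemma rectint_cst l : rectint (fun=> l) x0 x1 y0 y1 = 0.
Proof. by rewrite /rectint !subrr mulr0 addr0. Qed.

End Fixed.

Lemma rectint_xdegen h x0 y0 y1 : rectint h x0 x0 y0 y1 = 0.
Proof. by rewrite /rectint !cint_point !subrr mulr0 addr0. Qed.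

Lemma rectint_ydegen h x0 x1 y0 : rectint h x0 x1 y0 y0 = 0.
Proof. by rewrite /rectint !cint_point !subrr mulr0 addr0. Qed.

Lemma rectint_id x0 x1 y0 y1 : x0 <= x1 -> y0 <= y1 -> rectint id x0 x1 y0 y1 = 0.
Proof.
move=> x01 y01; rewrite /rectint.
have [p1 p2 p3 p4] := sides_pcont x01 y01 (fun z _ => @ccont_id _ z).
rewrite -!cintB// (@eq_cint _ _ (fun=> (y0 - y1)%:C * (0 +i* 1))); last first.
  by move=> t _; apply/eqP; rewrite eq_complex /=; apply/andP; split; apply/eqP; ring.
rewrite (@eq_cint _ (fun t => _ - _) (fun=> (x1 - x0)%:C)); last first.
  by move=> t _; apply/eqP; rewrite eq_complex /=; apply/andP; split; apply/eqP; ring.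
by rewrite !cint_cst//; apply/eqP; rewrite eq_complex /=; apply/andP; split; apply/eqP; ring.
Qed.

Lemma inR_sub x0 x1 y0 y1 a b c d z : x0 <= a -> b <= x1 -> y0 <= c -> d <= y1 ->
  inR a b c d z -> inR x0 x1 y0 y1 z.
Proof.
by move=> h1 h2 h3 h4 [/andP[r1 r2] /andP[i1 i2]]; split; apply/andP; split; lra.
Qed.

Lemma rectint_quarters h a b c d : a <= b -> c <= d -> (forall z, inR a b c d z -> ccont h z) ->
  rectint h a b c d = (rectint h a ((a+b)/2) c ((c+d)/2) + rectint h ((a+b)/2) b c ((c+d)/2)) +
    (rectint h a ((a+b)/2) ((c+d)/2) d + rectint h ((a+b)/2) b ((c+d)/2) d).
Proof.
move=> ab cd hc.
have xm : a <= (a+b)/2 <= b by lra.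
have ym : c <= (c+d)/2 <= d by lra.
have /andP[y1 y2] := ym.
rewrite (rectint_ycut ab cd ym); last by move=> z [/hc].
rewrite (rectint_xcut ab y1 xm); last by move=> z [/(inR_sub (lexx a) (lexx b) (lexx c) y2)/hc].
by rewrite (rectint_xcut ab y2 xm)//; move=> z [/(inR_sub (lexx a) (lexx b) y1 (lexx d))/hc].
Qed.

(** The bound [e s^2], with [s] half the perimeter, is stable under quartering because
    [4 (s/2)^2 = s^2]. Locally an affine function, whose integral is 0, is subtracted; the remainder
    is at most [(e/4) s] on the boundary, which compensates the 4 of [rectint_bound]. *)
Theorem goursat h x0 x1 y0 y1 : x0 <= x1 -> y0 <= y1 ->
  (forall z, inR x0 x1 y0 y1 z -> cdiff h z) -> rectint h x0 x1 y0 y1 = 0.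
Proof.
move=> x01 y01 hd; apply/eqP; rewrite -normc_eq0; apply/eqP/le_anti; rewrite normc_ge0 andbT.
pose s := (x1 - x0) + (y1 - y0).
suff H e : 0 < e -> N (rectint h x0 x1 y0 y1) <= e * s ^+ 2.
  apply/ler_addgt0Pr => e e0; rewrite add0r.
  have s0 : 0 < s ^+ 2 + 1 by have := sqr_ge0 s; lra.
  have := H (e / (s ^+ 2 + 1)) (divr_gt0 e0 s0) => /le_trans; apply.
  rewrite mulrAC ler_pdivrMr// ler_wpM2l ?ltW//; lra.
move=> e0; pose P a b c d := x0 <= a -> b <= x1 -> y0 <= c -> d <= y1 ->
  N (rectint h a b c d) <= e * ((b - a) + (d - c)) ^+ 2.
suff : P x0 x1 y0 y1 by apply.
apply: cousin => //.
  move=> a b c d ab cd P1 P2 P3 P4 xa bx yc dy.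
  rewrite rectint_quarters//; last by move=> z /(inR_sub xa bx yc dy)/hd/cdiff_ccont.
  have := P1 xa ltac:(lra) yc ltac:(lra).
  have := P2 ltac:(lra) bx yc ltac:(lra).
  have := P3 xa ltac:(lra) ltac:(lra) dy.
  have := P4 ltac:(lra) bx ltac:(lra) dy.
  rewrite (_ : b - (a + b) / 2 = (b - a) / 2); last by field.
  rewrite (_ : (a + b) / 2 - a = (b - a) / 2); last by field.
  rewrite (_ : d - (c + d) / 2 = (d - c) / 2); last by field.
  rewrite (_ : (c + d) / 2 - c = (d - c) / 2); last by field.
  rewrite -mulrDl expr_div_n => p1 p2 p3 p4.
  apply: (le_trans (normc_add _ _)); apply: (le_trans (lerD (normc_add _ _) (normc_add _ _))).
  by lra.
move=> x y xx yy; have [l hl] : cdiff h (x +i* y) by apply: hd.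
have [dl dl0 Hd] := hl (e / 4) ltac:(lra).
exists (dl / 2); first by lra.
move=> a b c d xa /andP[ax xb] bx yc /andP[cy yd] dy ba dc _ _ _ _.
have ab : a <= b by lra.
have cd : c <= d by lra.
pose g w := h w + (- h (x +i* y) + - l * (w + - (x +i* y))).
have hc z : inR a b c d z -> ccont h z by move=> /(inR_sub xa bx yc dy)/hd/cdiff_ccont.
have Bin z : onB a b c d z -> inR a b c d z by case.
have Eg : rectint h a b c d = rectint g a b c d.
  rewrite /g rectintD//; last 2 first.
  - by move=> z /Bin/hc.
  - by move=> z _; apply: ccontD; [exact: ccont_cst|apply: ccontM; [exact: ccont_cst|apply: ccontD; [exact: ccont_id|exact: ccont_cst]]].
  rewrite rectintD//; last 2 first.
  - by move=> z _; exact: ccont_cst.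
  - by move=> z _; apply: ccontM; [exact: ccont_cst|apply: ccontD; [exact: ccont_id|exact: ccont_cst]].
  rewrite rectintZ//; last by move=> z _; apply: ccontD; [exact: ccont_id|exact: ccont_cst].
  rewrite rectintD//; last 2 first.
  - by move=> z _; exact: ccont_id.
  - by move=> z _; exact: ccont_cst.
  by rewrite !rectint_cst rectint_id// !addr0 mulr0 !addr0.
pose s' := (b - a) + (d - c).
have gM z : onB a b c d z -> N (g z) <= e / 4 * s'.
  move=> /Bin[/andP[r1 r2] /andP[i1 i2]].
  have zs : N (z - (x +i* y)) <= s'.
    apply: (le_trans (normc_ReIm _)); rewrite !raddfB /=.
    have : `|complex.Re z - x| <= b - a by rewrite ler_norml; lra.
    have : `|complex.Im z - y| <= d - c by rewrite ler_norml; lra.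
    by rewrite /s'; lra.
  have -> : g z = h z - h (x +i* y) - l * (z - (x +i* y)) by rewrite /g; ring.
  apply: (le_trans (Hd z _)); first by apply: (le_lt_trans zs); rewrite /s'; lra.
  by apply: ler_wpM2l => //; lra.
have gc z : onB a b c d z -> ccont g z.
  move=> /Bin/hc hz; apply: ccontD => //.
  by apply: ccontD; [exact: ccont_cst|apply: ccontM; [exact: ccont_cst|apply: ccontD; [exact: ccont_id|exact: ccont_cst]]].
have := rectint_bound ab cd gc gM; rewrite -Eg => /le_trans; apply.
by rewrite /s'; lra.
Qed.

End Rectangles.

(** * Cauchy formula *)

Section Cauchy.
Context {R : realType}.
Implicit Types (f g h : R[i] -> R[i]) (z w p l : R[i]) (x y a b c d m : R).

(** The strips cut off around the inner rectangle avoid [p], so their integrals vanish. Alternatives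
    such as [a = x0] admit a point [p] on the outer boundary, where the strip is degenerate. *)
Lemma rectint_shrink h p x0 x1 y0 y1 a b c d :
  x0 <= a -> a <= complex.Re p -> complex.Re p <= b -> b <= x1 ->
  y0 <= c -> c <= complex.Im p -> complex.Im p <= d -> d <= y1 ->
  a = x0 \/ a < complex.Re p -> b = x1 \/ complex.Re p < b ->
  c = y0 \/ c < complex.Im p -> d = y1 \/ complex.Im p < d ->
  (forall z, inR x0 x1 y0 y1 z -> ~ (a < complex.Re z < b /\ c < complex.Im z < d) -> ccont h z) ->
  (forall a' b' c' d', x0 <= a' -> a' <= b' -> b' <= x1 -> y0 <= c' -> c' <= d' -> d' <= y1 ->
     [\/ complex.Re p < a', b' < complex.Re p, complex.Im p < c' | d' < complex.Im p] ->
     rectint h a' b' c' d' = 0) ->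
  rectint h x0 x1 y0 y1 = rectint h a b c d.
Proof.
move=> xa ap pb bx yc cp pd dy Ha Hb Hc Hd Cz V.
have x01 : x0 <= x1 by lra.
have y01 : y0 <= y1 by lra.
rewrite (@rectint_xcut _ _ _ _ _ x01 y01 _ a); [|by lra|].
  2: { move=> z [zi zB]; apply: Cz => // -[/andP[? ?] /andP[? ?]]; case: zB => ?; lra. }
rewrite (_ : rectint h x0 a y0 y1 = 0) ?add0r; last first.
  case: Ha => [->|Ha]; first exact: rectint_xdegen.
  by apply: V => //; [lra|constructor 2].
have ax1 : a <= x1 by lra.
rewrite (@rectint_xcut _ _ _ _ _ ax1 y01 _ b); [|by lra|].
  2: { move=> z [zi zB]; apply: Cz => [|[/andP[? ?] /andP[? ?]]]; last by case: zB => ?; lra.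
       exact: inR_sub zi. }
rewrite (_ : rectint h b x1 y0 y1 = 0) ?addr0; last first.
  case: Hb => [->|Hb]; first exact: rectint_xdegen.
  by apply: V => //; [lra|constructor 1].
have ab : a <= b by lra.
rewrite (@rectint_ycut _ _ _ _ _ ab y01 _ c); [|by lra|].
  2: { move=> z [zi zB]; apply: Cz => [|[/andP[? ?] /andP[? ?]]]; last by case: zB => ?; lra.
       exact: inR_sub zi. }
rewrite (_ : rectint h a b y0 c = 0) ?add0r; last first.
  case: Hc => [->|Hc]; first exact: rectint_ydegen.
  by apply: V => //; [lra|constructor 4].
have cy1 : c <= y1 by lra.
rewrite (@rectint_ycut _ _ _ _ _ ab cy1 _ d); [|by lra|].
  2: { move=> z [zi zB]; apply: Cz => [|[/andP[? ?] /andP[? ?]]]; last by case: zB => ?; lra.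
       exact: inR_sub zi. }
rewrite (_ : rectint h a b d y1 = 0) ?addr0//.
case: Hd => [->|Hd]; first exact: rectint_ydegen.
by apply: V => //; [lra|constructor 3].
Qed.

Lemma eq0_small (X K e0 : R) : 0 <= X -> 0 < e0 -> 0 <= K ->
  (forall e, 0 < e -> e < e0 -> X <= K * e) -> X = 0.
Proof.
move=> X0 e00 K0 H; apply/eqP; rewrite eq_le X0 andbT; apply/ler_addgt0Pr => e e1.
rewrite add0r; pose e2 := Num.min (e / (K + 1)) (e0 / 2).
have K1 : 0 < K + 1 by lra.
have e20 : 0 < e2 by rewrite lt_min !divr_gt0.
have e2e : e2 < e0 by rewrite /e2 gt_min; apply/orP; right; lra.
apply: (le_trans (H _ e20 e2e)).
have : e2 <= e / (K + 1) by rewrite ge_min lexx.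
by rewrite ler_pdivlMr// => h; lra.
Qed.

(** By continuity [h] is bounded near [p], and shrinking to rectangles at [p] with sides at most
    [2 e] makes the integral [O(e)]. *)
Lemma goursat1 h p x0 x1 y0 y1 : inR x0 x1 y0 y1 p ->
  (forall z, inR x0 x1 y0 y1 z -> ccont h z) ->
  (forall z, inR x0 x1 y0 y1 z -> z != p -> cdiff h z) -> rectint h x0 x1 y0 y1 = 0.
Proof.
move=> Rp; case: (Rp) => /andP[px0 px1] /andP[py0 py1] hc hd.
apply/eqP; rewrite -normc_eq0; apply/eqP.
have [dl dl0 Hb] := ccont_bound (hc _ Rp).
apply: (@eq0_small _ (16 * (N (h p) + 1)) (dl / 4)); rewrite ?normc_ge0//; first by lra.
  by have := normc_ge0 (h p); lra.
move=> e e0 ed.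
pose a := Num.max x0 (complex.Re p - e); pose b := Num.min x1 (complex.Re p + e).
pose c := Num.max y0 (complex.Im p - e); pose d := Num.min y1 (complex.Im p + e).
have ax : x0 <= a by rewrite le_max lexx.
have ap : a <= complex.Re p by rewrite ge_max px0; lra.
have pb : complex.Re p <= b by rewrite le_min px1; lra.
have bx : b <= x1 by rewrite ge_min lexx.
have cy : y0 <= c by rewrite le_max lexx.
have cp : c <= complex.Im p by rewrite ge_max py0; lra.
have pd : complex.Im p <= d by rewrite le_min py1; lra.
have dy : d <= y1 by rewrite ge_min lexx.
have ba : b - a <= 2 * e.
  have : b <= complex.Re p + e by rewrite ge_min lexx orbT.
  have : complex.Re p - e <= a by rewrite le_max lexx orbT.
  by lra.
have dc : d - c <= 2 * e.
  have : d <= complex.Im p + e by rewrite ge_min lexx orbT.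
  have : complex.Im p - e <= c by rewrite le_max lexx orbT.
  by lra.
rewrite (@rectint_shrink h p x0 x1 y0 y1 a b c d)//.
- have ab : a <= b by lra.
  have cd : c <= d by lra.
  have hB z : onB a b c d z -> ccont h z by case=> /(inR_sub ax bx cy dy)/hc.
  have hM z : onB a b c d z -> N (h z) <= N (h p) + 1.
    move=> [[/andP[r1 r2] /andP[i1 i2]] _]; apply/ltW/Hb.
    apply: (le_lt_trans (normc_ReIm _)); rewrite !raddfB /=.
    have : `|complex.Re z - complex.Re p| <= b - a by rewrite ler_norml; lra.
    have : `|complex.Im z - complex.Im p| <= d - c by rewrite ler_norml; lra.
    by lra.
  apply: (le_trans (rectint_bound ab cd hB hM)).
  have M0 : 0 <= N (h p) + 1 by have := normc_ge0 (h p); lra.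
  have : (b - a + (d - c)) * (N (h p) + 1) <= 4 * e * (N (h p) + 1) by apply: ler_wpM2r => //; lra.
  by lra.
- rewrite /a; case: (leP x0 (complex.Re p - e)) => h'; [right; lra|by left].
- rewrite /b; case: (leP x1 (complex.Re p + e)) => h'; [by left|right; lra].
- rewrite /c; case: (leP y0 (complex.Im p - e)) => h'; [right; lra|by left].
- rewrite /d; case: (leP y1 (complex.Im p + e)) => h'; [by left|right; lra].
- by move=> z zR _; exact: hc.
- move=> a' b' c' d' xa ab bx' yc cd dy' np; apply: goursat => // z zi.
  apply: hd; first exact: inR_sub zi.
  by case: zi => /andP[? ?] /andP[? ?]; apply/eqP => E; subst z; case: np; lra.
Qed.

(** Bisection ends at rectangles with at most one exceptional point, where [goursat1] applies. *)
Theorem goursatK h x0 x1 y0 y1 : x0 <= x1 -> y0 <= y1 ->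
  (forall z, inR x0 x1 y0 y1 z -> holK h z) -> rectint h x0 x1 y0 y1 = 0.
Proof.
move=> x01 y01 hK.
pose P a b c d := x0 <= a -> b <= x1 -> y0 <= c -> d <= y1 -> rectint h a b c d = 0.
suff : P x0 x1 y0 y1 by apply.
apply: cousin => //.
  move=> a b c d ab cd P1 P2 P3 P4 xa bx yc dy.
  rewrite rectint_quarters//; last by move=> z /(inR_sub xa bx yc dy)/hK[].
  rewrite P1 ?P2 ?P3 ?P4 ?addr0//; lra.
move=> x y xx yy; have [_ [dl dl0 hd]] : holK h (x +i* y) by apply: hK.
exists (dl / 2) => [|a b c d xa axb bx yc cyd dy ba dc _ _ _ _]; first by lra.
apply: (@goursat1 _ (x +i* y)) => //.
  by move=> z /(inR_sub xa bx yc dy)/hK[].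
move=> z [/andP[? ?] /andP[? ?]] zp; apply: hd.
rewrite normc_gt0 subr_eq0 zp; apply: (le_lt_trans (normc_ReIm _)); rewrite !raddfB /=.
have : `|complex.Re z - x| <= b - a by rewrite ler_norml; lra.
have : `|complex.Im z - y| <= d - c by rewrite ler_norml; lra.
by lra.
Qed.

(** The square has centre [p] and half-side [t]. *)
Definition sq h p t := rectint h (complex.Re p - t) (complex.Re p + t) (complex.Im p - t) (complex.Im p + t).

Definition inSq p t := inR (complex.Re p - t) (complex.Re p + t) (complex.Im p - t) (complex.Im p + t).
Definition onSq p t := onB (complex.Re p - t) (complex.Re p + t) (complex.Im p - t) (complex.Im p + t).

Lemma onSq_dist p t z : 0 <= t -> onSq p t z -> t <= N (z - p) <= 2 * t.
Proof.
move=> t0 [[/andP[r1 r2] /andP[i1 i2]] zB]; apply/andP; split; last first.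
  apply: (le_trans (normc_ReIm _)); rewrite !raddfB /=.
  have : `|complex.Re z - complex.Re p| <= t by rewrite ler_norml; lra.
  have : `|complex.Im z - complex.Im p| <= t by rewrite ler_norml; lra.
  by lra.
have [h1 h2] := (normc_Re (z - p), normc_Im (z - p)).
rewrite !raddfB /= in h1 h2.
have a1 := ler_norm (complex.Re z - complex.Re p); have a2 := lerNnormlW (lexx `|complex.Re z - complex.Re p|).
have b1 := ler_norm (complex.Im z - complex.Im p); have b2 := lerNnormlW (lexx `|complex.Im z - complex.Im p|).
by case: zB => E; lra.
Qed.

Lemma sub_neq0 z p : z != p -> z - p != 0.
Proof. by rewrite subr_eq0. Qed.

Lemma holK_sub p z : holK (fun w => w - p) z.
Proof.
apply: (holK_cdiff ltr01) => w _.
by apply: cdiffB; [exact: cdiff_id|exact: cdiff_cst].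
Qed.

(* Only continuity of h at p is used, so p may be an exceptional point. *)
Theorem cauchy h p x0 x1 y0 y1 :
  x0 < complex.Re p < x1 -> y0 < complex.Im p < y1 ->
  (forall z, inR x0 x1 y0 y1 z -> holK h z) ->
  rectint (fun z => h z / (z - p)) x0 x1 y0 y1 = h p * rectint (fun z => (z - p)^-1) x0 x1 y0 y1.
Proof.
move=> /andP[px0 px1] /andP[py0 py1] hK.
have x01 : x0 <= x1 by lra.
have y01 : y0 <= y1 by lra.
pose F z := (h z + - h p) * (z - p)^-1.
have FK z : inR x0 x1 y0 y1 z -> z != p -> holK F z.
  move=> zR zp; apply: holKM; last by apply: holKV; [exact: holK_sub|exact: sub_neq0].
  apply: holKD; [exact: hK|apply: (holK_cdiff ltr01) => w _; exact: cdiff_cst].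
have Bp z : onB x0 x1 y0 y1 z -> inR x0 x1 y0 y1 z /\ z != p.
  by case=> zi zB; split=> //; apply/eqP => E; subst z; case: zB; lra.
suff F0 : rectint F x0 x1 y0 y1 = 0.
  have Vc z : onB x0 x1 y0 y1 z -> ccont (fun z => (z - p)^-1) z.
    by move=> /Bp[zi zp]; have [] := holKV (holK_sub p z) (sub_neq0 zp).
  rewrite -(rectintZ x01 y01 _ Vc) -[RHS]add0r -F0 -rectintD//.
  - by apply: eq_rectint => // z _; rewrite /F -mulrDl subrK.
  - by move=> z /Bp[zi zp]; have [] := FK _ zi zp.
  - by move=> z /Vc vz; apply: ccontM => //; exact: ccont_cst.
apply/eqP; rewrite -normc_eq0; apply/eqP.
(* On the boundary of a square of half-side [t] at [p] the integrand is at most [e / t], and the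
   perimeter is [8 t]; so the integral is [O(e)] however small [t] is. *)
pose e0 := Num.min (Num.min (complex.Re p - x0) (x1 - complex.Re p))
                   (Num.min (complex.Im p - y0) (y1 - complex.Im p)).
apply: (@eq0_small _ 16 1) => //; first exact: normc_ge0.
move=> e e1 _; have [] : holK h p by apply: hK; split; apply/andP; split; exact: ltW.
move=> /(_ e e1)[dl dl0 Hd] _.
pose t := Num.min (dl / 4) (e0 / 2).
have e00 : 0 < e0 by rewrite !lt_min !subr_gt0 px0 px1 py0 py1.
have t0 : 0 < t by rewrite lt_min !divr_gt0.
have te : t < e0 by rewrite gt_min; apply/orP; right; lra.
have td : t <= dl / 4 by rewrite ge_min lexx.
have [t1 t2 t3 t4] : [/\ t < complex.Re p - x0, t < x1 - complex.Re p, t < complex.Im p - y0 & t < y1 - complex.Im p].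
  by move: te; rewrite /e0 !lt_min => /andP[/andP[? ?] /andP[? ?]].
have inner z : z = p -> complex.Re p - t < complex.Re z < complex.Re p + t /\ complex.Im p - t < complex.Im z < complex.Im p + t.
  by move=> ->; split; lra.
rewrite (@rectint_shrink F p x0 x1 y0 y1 (complex.Re p - t) (complex.Re p + t) (complex.Im p - t) (complex.Im p + t)); try lra.
- have ab : complex.Re p - t <= complex.Re p + t by lra.
  have cd : complex.Im p - t <= complex.Im p + t by lra.
  have zR z : onSq p t z -> inR x0 x1 y0 y1 z /\ z != p.
    move=> zB; have /andP[h1 _] := onSq_dist (ltW t0) zB; split.
      by case: zB => [[/andP[? ?] /andP[? ?]]] _; split; lra.
    by rewrite -subr_eq0 -normc_gt0; lra.
  have FM z : onSq p t z -> N (F z) <= e / t.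
    move=> zB; have /andP[h1 h2] := onSq_dist (ltW t0) zB.
    rewrite /F normcM' normcV'; apply: ler_pM; rewrite ?normc_ge0 ?invr_ge0 ?normc_ge0//.
      by apply/ltW/Hd; lra.
    by rewrite lef_pV2 ?posrE//; lra.
  have Fc z : onSq p t z -> ccont F z by move=> /zR[zi zp]; have [] := FK _ zi zp.
  apply: (le_trans (rectint_bound ab cd Fc FM)).
  by rewrite [leLHS](_ : _ = 16 * e)//; field; exact: lt0r_neq0.
- move=> z zi zn; have [] := FK z zi _ => //.
  by apply/eqP => E; apply: zn; exact: inner.
- move=> a' b' c' d' xa ab bx' yc cd dy' np; apply: goursatK => // z zi.
  apply: FK; first exact: inR_sub zi.
  by case: zi => /andP[? ?] /andP[? ?]; apply/eqP => E; subst z; case: np; lra.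
Qed.

(* 1 / (z - p) is compared on the boundary with 18/25 conj (z - p) / t^2, whose
   integral is explicit: the multiplier 18/25 makes the error smaller. *)
Lemma sq_inv_lb p t : 0 < t -> 4 / 25 <= N (sq (fun z => (z - p)^-1) p t).
Proof.
move=> t0.
have ab : complex.Re p - t <= complex.Re p + t by lra.
have cd : complex.Im p - t <= complex.Im p + t by lra.
pose k : R[i] := (18 / 25 / t ^+ 2)%:C.
pose G z : R[i] := conjc (z - p).
have Gc z : ccont G z.
  move=> e e0; exists e => // w wz; rewrite /G -raddfB /= normc_conj.
  by rewrite (_ : w - p - (z - p) = w - z)//; ring.
have Vc z : onSq p t z -> ccont (fun z => (z - p)^-1) z.
  move=> zB; have /andP[h1 _] := onSq_dist (ltW t0) zB.
  have zp : z - p != 0 by rewrite -normc_gt0; lra.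
  by have [] := holKV (holK_sub p z) zp.
have kGc z : ccont (fun z => - k * G z) z by apply: ccontM => //; exact: ccont_cst.
have EG : sq G p t = (0 +i* (8 * t ^+ 2)).
  rewrite /sq /rectint.
  have [p1 p2 p3 p4] := sides_pcont ab cd (fun z _ => Gc z).
  rewrite -!cintB// (@eq_cint _ _ (fun=> 0 +i* (2 * t))); last first.
    move=> u _; rewrite /G; apply/eqP; rewrite eq_complex.
    by case: (p) => px py /=; apply/andP; split; apply/eqP; ring.
  rewrite (@eq_cint _ (fun t => _ - _) (fun=> (2 * t)%:C)); last first.
    move=> u _; rewrite /G; apply/eqP; rewrite eq_complex.
    by case: (p) => px py /=; apply/andP; split; apply/eqP; ring.
  by rewrite !cint_cst//; apply/eqP; rewrite eq_complex /=; apply/andP; split; apply/eqP; ring.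
have E1 : sq (fun z => (z - p)^-1 + - k * G z) p t = sq (fun z => (z - p)^-1) p t - k * sq G p t.
  by rewrite /sq rectintD// rectintZ// mulNr.
have nk : N (k * sq G p t) = 144 / 25.
  rewrite EG normcM' normcZ ger0_norm; last by rewrite divr_ge0 ?exprn_ge0 ?(ltW t0)//; lra.
  rewrite (_ : N (0 +i* _) = 8 * t ^+ 2); last first.
    by rewrite /= expr0n add0r sqrtr_sqr ger0_norm// mulr_ge0// exprn_ge0// ltW.
  by field; rewrite gt_eqF.
(* Since [conjc (z - p)] is [|z - p|^2 / (z - p)], the error is [|1 - 18/25 v^2| / (v t)] with
   [v = |z - p| / t], and [1 <= v <= sqrt 2 < 71/50]. The main term has norm [144/25] and the error
   contributes at most [4 * 7/20 * 4 = 28/5], which leaves [4/25]. *)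
have B z : onSq p t z -> N ((z - p)^-1 + - k * G z) <= 7 / 20 / t.
  move=> zB; have /andP[h1 h2] := onSq_dist (ltW t0) zB.
  have h3 : N (z - p) ^+ 2 <= 2 * t ^+ 2.
    case: zB => -[/andP[r1 r2] /andP[i1 i2]] _; rewrite normc_sqr !raddfB /=.
    have q1 : (complex.Re z - complex.Re p) ^+ 2 <= t ^+ 2.
      rewrite -[leLHS]real_normK ?num_real//; apply: lerXn2r; rewrite ?nnegrE ?(ltW t0)// ler_norml; lra.
    have q2 : (complex.Im z - complex.Im p) ^+ 2 <= t ^+ 2.
      rewrite -[leLHS]real_normK ?num_real//; apply: lerXn2r; rewrite ?nnegrE ?(ltW t0)// ler_norml; lra.
    by lra.
  pose s := N (z - p).
  have s0 : 0 < s by rewrite /s; lra.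
  have zp : z - p != 0 by rewrite -normc_gt0.
  have -> : (z - p)^-1 + - k * G z = (z - p)^-1 * (1 - 18 / 25 * (s / t) ^+ 2)%:C.
    rewrite /k /G; have := mulc_conj (z - p); rewrite -/s => Ec.
    have Ek : conjc (z - p) = (z - p)^-1 * (s ^+ 2)%:C by rewrite -Ec mulKf.
    have -> : (1 - 18 / 25 * (s / t) ^+ 2)%:C = 1 - k * (s ^+ 2)%:C.
      by rewrite /k -rmorphM -(rmorph1 (real_complex R)) -rmorphB /=; congr (_%:C); field; rewrite gt_eqF.
    by rewrite Ek; ring.
  rewrite normcM' normcV' normcZ -/s.
  pose v := s / t.
  have vs : s = v * t by rewrite /v divfK// gt_eqF.
  have v1 : 1 <= v by rewrite /v ler_pdivlMr// mul1r.
  have v2 : v ^+ 2 <= 2 by rewrite /v expr_div_n ler_pdivrMr ?exprn_gt0.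
  have v3 : v <= 71 / 50.
    rewrite leNgt; apply/negP => v3.
    have : (71 / 50) * (71/50) < v * v by apply: ltr_pM; lra.
    by move: v2; rewrite expr2; lra.
  have v0 : 0 < v by lra.
  rewrite -/v vs; set X := `|_|.
  rewrite (_ : (v * t)^-1 * X = X / v / t); last by field; rewrite !gt_eqF.
  rewrite ler_pM2r ?invr_gt0// ler_pdivrMr// /X.
  have q : v ^+ 2 <= 121 / 50 * v - 71 / 50.
    have : 0 <= (71 / 50 - v) * (v - 1) by apply: mulr_ge0; lra.
    by rewrite expr2; lra.
  have q1 : 1 <= v ^+ 2 by rewrite expr_ge1//; lra.
  by rewrite ler_norml; lra.
have := rectint_bound ab cd (fun z zB => ccontD (Vc z zB) (kGc z)) B.
rewrite -/(sq _ p t) E1.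
rewrite (_ : 4 * _ * _ = 28 / 5); last by field; rewrite gt_eqF.
have := normc_triB (k * sq G p t) (sq (fun z => (z - p)^-1) p t).
by rewrite nk normc_sub; lra.
Qed.

(** In Cauchy's formula on a square of half-side [t] the integrand is [O(1 / t^2)] on a contour of
    length [8 t], while the integral of [1 / (z - p)] stays away from 0. *)
Lemma liouville_dec h (C R1 : R) : (forall z, holK h z) ->
  (forall z, R1 <= N z -> N (h z) * N z <= C) -> forall p, h p = 0.
Proof.
move=> hK hC p; apply/eqP; rewrite -normc_eq0; apply/eqP.
have C0 : 0 <= C.
  apply: le_trans (hC (`|R1|)%:C _); first by rewrite mulr_ge0 ?normc_ge0.
  by rewrite normcZ normr_id ler_norm.
pose m := `|R1| + N p + 1.
have m0 : 0 < m by have := normr_ge0 R1; have := normc_ge0 p; rewrite /m; lra.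
(* 1 / e is the half-size of the square used in the Cauchy formula *)
apply: (@eq0_small _ (400 * (C + 1)) (Num.min 1 (1 / (2 * m)))).
- exact: normc_ge0.
- by rewrite lt_min ltr01 divr_gt0// mulr_gt0.
- by lra.
move=> e e0; rewrite lt_min => /andP[e1].
rewrite ltr_pdivlMr ?mulr_gt0// => em.
pose t := e^-1.
have t0 : 0 < t by rewrite invr_gt0.
have et : e * t = 1 by rewrite divff// gt_eqF.
have tm : 2 * m < t.
  by rewrite -(ltr_pM2l e0) et.
have ab : complex.Re p - t <= complex.Re p + t by lra.
have cd : complex.Im p - t <= complex.Im p + t by lra.
have E := @cauchy h p (complex.Re p - t) (complex.Re p + t) (complex.Im p - t) (complex.Im p + t) ltac:(lra) ltac:(lra) (fun z _ => hK z).
have zB' z : onSq p t z -> [/\ t <= N (z - p), t / 2 <= N z & R1 <= N z].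
  move=> /(onSq_dist (ltW t0))/andP[h1 h2].
  have := normc_add z (- p); rewrite normc_opp => h3.
  have := ler_norm R1; have := normr_ge0 R1; have := normc_ge0 p.
  by rewrite /m in tm; split=> //; lra.
have bound z : onSq p t z -> N (h z / (z - p)) <= 2 * C * e * e.
  move=> /zB'[h1 h2 h3]; have := hC z h3 => h4.
  rewrite normc_div; apply: ler_pM; rewrite ?normc_ge0 ?invr_ge0 ?normc_ge0//.
    have z0 : 0 < N z by lra.
    have : N (h z) * (t / 2) <= C by apply: le_trans h4; apply: ler_wpM2l => //; exact: normc_ge0.
    move=> /(ler_wpM2r (ltW e0)) h5.
    rewrite (_ : _ * e = N (h z) / 2 * (e * t)) in h5; last by ring.
    by rewrite et in h5; lra.
  have n0 : 0 < N (z - p) by lra.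
  by rewrite -div1r ler_pdivrMr// -et ler_pM2l.
have zc z : onSq p t z -> ccont (fun z => h z / (z - p)) z.
  move=> /zB'[h1 _ _]; have zp : z - p != 0 by rewrite -normc_gt0; lra.
  by apply: ccontM; [have [] := hK z|have [] := holKV (holK_sub p z) zp].
have := rectint_bound ab cd zc bound; rewrite E normcM' => h6.
have h7 := ler_wpM2l (normc_ge0 (h p)) (sq_inv_lb p t0).
have h8 := le_trans h7 h6.
have E2 : 4 * (2 * C * e * e) * (complex.Re p + t - (complex.Re p - t) + (complex.Im p + t - (complex.Im p - t))) = 32 * C * e * (e * t) by ring.
rewrite E2 et mulr1 in h8.
have Ce : 0 <= C * e by rewrite mulr_ge0// ltW.
by lra.
Qed.

(** The value [k] filled in at [a] is meant to be the derivative of [h] there. *)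
Definition divdiff h (a k : R[i]) z := if z == a then k else (h z + - h a) * (z - a)^-1.

Lemma divdiffE h (a k : R[i]) z : z != a -> divdiff h a k z = (h z + - h a) * (z - a)^-1.
Proof. by rewrite /divdiff => /negbTE ->. Qed.

Lemma divdiffK h (a k : R[i]) z : h z = h a + (z - a) * divdiff h a k z.
Proof.
have [->|za] := eqVneq z a; first by rewrite subrr mul0r addr0.
by rewrite divdiffE// mulrC divfK ?subr_eq0// addrC subrK.
Qed.

(** Off [a] the quotient inherits the property from [h]; at [a] itself continuity is asked, and this
    is the differentiability of [h]. *)
Lemma holK_divdiff h (a k : R[i]) z : cderiv h a k -> holK h z -> holK (divdiff h a k) z.
Proof.
move=> hk hz.
have near v : v != a -> exists2 dl : R, 0 < dl &
    forall w, N (w - v) < dl -> (h w + - h a) * (w - a)^-1 = divdiff h a k w.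
  move=> va; exists (N (v - a)); first by rewrite normc_gt0 subr_eq0.
  move=> w wv; rewrite divdiffE//; apply/eqP => E; subst w.
  by rewrite normc_sub ltxx in wv.
have [za|za] := eqVneq z a; last first.
  have [dl dl0 Hdl] := near z za; apply: (holK_near dl0 Hdl).
  apply: holKM; last by apply: holKV; [exact: holK_sub|exact: sub_neq0].
  by apply: holKD => //; apply: (holK_cdiff ltr01) => w _; exact: cdiff_cst.
subst z; split.
  move=> e e0; have e2 : 0 < e / 2 by lra.
  have [d1 d10 H1] := hk _ e2; exists d1 => // w wa.
  rewrite {2}/divdiff eqxx.
  have [->|wna] := eqVneq w a; first by rewrite /divdiff eqxx subrr normc0E.
  rewrite divdiffE//; have wa0 : w - a != 0 by rewrite subr_eq0.
  have wn0 : 0 < N (w - a) by rewrite normc_gt0.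
  rewrite (_ : _ - k = (h w - h a - k * (w - a)) / (w - a)); last by field.
  by rewrite normc_div ltr_pdivrMr//; apply: le_lt_trans (H1 _ wa) _; rewrite ltr_pM2r//; lra.
have [d2 d20 Hd2] := hz.2; exists d2 => // w /[dup] w2 /andP[w0 _].
have wa : w != a by rewrite -subr_eq0 -normc_gt0.
have [dl dl0 Hdl] := near w wa; apply: (cdiff_near dl0 Hdl).
apply: cdiffM; first by apply: cdiffD; [exact: Hd2|exact: cdiff_cst].
by apply: cdiffV; [apply: cdiffB; [exact: cdiff_id|exact: cdiff_cst]|rewrite subr_eq0].
Qed.

(* h'(a) T(a) = int (h z - h a) / (z - a)^2 over a fixed square, and the right-hand
   side depends continuously on a *)
Lemma cderiv_neq0_near h p l (r : R) : 0 < r -> (forall w, N (w - p) < r -> cdiff h w) ->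
  cderiv h p l -> l != 0 ->
  exists2 e, 0 < e & forall w (k : R[i]), N (w - p) < e -> cderiv h w k -> k != 0.
Proof.
move=> r0 hd hl l0.
have [dl dl0 Hb] := ccont_bound (cderiv_ccont hl).
pose t := Num.min (r / 4) (dl / 4).
have t0 : 0 < t by rewrite lt_min !divr_gt0.
have tr : t <= r / 4 by rewrite ge_min lexx.
have td : t <= dl / 4 by rewrite ge_min lexx orbT.
have ab : complex.Re p - t <= complex.Re p + t by lra.
have cd : complex.Im p - t <= complex.Im p + t by lra.
have inr z : inSq p t z -> N (z - p) < r.
  move=> [/andP[r1 r2] /andP[i1 i2]].
  apply: (le_lt_trans (normc_ReIm _)); rewrite !raddfB /=.
  have : `|complex.Re z - complex.Re p| <= t by rewrite ler_norml; lra.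
  have : `|complex.Im z - complex.Im p| <= t by rewrite ler_norml; lra.
  by lra.
have hc z : inSq p t z -> ccont h z by move=> /inr/hd/cdiff_ccont.
pose Phi (a : R[i]) := sq (fun z => (h z + - h a) * ((z - a)^-1 * (z - a)^-1)) p t.
pose T (a : R[i]) := sq (fun z => (z - a)^-1) p t.
have PhiE (a m : R[i]) : N (a - p) < t -> cderiv h a m -> Phi a = m * T a.
  move=> ap hm.
  pose g := divdiff h a m.
  have ra := le_lt_trans (normc_Re (a - p)) ap.
  have ia := le_lt_trans (normc_Im (a - p)) ap.
  rewrite !raddfB /= !ltr_norml in ra ia.
  have ga : g a = m by rewrite /g /divdiff eqxx.
  have gK z : inSq p t z -> holK g z.
    move=> zi; have zr := inr z zi; apply: holK_divdiff => //.
    have Hr : 0 < r - N (z - p) by lra.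
    by apply: (holK_cdiff Hr) => w wz; apply: hd; have := normc_tri z w p; lra.
  have C := @cauchy g a _ _ _ _ _ _ gK.
  rewrite /T -{1}ga /sq -C; [|lra|lra].
  apply: eq_rectint => // z zB; have za : z != a.
    apply/eqP => E; subst z; have /andP[] := onSq_dist (ltW t0) zB; lra.
  by rewrite /g divdiffE// mulrA.
have pt : N (p - p) < t by rewrite subrr normc0E.
have [be Ebe] : exists be : R, be = N l * (4 / 25) by eexists.
have be0 : 0 < be by rewrite Ebe mulr_gt0 ?normc_gt0//; lra.
have Pp : be <= N (Phi p).
  by rewrite Ebe (PhiE p l pt hl) normcM'; apply: ler_wpM2l; rewrite ?normc_ge0//; exact: sq_inv_lb.
pose M := 2 * N (h p) + 2.
have M0 : 0 < M by have := normc_ge0 (h p); rewrite /M; lra.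
have eta0 : 0 < be * t / 256 by have := mulr_gt0 be0 t0; lra.
have [d1 d10 H1] := cderiv_ccont hl eta0.
have M400 : 0 < 400 * M by lra.
have d20 : 0 < be * t ^+ 2 / (400 * M) := divr_gt0 (mulr_gt0 be0 (exprn_gt0 2 t0)) M400.
exists (Num.min d1 (Num.min (t / 2) (be * t ^+ 2 / (400 * M)))).
  by rewrite !lt_min d10 d20 divr_gt0.
move=> a k; rewrite !lt_min => /andP[/H1 h1 /andP[h2]].
rewrite (ltr_pdivlMr _ _ M400) => h3 hk.
have at_ : N (a - p) < t by lra.
apply/eqP => k0; have := PhiE a k at_ hk; rewrite k0 mul0r => Pa.
have za z : onSq p t z -> t / 2 <= N (z - a) /\ t <= N (z - p) <= 2 * t.
  move=> /(onSq_dist (ltW t0))/[dup]zp /andP[? _]; split=> //.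
  by have := normc_tri a z p; lra.
pose F (b : R[i]) z := (h z + - h b) * ((z - b)^-1 * (z - b)^-1).
have Fc (b : R[i]) z : onSq p t z -> z != b -> ccont (F b) z.
  move=> [zi _] zb; have [Vc _] := holKV (holK_sub b z) (sub_neq0 zb).
  by apply: ccontM; [apply: ccontD; [exact: hc|exact: ccont_cst]|exact: ccontM].
have znb z : onSq p t z -> z != a /\ z != p.
  by move=> /za[q1 /andP[q2 _]]; rewrite -!(subr_eq0 z) -!normc_gt0; split; lra.
have Fac z : onSq p t z -> ccont (F a) z by move=> zB; apply: Fc => //; have [] := znb _ zB.
have Fpc z : onSq p t z -> ccont (F p) z by move=> zB; apply: Fc => //; have [] := znb _ zB.
have Fpc' z : onSq p t z -> ccont (fun z => -1 * F p z) z.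
  by move=> /Fpc ?; apply: ccontM => //; exact: ccont_cst.
have EP : sq (fun z => F a z + -1 * F p z) p t = Phi a - Phi p.
  by rewrite /sq rectintD// rectintZ// mulN1r.
(* Over the whole square this gives [be / 4 + 96 M |a - p| / t^2], at most [be / 2] by the choice of
   the radii, whereas [Phi p] has norm at least [be] and [Phi a = 0]. *)
have DM z : onSq p t z -> N (F a z + -1 * F p z) <= be / (64 * t) + 6 * M * N (a - p) / t ^+ 3.
  move=> zB; have [q1 /andP[q2 q3]] := za _ zB; have [na np] := znb _ zB.
  pose Va := (z - a)^-1; pose Vp := (z - p)^-1.
  have ea : z - a != 0 by rewrite subr_eq0.
  have ep : z - p != 0 by rewrite subr_eq0.
  have nVa : N Va <= 2 / t.
    by rewrite /Va normcV' -[2 / t]invf_div lef_pV2 ?posrE ?divr_gt0//; lra.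
  have nVp : N Vp <= 1 / t.
    by rewrite /Vp normcV' -[1 / t]invf_div lef_pV2 ?posrE ?divr_gt0//; lra.
  rewrite /F (_ : _ + _ = (h p - h a) * (Va * Va) + (h z - h p) * ((a - p) * (Va * Vp) * (Va + Vp))); last first.
    by rewrite /Va /Vp; field; rewrite ea ep.
  apply: (le_trans (normc_add _ _)); rewrite !normcM'.
  have it : 0 < t^-1 by rewrite invr_gt0.
  apply: lerD.
    rewrite (_ : be / (64 * t) = be * t / 256 * (2 / t * (2 / t))); last by field; rewrite gt_eqF.
    apply: ler_pM; rewrite ?mulr_ge0 ?normc_ge0//; first by rewrite normc_sub ltW.
    by apply: ler_pM; rewrite ?normc_ge0.
  rewrite (_ : 6 * M * N (a - p) / t ^+ 3 = M * (N (a - p) * (2 / t * (1 / t)) * (3 / t))); last by field; rewrite gt_eqF.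
  apply: ler_pM; rewrite ?mulr_ge0 ?normc_ge0//.
    have := Hb z ltac:(lra); have := normc_add (h z) (- h p); rewrite normc_opp /M.
    by have := normc_ge0 (h p); lra.
  apply: ler_pM; rewrite ?mulr_ge0 ?normc_ge0//.
    by apply: ler_wpM2l; rewrite ?normc_ge0//; apply: ler_pM; rewrite ?normc_ge0.
  by have := normc_add Va Vp; lra.
have := rectint_bound ab cd (fun z zB => ccontD (Fac z zB) (Fpc' z zB)) DM.
rewrite -/(sq _ p t) EP Pa sub0r normc_opp.
rewrite (_ : 4 * _ * _ = be / 4 + 96 * (N (a - p) * M) / t ^+ 2); last by field; rewrite gt_eqF.
have : 96 * (N (a - p) * M) / t ^+ 2 <= be / 4.
  have := mulr_ge0 (normc_ge0 (a - p)) (ltW M0).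
  by rewrite ler_pdivrMr ?exprn_gt0//; lra.
by lra.
Qed.

End Cauchy.

(** * Liouville theorem and area of plane covers *)

Section LiouvillePoly.
Context {R : realType}.

(** A divided difference lowers the growth exponent by one and stays in the class [holK]; at
    exponent 0 the function decays and therefore vanishes. *)
Lemma liouville_poly (h : R[i] -> R[i]) n (C R1 : R) : (forall z, holK h z) ->
  (forall z, R1 <= N z -> N (h z) * N z <= C * N z ^+ n) ->
  exists p : {poly R[i]}, forall z, h z = p.[z].
Proof.
elim: n h C R1 => [|n IH] h C R1 hK hC.
  exists 0 => z; rewrite horner0; apply: (@liouville_dec _ h C R1 hK) => w wR.
  by have := hC w wR; rewrite expr0 mulr1.
have [_ [dl dl0 hd]] := hK 0.
(* The centre must be a point of differentiability, and 0 may be exceptional. *)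
have [l hl] : cdiff h (dl / 2)%:C.
  apply: hd; rewrite subr0 normcZ ger0_norm; lra.
set a := _%:C in hl.
have a0 : 0 <= N a := normc_ge0 a.
have [p Hp] : exists p : {poly R[i]}, forall z, divdiff h a l z = p.[z].
  apply: (IH _ (2 * (C + N (h a))) (Num.max R1 (2 * N a + 1))).
    by move=> z; exact: holK_divdiff.
  move=> z; rewrite ge_max => /andP[zR za].
  have z1 : 1 <= N z by lra.
  have z0 : 0 < N z by lra.
  have zna : z != a by apply/eqP => E; rewrite E in za; lra.
  have := hC z zR; rewrite exprSr mulrA ler_pM2r// => hz.
  have zn1 : 1 <= N z ^+ n by exact: exprn_ege1.
  have dz : N z / 2 <= N (z - a) by have := normc_triB z a; lra.
  have dz0 : 0 < N (z - a) by lra.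
  rewrite divdiffE// normcM' normcV' mulrAC ler_pdivrMr//.
  have h1 : N (h z + - h a) <= (C + N (h a)) * N z ^+ n.
    apply: (le_trans (normc_add _ _)); rewrite normc_opp.
    by have := ler_wpM2l (normc_ge0 (h a)) zn1; lra.
  apply: (le_trans (ler_wpM2r (ltW z0) h1)).
  have K0 : 0 <= (C + N (h a)) * N z ^+ n by apply: le_trans h1; exact: normc_ge0.
  by have := ler_wpM2l K0 dz; lra.
exists ((h a)%:P + ('X - a%:P) * p) => z.
by rewrite (divdiffK h a l z) Hp !hornerE.
Qed.

End LiouvillePoly.

Section Area.
Context {R : realType}.
Local Notation mu := (@lebesgue_measure R).
Local Notation mu2 := (mu \x mu)%E.

(** [p.1] is the centre and [p.2] half of the side. *)
Definition box (p : R * R * R) : set (R * R) :=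
  `[p.1.1 - p.2, p.1.1 + p.2] `*` `[p.1.2 - p.2, p.1.2 + p.2].

Lemma measurable_box p : measurable (box p).
Proof. by apply: measurableX; exact: measurable_itv. Qed.

Lemma itv_measure (a r : R) : 0 <= r -> mu `[a - r, a + r] = (2 * r)%:E.
Proof.
move=> r0; have /= -> := lebesgue_measure_itv `[a - r, a + r].
rewrite lte_fin; case: ltP => h.
  by rewrite -EFinD; congr EFin; ring.
by congr EFin; lra.
Qed.

Lemma box_measure p : 0 <= p.2 -> mu2 (box p) = (4 * p.2 ^+ 2)%:E.
Proof.
move=> p0; rewrite product_measure1E; try exact: measurable_itv.
transitivity ((2 * p.2)%:E * (2 * p.2)%:E)%E; last by rewrite -EFinM; congr EFin; ring.
by congr (_ * _)%E; exact: itv_measure.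
Qed.

(** Lebesgue measure is finitely subadditive, and the factor 4 in the areas cancels. In Sard's
    theorem this shows that small boxes miss a point. *)
Lemma boxes_cover (L : seq (R * R * R)) (p0 : R * R * R) : 0 <= p0.2 ->
  all (fun p => 0 <= p.2) L ->
  (forall x, box p0 x -> exists2 p, p \in L & box p x) ->
  p0.2 ^+ 2 <= \sum_(p <- L) p.2 ^+ 2.
Proof.
move=> p00 L0 cov.
pose U := foldr (fun p S => box p `|` S) set0 L.
have mU : measurable U.
  rewrite /U; elim: (L) => [|p L' IH] /=; first exact: measurable0.
  by apply: measurableU => //; exact: measurable_box.
have UL : (mu2 U <= (4 * \sum_(p <- L) p.2 ^+ 2)%:E)%E.
  rewrite /U; elim: (L) L0 => [|p L' IH] /=; first by rewrite measure0 big_nil mulr0.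
  move=> /andP[q0 q]; rewrite big_cons mulrDr EFinD -box_measure//.
  apply: le_trans (leeD2l _ (IH q)).
  apply: measureU2; first exact: measurable_box.
  elim: (L') => [|q' L'' IH'] /=; first exact: measurable0.
  by apply: measurableU => //; exact: measurable_box.
have sub : box p0 `<=` U.
  move=> x /cov[p pL px]; rewrite /U; elim: (L) pL => [//|q L' IH] /=.
  by rewrite inE => /orP[/eqP <-|/IH]; [left|right].
have h : (mu2 (box p0) <= mu2 U)%E.
  by apply: le_measure; rewrite ?inE//; exact: measurable_box.
have := le_trans h UL.
by rewrite box_measure// lee_fin ler_pM2l.
Qed.

End Area.

(** * Meromorphic functions and regular values *)

Section Meromorphic.
Context {R : realType}.
Implicit Types (f : R[i] -> sphere R) (z w : R[i]).

Lemma normC_E z : `|z| = (N z)%:C.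
Proof. by []. Qed.

(** Radii of balls in [R[i]^o] are elements of [R[i]]; positivity makes the imaginary part 0, so the
    real part serves as radius. *)
Lemma nbhs_normc (P : set R[i]^o) (z : R[i]^o) : (\forall w \near z, P w) ->
  exists2 dl : R, 0 < dl & forall w : R[i], N (w - z) < dl -> P w.
Proof.
move=> /nbhs_ballP[[dl im] /= dl0 H].
move: (dl0); rewrite ltcE /= => /andP[/eqP im0 dl1].
exists dl => // w wz; apply: H; rewrite /ball /= normC_E normc_sub.
by rewrite im0 -[dl +i* 0]/(dl%:C) ltcR.
Qed.

Lemma dnbhs_normc (P : set R[i]^o) (z : R[i]^o) : (\forall w \near z^', P w) ->
  exists2 dl : R, 0 < dl & forall w : R[i], 0 < N (w - z) < dl -> P w.
Proof.
rewrite /prop_near1 /= => /nbhs_normc[dl dl0 H]; exists dl => // w /andP[w0 w1].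
by apply: (H w w1); rewrite -subr_eq0 -normc_gt0.
Qed.

Lemma derivable_cdiff (F : R[i]^o -> R[i]^o) (z : R[i]^o) : derivable F z 1 -> cdiff F z.
Proof.
move=> /cvg_ex[l /cvgrPdist_le Hl]; exists l => e e0.
have eC : 0 < e%:C :> R[i] by rewrite ltcR.
have [dl dl0 H] := dnbhs_normc (Hl _ eC); exists dl => // w wz.
have [->|wz0] := eqVneq w z.
  by rewrite !subrr mulr0 subrr normc0E mulr0.
have wz' : w - z != 0 by rewrite subr_eq0.
have n0 : 0 < N (w - z) by rewrite normc_gt0.
have := H (w - z); rewrite subr0 n0 wz => /(_ isT).
rewrite normC_E lecR /= /shift /= => h.
rewrite -(ler_pM2r n0) in h; apply: le_trans h; rewrite -normcM'.
rewrite -[(w - z) *: 1]/((w - z) * 1) mulr1 subrK.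
rewrite -[_ *: _]/(_ * _) mulrBl normc_sub.
rewrite [X in _ <= N (_ - X)](_ : _ = F w - F z); last by rewrite mulrC mulVKf.
by rewrite -normc_opp le_eqVlt; apply/orP; left; apply/eqP; congr N; ring.
Qed.

Local Notation F f := (finite_part f : R[i] -> R[i]).

Lemma finite_partE f z : f z <> None -> f z = Some (F f z).
Proof. by rewrite /finite_part; case: (f z). Qed.

Lemma mero_finite f z : meromorphic f -> f z <> None -> regular_at f z.
Proof. by move=> mf fz; case: (mf z) => // -[]. Qed.

Lemma regular_near f z : meromorphic f -> regular_at f z -> exists2 dl : R, 0 < dl &
  forall w, N (w - z) < dl -> f w = Some (F f w) /\ cdiff (F f) w.
Proof.
move=> mf [/nbhs_normc[dl dl0 H] _]; exists dl => // w /H fw; split.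
  exact: finite_partE.
by have [_ /derivable_cdiff] := mero_finite mf fw.
Qed.

Lemma qdist_None (v : R[i]) : 1 / (N v + 1) <= qdist (Some v) None.
Proof.
rewrite hpt_Some (_ : None = hpt 1 0); last by rewrite /hpt eqxx.
rewrite qdist_hpt ?oner_eq0 ?orbT// mulr0 sub0r normc_opp mulr1 normc1E.
have e1 : nrm (1 : R[i]) 0 = 1 by rewrite /nrm normc0E normc1E expr0n addr0 expr1n sqrtr1.
have := nrm_le v 1; rewrite normc1E => h.
have v0 : 0 < nrm v 1 by rewrite nrm_gt0// oner_eq0 orbT.
by rewrite e1 mulr1 !div1r lef_pV2 ?posrE//; lra.
Qed.

Lemma pole_near f p (M : R) : meromorphic f -> pole_at f p -> exists2 dl : R, 0 < dl &
  forall w, 0 < N (w - p) < dl -> [/\ f w = Some (F f w), cdiff (F f) w & M < N (F f w)].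
Proof.
move=> mf [fp /dnbhs_normc[d1 d10 H1] /cvgrPdist_lt Hq].
have M1 : 0 < `|M| + 1 by have := normr_ge0 M; lra.
have e0 : 0 < 1 / (`|M| + 1) by rewrite divr_gt0.
have [d2 d20 H2] := dnbhs_normc (Hq _ e0).
exists (Num.min d1 d2); first by rewrite lt_min d10.
move=> w; rewrite lt_min => /andP[w0 /andP[w1 w2]].
have fw : f w <> None by apply: H1; rewrite w0.
have E := finite_partE fw; split => //.
  by have [_ /derivable_cdiff] := mero_finite mf fw.
have := H2 w; rewrite w0 w2 => /(_ isT) h.
have := qdist_None (F f w); rewrite -E => h2.
have h3 : qdist (f w) None < 1 / (`|M| + 1).
  by apply: le_lt_trans h; rewrite sub0r normrN ler_norm.
have := le_lt_trans h2 h3; have n0 := normc_ge0 (F f w).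
rewrite !div1r ltf_pV2 ?posrE//; last by lra.
by have := ler_norm M; lra.
Qed.

(* Sard's theorem, using that nearby critical points only occur near critical points. *)
Lemma regular_value f x0 x1 y0 y1 (w0 : R[i]) (e : R) : meromorphic f ->
  x0 <= x1 -> y0 <= y1 -> 0 < e -> exists2 w1 : R[i], N (w1 - w0) < e &
    forall z, inR x0 x1 y0 y1 z -> f z = Some w1 -> ~ cderiv (F f) z 0.
Proof.
move=> mf x01 y01 e0; apply: contrapT => /forall2NP nw.
pose S := (x1 - x0) + (y1 - y0).
(* Chosen with [eta S^2 < (e / 4)^2]: boxes of this total size cannot cover the box of half-side
   [e / 4] at [w0]. *)
pose eta := (e / 4) ^+ 2 / (S ^+ 2 + 1).
have e4 : 0 < e / 4 by lra.
have S1 : 0 < S ^+ 2 + 1 by have := sqr_ge0 S; lra.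
have eta0 : 0 < eta by rewrite divr_gt0// exprn_gt0.
pose good (L : seq (R * R * R)) a b c d := forall z, inR a b c d z -> cderiv (F f) z 0 ->
  f z = Some (F f z) -> N (F f z - w0) < e ->
  exists2 p : R * R * R, p \in L & box p (complex.Re (F f z), complex.Im (F f z)).
pose P a b c d := x0 <= a -> b <= x1 -> y0 <= c -> d <= y1 -> exists L : seq (R * R * R),
  [/\ all (fun p => 0 <= p.2) L,
    \sum_(p <- L) p.2 ^+ 2 <= eta * ((b - a) + (d - c)) ^+ 2 & good L a b c d].
have PP : P x0 x1 y0 y1.
  apply: cousin => //.
    move=> a b c d ab cd P1 P2 P3 P4 xa bx yc dy.
    have [L1 [n1 s1 g1]] := P1 xa ltac:(lra) yc ltac:(lra).
    have [L2 [n2 s2 g2]] := P2 ltac:(lra) bx yc ltac:(lra).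
    have [L3 [n3 s3 g3]] := P3 xa ltac:(lra) ltac:(lra) dy.
    have [L4 [n4 s4 g4]] := P4 ltac:(lra) bx ltac:(lra) dy.
    exists (L1 ++ L2 ++ L3 ++ L4); split.
    - by rewrite !all_cat n1 n2 n3 n4.
    - rewrite !big_cat /=; move: s1 s2 s3 s4.
      rewrite (_ : b - (a + b) / 2 = (b - a) / 2); last by field.
      rewrite (_ : (a + b) / 2 - a = (b - a) / 2); last by field.
      rewrite (_ : d - (c + d) / 2 = (d - c) / 2); last by field.
      rewrite (_ : (c + d) / 2 - c = (d - c) / 2); last by field.
      rewrite -mulrDl expr_div_n; lra.
    - move=> z [/andP[r1 r2] /andP[i1 i2]] cz fz zw.
      have sub L : L = L1 \/ L = L2 \/ L = L3 \/ L = L4 -> {subset L <= L1 ++ L2 ++ L3 ++ L4}.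
        by move=> H p pL; rewrite !mem_cat; case: H => [|[|[|]]] E; rewrite -E pL ?orbT.
      case: (leP (complex.Im z) ((c + d) / 2)) => hy;
      case: (leP (complex.Re z) ((a + b) / 2)) => hx.
      + have [|p pL bp] := g1 z _ cz fz zw; first by split; apply/andP; split.
        by exists p => //; apply: sub pL; left.
      + have [|p pL bp] := g2 z _ cz fz zw; first by split; apply/andP; split=> //; exact: ltW.
        by exists p => //; apply: sub pL; right; left.
      + have [|p pL bp] := g3 z _ cz fz zw; first by split; apply/andP; split=> //; exact: ltW.
        by exists p => //; apply: sub pL; right; right; left.
      + have [|p pL bp] := g4 z _ cz fz zw; first by split; apply/andP; split=> //; exact: ltW.
        by exists p => //; apply: sub pL; right; right; right.
  move=> x y xx yy; pose z0 : R[i] := x +i* y.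
  have dist (dl a b c d : R) : a <= x <= b -> c <= y <= d -> b - a < dl / 2 -> d - c < dl / 2 ->
      forall z, inR a b c d z -> N (z - z0) <= (b - a) + (d - c) < dl.
    move=> /andP[? ?] /andP[? ?] ? ? z [/andP[? ?] /andP[? ?]]; apply/andP; split; last by lra.
    apply: (le_trans (normc_ReIm _)); rewrite !raddfB /=.
    have : `|complex.Re z - x| <= b - a by rewrite ler_norml; lra.
    have : `|complex.Im z - y| <= d - c by rewrite ler_norml; lra.
    by lra.
  (* Near a noncritical point there are no critical points, and near a pole no values close to [w0],
     so the empty list works. Near a critical point a rectangle is mapped into a box of half-side
     [k s], where [k^2 <= k <= eta]. *)
  case: (mf z0) => [/(regular_near mf)[dl dl0 Hr]|pz].
    have [_ [l hl]] : f z0 = Some (F f z0) /\ cdiff (F f) z0.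
      by apply: Hr; rewrite subrr normc0E.
    have [l0|l0] := eqVneq l 0; last first.
      have [d1 d10 H1] := cderiv_neq0_near dl0 (fun w wz => (Hr w wz).2) hl l0.
      exists (d1 / 2) => [|a b c d xa axb bx yc cyd dy ba dc _ _ _ _]; first by lra.
      exists [::]; split=> //.
        by rewrite big_nil mulr_ge0 ?sqr_ge0// ltW.
      move=> z zi cz _ _; have /andP[q1 q2] := dist d1 a b c d axb cyd ba dc z zi.
      by have := H1 z 0 (le_lt_trans q1 q2) cz; rewrite eqxx.
    rewrite {}l0 in hl.
    pose k := Num.min 1 eta.
    have k0 : 0 < k by rewrite lt_min ltr01.
    have k1 : k <= 1 by rewrite ge_min lexx.
    have ke : k <= eta by rewrite ge_min lexx orbT.
    have [d1 d10 H1] := hl k k0.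
    exists (d1 / 2) => [|a b c d xa axb bx yc cyd dy ba dc _ _ _ _]; first by lra.
    set s := (b - a) + (d - c).
    have s0 : 0 <= s by move: axb cyd => /andP[? ?] /andP[? ?]; rewrite /s; lra.
    exists [:: (complex.Re (F f z0), complex.Im (F f z0), k * s)]; split.
    - by rewrite /= andbT mulr_ge0// ltW.
    - rewrite big_seq1 /= exprMn; apply: ler_wpM2r; first exact: sqr_ge0.
      by apply: le_trans ke; rewrite expr2 ler_piMr// ltW.
    - move=> z zi _ _ _; have /andP[q1 q2] := dist d1 a b c d axb cyd ba dc z zi.
      exists (complex.Re (F f z0), complex.Im (F f z0), k * s); first by rewrite inE.
      have := H1 z (le_lt_trans q1 q2); rewrite mul0r subr0 => h.
      have h' : N (F f z - F f z0) <= k * s.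
        by apply: (le_trans h); apply: ler_wpM2l q1; exact: ltW.
      have := le_trans (normc_Re _) h'; have := le_trans (normc_Im _) h'.
      rewrite !raddfB /= !ler_norml => /andP[? ?] /andP[? ?].
      by split; rewrite /= in_itv /=; apply/andP; split; lra.
  have [dl dl0 Hp] := pole_near (N w0 + e) mf pz.
  exists (dl / 2) => [|a b c d xa axb bx yc cyd dy ba dc _ _ _ _]; first by lra.
  exists [::]; split=> //.
    by rewrite big_nil mulr_ge0 ?sqr_ge0// ltW.
  move=> z zi _ fz zw; have /andP[q1 q2] := dist dl a b c d axb cyd ba dc z zi.
  have [E|zz] := eqVneq z z0; first by case: pz => pz _ _; rewrite E pz in fz.
  have [|_ _] := Hp z; first by rewrite normc_gt0 subr_eq0 zz /=; exact: le_lt_trans q1 q2.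
  by have := normc_triB (F f z) w0; lra.
have [L [L0 sL gL]] := PP (lexx _) (lexx _) (lexx _) (lexx _).
have cov x : box (complex.Re w0, complex.Im w0, e / 4) x -> exists2 p, p \in L & box p x.
  case: x => x y [] /=; rewrite !in_itv /= => /andP[x2 x3] /andP[y2 y3].
  have nxy : N ((x +i* y) - w0) < e.
    apply: (le_lt_trans (normc_ReIm _)); rewrite !raddfB /=.
    have : `|x - complex.Re w0| <= e / 4 by rewrite ler_norml; lra.
    have : `|y - complex.Im w0| <= e / 4 by rewrite ler_norml; lra.
    by lra.
  have [//|] := nw (x +i* y).
  move=> /existsNP[z /not_implyP[zi /not_implyP[fz /contrapT cz]]].
  have EF : F f z = x +i* y by rewrite /finite_part fz.
  by have := gL z zi cz; rewrite EF => /(_ fz nxy).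
have := @boxes_cover _ L (complex.Re w0, complex.Im w0, e / 4) (ltW e4) L0 cov; rewrite /= => h.
have := le_trans h sL; rewrite -/S /eta mulrAC ler_pdivlMr//.
by rewrite ler_pM2l ?exprn_gt0//; lra.
Qed.

End Meromorphic.

(** * Removable singularities and reciprocals *)

Section Removable.
Context {R : realType}.
Implicit Types (f g h k : R[i] -> R[i]) (z w : R[i]) (p q : {poly R[i]}).

Lemma poly_neq0_near p z : p != 0 -> exists2 dl : R, 0 < dl &
  forall w, 0 < N (w - z) < dl -> p.[w] != 0.
Proof.
move=> p0; have [m [u + E]] := multiplicity_XsubC p z; rewrite p0 /= => uz.
have [e /andP[e0 _] [b b0 H]] := poly_local_lb uz; exists e => // w /andP[w0 we].
rewrite E hornerM horner_exp hornerXsubC mulf_neq0 ?expf_neq0//.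
  by rewrite -normc_gt0; apply: lt_le_trans (H w we).
by rewrite -normc_gt0.
Qed.

Lemma near_point z (dl : R) : 0 < dl -> exists w, 0 < N (w - z) < dl.
Proof.
move=> dl0; exists (z + (dl / 2)%:C).
by rewrite addrC addKr normcZ ger0_norm; lra.
Qed.

Lemma ccont_unique g h z (dl : R) : ccont g z -> ccont h z -> 0 < dl ->
  (forall w, 0 < N (w - z) < dl -> g w = h w) -> g z = h z.
Proof.
move=> gc hc dl0 E; apply/eqP; rewrite -subr_eq0 -normc_eq0; apply/eqP.
apply: (@eq0_small _ _ 2 1); rewrite ?normc_ge0// => e e0 _.
have [d1 d10 H1] := gc e e0; have [d2 d20 H2] := hc e e0.
have [|w] := @near_point z (Num.min dl (Num.min d1 d2)); first by rewrite !lt_min dl0 d10.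
rewrite !lt_min => /andP[w0 /andP[w1 /andP[/H1 w2 /H2 w3]]].
have Ew : g w = h w by apply: E; rewrite w0.
have := normc_tri (g w) (g z) (h z); rewrite {2}Ew (normc_sub (g z) (g w)).
by lra.
Qed.

Definition removable g z := exists k, holK k z /\
  exists2 dl : R, 0 < dl & forall w, 0 < N (w - z) < dl -> k w = g w.

Lemma holK_removable g z : holK g z -> removable g z.
Proof. by move=> gz; exists g; split=> //; exists 1. Qed.

Lemma removableM g h z : holK h z -> removable g z -> removable (fun w => h w * g w) z.
Proof.
move=> hz [k [kz [dl dl0 E]]]; exists (fun w => h w * k w); split; first exact: holKM.
by exists dl => // w /E ->.
Qed.

(** At each point the value of the local extension chosen there is taken; continuity makes
    neighbouring local extensions agree. *)
Lemma removable_extension g : (forall z, removable g z) -> exists h,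
  (forall z, holK h z) /\ (forall z, holK g z -> h z = g z).
Proof.
move=> /choice[k Hk]; exists (fun z => k z z).
have same z (h : R[i] -> R[i]) (dl : R) : ccont h z -> 0 < dl ->
    (forall w, 0 < N (w - z) < dl -> h w = g w) -> k z z = h z.
  move=> hc dl0 E; have [[kc _] [d1 d10 E1]] := Hk z.
  apply: (@ccont_unique _ _ _ (Num.min dl d1)) => //; first by rewrite lt_min dl0.
  by move=> w; rewrite lt_min => /andP[w0 /andP[w1 w2]]; rewrite E1 ?E// w0.
split=> z; last first.
  by move=> [gc _]; apply: (same _ _ 1).
have [kK [dl dl0 E]] := Hk z; have [_ [d1 d10 kd]] := kK.
apply: (@holK_near _ (k z) _ z (Num.min dl d1)) => //; first by rewrite lt_min dl0.
move=> w; rewrite lt_min => /andP[w1 w2].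
have [->//|wz] := eqVneq w z.
have w0 : 0 < N (w - z) by rewrite normc_gt0 subr_eq0.
have kw : ccont (k z) w by apply/cdiff_ccont/kd; rewrite w0.
apply/esym/(same _ _ (Num.min (N (w - z)) (dl - N (w - z)))) => //.
  by rewrite lt_min w0; lra.
move=> v; rewrite lt_min => /andP[v0 /andP[v1 v2]]; apply: E; apply/andP; split.
  by rewrite normc_gt0 subr_eq0; apply/eqP => vz; rewrite vz normc_sub ltxx in v1.
by have := normc_tri w v z; lra.
Qed.

Lemma poly_growth p : exists2 C : R, 0 <= C & forall z, 1 <= N z -> N p.[z] <= C * N z ^+ size p.
Proof.
elim/poly_ind: p => [|p c [C C0 H]].
  by exists 0 => // z _; rewrite horner0 normc0E mul0r.
have [->|p0] := eqVneq p 0.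
  exists (N c) => [|z z1]; first exact: normc_ge0.
  rewrite mul0r add0r hornerC; apply: ler_peMr; rewrite ?normc_ge0//.
  exact: exprn_ege1.
exists (C + N c) => [|z z1]; first by rewrite addr_ge0 ?normc_ge0.
rewrite !hornerE size_MXaddC (negbTE p0) /=.
apply: (le_trans (normc_add _ _)); rewrite normcM' mulrDl; apply: lerD.
  by rewrite exprSr mulrA; apply: ler_wpM2r; [exact: normc_ge0|exact: H].
by apply: ler_peMr; rewrite ?normc_ge0//; exact: exprn_ege1.
Qed.

End Removable.

Section Omitted.
Context {R : realType}.
Variable f : R[i] -> sphere R.
Hypothesis mf : meromorphic f.
Local Notation F := (finite_part f : R[i] -> R[i]).
Implicit Types z w : R[i].

Lemma mero_qcont z (e : R) : 0 < e -> exists2 dl : R, 0 < dl &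
  forall w, 0 < N (w - z) < dl -> qdist (f w) (f z) < e.
Proof.
move=> e0; case: (mf z) => [/(regular_near mf)[dl dl0 H]|pz].
  have [|fz /cdiff_ccont Fc] := H z; first by rewrite subrr normc0E.
  have [d1 d10 H1] := Fc e e0.
  exists (Num.min dl d1); first by rewrite lt_min dl0.
  move=> w; rewrite lt_min => /andP[_ /andP[/H[fw _] /H1 w2]].
  by rewrite fw fz; apply: le_lt_trans w2; exact: qdist_le_dist.
case: pz => fz _ /cvgrPdist_lt/(_ e e0)/dnbhs_normc[dl dl0 H]; exists dl => // w /H.
by rewrite fz sub0r normrN ger0_norm// qdist_ge0.
Qed.

Variable w1 : R[i].
(* The values at the w1-points of f are junk. *)
Definition recip z : R[i] := if f z is Some v then (v - w1)^-1 else 0.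

(** At a pole the reciprocal tends to the value 0 that it is given there, and [holK] asks only
    continuity at the point itself. The second part, together with [recip_simple_pole], isolates
    poles and [w1]-points. *)
Lemma recip_holK z : f z <> Some w1 -> holK recip z /\
  exists2 dl : R, 0 < dl & forall w, 0 < N (w - z) < dl -> f w <> None /\ f w <> Some w1.
Proof.
move=> fz1.
have near z0 (dl : R) : 0 < dl -> (forall w, N (w - z0) < dl ->
   [/\ f w = Some (F w), cdiff F w & F w != w1]) -> holK recip z0.
  move=> dl0 H; apply: (@holK_near _ (fun w => (F w - w1)^-1) _ _ dl) => //.
    by move=> w /H[fw _ _]; rewrite /recip fw.
  apply: (holK_cdiff dl0) => w /H[_ Fw w1w]; apply: cdiffV; last by rewrite subr_eq0.
  by apply: cdiffB => //; exact: cdiff_cst.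
case: (mf z) => [/(regular_near mf)[dl dl0 H]|pz].
  have [|fz Fd] := H z; first by rewrite subrr normc0E.
  have Fz : F z - w1 != 0 by rewrite subr_eq0; apply/eqP => E; apply: fz1; rewrite fz E.
  have Fc : ccont (fun w => F w - w1) z.
    by apply: ccontB; [exact: cdiff_ccont|exact: ccont_cst].
  have [d1 d10 H1] := ccont_neq0 Fc Fz.
  have m0 : 0 < Num.min dl d1 by rewrite lt_min dl0.
  have HH w : N (w - z) < Num.min dl d1 -> [/\ f w = Some (F w), cdiff F w & F w != w1].
    rewrite lt_min => /andP[/H[fw Fw] /H1 h]; split=> //.
    by rewrite -subr_eq0 -normc_gt0; apply: le_lt_trans h; rewrite divr_ge0 ?normc_ge0.
  split; first exact: near HH.
  by exists (Num.min dl d1) => // w /andP[_ /HH[-> _ /eqP ne]]; split=> // -[].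
have [dl dl0 H] := pole_near (N w1) mf pz.
have HH w : 0 < N (w - z) < dl -> [/\ f w = Some (F w), cdiff F w & F w != w1].
  by move=> /H[fw Fw Fl]; split=> //; apply/eqP => E; rewrite E ltxx in Fl.
split; last by exists dl => // w /HH[-> _ /eqP ne]; split=> // -[].
have fz : f z = None by case: pz.
split.
  move=> e e0; have [d1 d10 H1] := pole_near (N w1 + e^-1) mf pz.
  exists d1 => // w wd; rewrite {2}/recip fz subr0.
  have [->|wz] := eqVneq w z; first by rewrite /recip fz normc0E.
  have [|fw _ Fl] := H1 w; first by rewrite normc_gt0 subr_eq0 wz.
  have ei : 0 < e^-1 by rewrite invr_gt0.
  rewrite /recip fw normcV' -[e]invrK ltf_pV2 ?posrE//; have := normc_triB (F w) w1; lra.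
exists dl => // w /[dup] wd /andP[w0 w2].
have [] := @near w (Num.min (N (w - z)) (dl - N (w - z))) _ _.
- by rewrite lt_min w0; lra.
- move=> v; rewrite lt_min => /andP[v1 v2]; apply: HH; apply/andP; split.
    by rewrite normc_gt0 subr_eq0; apply/eqP => vz; rewrite vz normc_sub ltxx in v1.
  by have := normc_tri w v z; lra.
move=> _ _.
have [fw Fw w1w] := HH w wd.
apply: (@cdiff_near _ (fun w => (F w - w1)^-1) _ _ (Num.min (N (w - z)) (dl - N (w - z)))).
- by rewrite lt_min w0; lra.
- move=> v; rewrite lt_min => /andP[v1 v2]; have [] := HH v _; last by move=> fv _ _; rewrite /recip fv.
  apply/andP; split; last by have := normc_tri w v z; lra.
  by rewrite normc_gt0 subr_eq0; apply/eqP => vz; rewrite vz normc_sub ltxx in v1.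
apply: cdiffV; last by rewrite subr_eq0.
by apply: cdiffB => //; exact: cdiff_cst.
Qed.

(* at a w1-point with f' != 0 the difference quotient of f is invertible *)
Lemma recip_simple_pole z : f z = Some w1 -> ~ cderiv F z 0 ->
  removable (fun w => ('X - z%:P).[w] * recip w) z /\
  exists2 dl : R, 0 < dl & forall w, 0 < N (w - z) < dl -> f w <> None /\ f w <> Some w1.
Proof.
move=> fz nd; have [dl dl0 H] := regular_near mf (mero_finite mf (z := z) ltac:(by rewrite fz)).
have [|_ [l hl]] := H z; first by rewrite subrr normc0E.
have Fz : F z = w1 by rewrite /finite_part fz.
have l0 : l != 0 by apply/eqP => l0; apply: nd; rewrite -l0.
have FK : holK F z by apply: (holK_cdiff dl0) => w /H[].
have DK := holK_divdiff hl FK.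
have Dz : divdiff F z l z = l by rewrite /divdiff eqxx.
have Dz0 : divdiff F z l z != 0 by rewrite Dz.
have [d1 d10 H1] := ccont_neq0 DK.1 Dz0.
have dF w : 0 < N (w - z) < Num.min dl d1 -> [/\ f w = Some (F w), F w - w1 != 0 & w - z != 0].
  rewrite lt_min => /andP[w0 /andP[/H[fw _] /H1 h]].
  have wz : w - z != 0 by rewrite -normc_gt0.
  split=> //; rewrite (divdiffK F z l w) Fz addrC addKr mulf_neq0//.
  by rewrite -normc_gt0; apply: le_lt_trans h; rewrite divr_ge0 ?normc_ge0.
have m0 : 0 < Num.min dl d1 by rewrite lt_min dl0.
split; last first.
  exists (Num.min dl d1) => // w /dF[-> + _]; rewrite subr_eq0 => /eqP ne.
  by split=> // -[].
exists (fun w => (divdiff F z l w)^-1); split; first exact: holKV.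
exists (Num.min dl d1) => // w /dF[fw Fw wz].
rewrite /recip fw hornerXsubC divdiffE; last by rewrite -subr_eq0.
by rewrite invfM invrK Fz mulrC.
Qed.

End Omitted.

(** * Meromorphic functions omitting a disc near infinity *)

Section Assembly.
Context {R : realType}.
Implicit Types (f : R[i] -> sphere R) (z w : R[i]) (p q : {poly R[i]}).

Lemma ratpoint_qcont p q z (e : R) : (p.[z] != 0) || (q.[z] != 0) ->
  (forall w, (p.[w] != 0) || (q.[w] != 0)) -> 0 < e ->
  exists2 dl : R, 0 < dl & forall w, N (w - z) < dl -> qdist (ratpoint p q w) (ratpoint p q z) < e.
Proof.
move=> pqz pq e0.
have [e3 /andP[e30 e31] [v v0 Hv]] := nrm_local_lb pqz.
have [Bp Bp0 Hp] := poly_local_bound p z.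
have [Bq Bq0 Hq] := poly_local_bound q z.
have zz : N (z - z) <= 1 by rewrite subrr normc0E.
have d0 : 0 < e * (v * v) / (2 * Bp * Bq) by rewrite divr_gt0 ?mulr_gt0.
exists (Num.min e3 (e * (v * v) / (2 * Bp * Bq))); first by rewrite lt_min e30.
move=> w; rewrite lt_min => /andP[w3]; rewrite ltr_pdivlMr ?mulr_gt0// => w4.
have wz : N (w - z) <= 1 by lra.
have [p1 p2] := Hp w z wz zz; have [q1 q2] := Hq w z wz zz.
have [p3 _] := Hp z w zz wz; have [q3 _] := Hq z w zz wz.
have n1 := Hv w w3; have n2 : v <= nrm p.[z] q.[z] by apply: Hv; rewrite subrr normc0E.
rewrite /ratpoint qdist_hpt//.
have nn : v * v <= nrm p.[w] q.[w] * nrm p.[z] q.[z] by apply: ler_pM => //; exact: ltW.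
have vv : 0 < v * v by rewrite mulr_gt0.
rewrite ltr_pdivrMr; last by lra.
apply: (@lt_le_trans _ _ (e * (v * v))); last by rewrite ler_pM2l.
apply: le_lt_trans w4.
rewrite (_ : _ - _ = (p.[w] - p.[z]) * q.[z] - p.[z] * (q.[w] - q.[z])); last by ring.
apply: (le_trans (normc_add _ _)); rewrite normc_opp !normcM'.
have h1 : N (p.[w] - p.[z]) * N q.[z] <= Bp * N (w - z) * Bq by apply: ler_pM; rewrite ?normc_ge0.
have h2 : N p.[z] * N (q.[w] - q.[z]) <= Bp * (Bq * N (w - z)) by apply: ler_pM; rewrite ?normc_ge0.
by lra.
Qed.

Lemma gcd_reduce (p q : {poly R[i]}) : q != 0 -> exists g p' q' : {poly R[i]},
  [/\ g != 0, coprimep p' q', p = p' * g, q = q' * g & q' != 0].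
Proof.
move=> q0; pose g := gcdp p q.
have g0 : g != 0 by rewrite gcdp_eq0 negb_and q0 orbT.
have Ep : p = (p %/ g) * g by rewrite divpK// dvdp_gcdl.
have Eq : q = (q %/ g) * g by rewrite divpK// dvdp_gcdr.
exists g, (p %/ g), (q %/ g); split=> //.
  by apply: coprimep_div_gcd; rewrite q0 orbT.
by apply: contra_neq q0 => E; rewrite Eq E mul0r.
Qed.

Variable f : R[i] -> sphere R.
Hypothesis mf : meromorphic f.
Local Notation F := (finite_part f : R[i] -> R[i]).

(* f agrees with P / Q off a discrete set; both sides are continuous *)
Lemma rational_of_generic (P Q : {poly R[i]}) (w1 : R[i]) : Q != 0 ->
  (forall z, exists2 dl : R, 0 < dl & forall w, 0 < N (w - z) < dl -> f w <> None /\ f w <> Some w1) ->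
  (forall z v, f z = Some v -> v != w1 -> Q.[z] * v = P.[z]) -> rational_on_plane f.
Proof.
move=> Q0 Hiso HQ.
have [g [p [q [g0 cpq EP EQ q0]]]] := gcd_reduce P Q0.
exists (ratfun p q); first by exists p, q; split.
have pq0 z : (p.[z] != 0) || (q.[z] != 0).
  by case: (eqVneq p.[z] 0) => //= /eqP; exact: (coprimep_root cpq).
have gen z v : f z = Some v -> v != w1 -> g.[z] != 0 -> f z = ratpoint p q z.
  move=> fz vw gz; have := HQ z v fz vw.
  rewrite EP EQ !hornerM mulrAC => /(mulIf gz) qv.
  rewrite fz /ratpoint /hpt; case: eqP => [qz|/eqP qz].
    by have := pq0 z; rewrite -qv qz mul0r eqxx.
  by rewrite -qv mulrC mulKf.
move=> z; rewrite -[RHS]/(ratpoint p q z); apply: qdist_eq0.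
apply: (@eq0_small _ _ 2 1); rewrite ?qdist_ge0// => e e0 _.
have [d1 d10 H1] := mero_qcont mf z e0.
have [d2 d20 H2] := ratpoint_qcont (pq0 z) pq0 e0.
have [d3 d30 H3] := Hiso z; have [d4 d40 H4] := poly_neq0_near z g0.
have [|w] := @near_point _ z (Num.min (Num.min d1 d2) (Num.min d3 d4)).
  by rewrite !lt_min d10 d20 d30 d40.
rewrite !lt_min => /andP[w0 /andP[/andP[wd1 wd2] /andP[wd3 wd4]]].
have [fw fw1] : f w <> None /\ f w <> Some w1 by apply: H3; rewrite w0.
have E : f w = ratpoint p q w.
  apply: (gen w (F w)); first exact: finite_partE.
    by apply/eqP => E; apply: fw1; rewrite (finite_partE fw) E.
  by apply: H4; rewrite w0.
have h1 : qdist (f w) (f z) < e by apply: H1; rewrite w0.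
have h2 := H2 w wd2.
have := qdist_tri (f w) (f z) (ratpoint p q z); rewrite [qdist (f z) (f w)]qdistC {2}E.
by lra.
Qed.

Lemma rational_of_omit (w0 : R[i]) (e R0 : R) : 0 < e ->
  (forall z, R0 < N z -> e <= qdist (f z) (Some w0)) -> rational_on_plane f.
Proof.
move=> e0 Hom.
pose B := `|R0| + 1.
have B1 : 1 <= B by rewrite /B; have := normr_ge0 R0; lra.
have BR : R0 < B by rewrite /B; have := ler_norm R0; lra.
have NB : - B <= B by lra.
have e2 : 0 < e / 2 by lra.
(* As [w1] is within [e / 2] of [w0], finite values of [f] outside the disc of radius [B] stay
   [e / 2] away from [w1]: all [w1]-points lie in the square where [w1] is a regular value. *)
have [w1 ww Hreg] := regular_value w0 mf NB NB e2.
have inB z : N z <= B -> inR (- B) B (- B) B z.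
  by move=> zB; split; rewrite -ler_norml; apply: le_trans zB; [exact: normc_Re|exact: normc_Im].
have far z v : R0 < N z -> f z = Some v -> e / 2 <= N (v - w1).
  move=> zR fz; have := Hom z zR; rewrite fz => h.
  have := qdist_le_dist v w0; have := normc_tri w1 v w0; lra.
have out z : B < N z -> f z <> Some w1.
  move=> zB fz; have := far z w1 (lt_trans BR zB) fz.
  by rewrite subrr normc0E; lra.
have crit z : f z = Some w1 -> ~ cderiv F z 0.
  move=> fz; apply: Hreg => //; apply: inB; rewrite leNgt; apply/negP => zB.
  exact: out fz.
have Hiso z : exists2 dl : R, 0 < dl & forall w, 0 < N (w - z) < dl -> f w <> None /\ f w <> Some w1.
  case: (pselect (f z = Some w1)) => [fz|fz].
    by have [] := recip_simple_pole mf fz (crit z fz).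
  by have [] := recip_holK mf fz.
pose G := recip f w1.
have GK z : f z <> Some w1 -> holK G z by move=> fz; have [] := recip_holK mf fz.
(* Bisection collects one linear factor per small rectangle; further factors keep a singularity
   removable, so the product serves the whole square. *)
have [A A0 HA] : exists2 A : {poly R[i]}, A != 0 &
    forall z, inR (- B) B (- B) B z -> removable (fun w => A.[w] * G w) z.
  pose P a b c d := exists2 A : {poly R[i]}, A != 0 &
    forall z, inR a b c d z -> removable (fun w => A.[w] * G w) z.
  have comb (A1 A2 : {poly R[i]}) z : removable (fun w => A2.[w] * G w) z ->
      removable (fun w => (A1 * A2).[w] * G w) z.
    move=> /(removableM (holK_poly A1 z)); congr removable; apply/funext => w.
    by rewrite hornerM mulrA.
  have comb' (A1 A2 : {poly R[i]}) z : removable (fun w => A1.[w] * G w) z ->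
      removable (fun w => (A1 * A2).[w] * G w) z by rewrite mulrC; exact: comb.
  have : P (- B) B (- B) B; last by [].
  apply: cousin => //.
    move=> a b c d ab cd [A1 n1 h1] [A2 n2 h2] [A3 n3 h3] [A4 n4 h4].
    exists (A1 * A2 * (A3 * A4)); first by rewrite !mulf_neq0.
    move=> z [/andP[r1 r2] /andP[i1 i2]].
    case: (leP (complex.Im z) ((c + d) / 2)) => hy;
    case: (leP (complex.Re z) ((a + b) / 2)) => hx.
    - by apply/comb'/comb'/h1; split; apply/andP; split.
    - by apply/comb'/comb/h2; split; apply/andP; split=> //; exact: ltW.
    - by apply/comb/comb'/h3; split; apply/andP; split=> //; exact: ltW.
    - by apply/comb/comb/h4; split; apply/andP; split=> //; exact: ltW.
  move=> x y _ _; pose z0 : R[i] := x +i* y.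
  have [dl dl0 Hd] := Hiso z0.
  exists (dl / 2) => [|a b c d _ axb _ _ cyd _ ba dc]; first by lra.
  have near z : inR a b c d z -> z != z0 -> 0 < N (z - z0) < dl.
    move=> [/andP[? ?] /andP[? ?]] zz; move: axb cyd => /andP[? ?] /andP[? ?].
    rewrite normc_gt0 subr_eq0 zz; apply: (le_lt_trans (normc_ReIm _)); rewrite !raddfB /=.
    have : `|complex.Re z - x| <= b - a by rewrite ler_norml; lra.
    have : `|complex.Im z - y| <= d - c by rewrite ler_norml; lra.
    by lra.
  exists ('X - z0%:P); first by rewrite polyXsubC_eq0.
  move=> z zi; have [->|zz] := eqVneq z z0.
    case: (pselect (f z0 = Some w1)) => [fz|fz].
      by have [] := recip_simple_pole mf fz (crit z0 fz).
    by apply: removableM; [exact: holK_poly|apply: holK_removable; exact: GK].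
  have [_ fz] := Hd z (near z zi zz).
  by apply: removableM; [exact: holK_poly|apply: holK_removable; exact: GK].
have {}HA z : removable (fun w => A.[w] * G w) z.
  have [zB|zB] := leP (N z) B; first exact/HA/inB.
  by apply: removableM; [exact: holK_poly|apply: holK_removable; apply: GK; exact: out].
have [H [HK HE]] := removable_extension HA.
have {}HE z : f z <> Some w1 -> H z = A.[z] * G z.
  by move=> fz; apply: HE; apply: holKM; [exact: holK_poly|exact: GK].
have [C C0 HC] := poly_growth A.
have [Q HQ] : exists Q : {poly R[i]}, forall z, H z = Q.[z].
  (* [A] grows at most like the power [size A] and the reciprocal is bounded by [2 / e]; the extra 1
     in the exponent is the factor [N z] in the hypothesis of [liouville_poly]. *)
  apply: (@liouville_poly _ H (size A).+1 (C * (2 / e)) (B + 1)) => // z zB.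
  have fz : f z <> Some w1 by apply: out; lra.
  have z1 : 1 <= N z by lra.
  rewrite exprSr mulrA ler_pM2r; last by lra.
  rewrite HE// normcM' mulrAC; apply: ler_pM; rewrite ?normc_ge0//; first exact: HC.
  rewrite /G /recip; case E : (f z) => [v|]; last by rewrite normc0E divr_ge0// ltW.
  have := far z v ltac:(lra) E => h.
  by rewrite normcV' -[2 / e]invf_div lef_pV2// posrE//; lra.
(* Otherwise the reciprocal would vanish at some point where [f] is finite and different from
   [w1]. *)
have Q0 : Q != 0.
  apply/eqP => Q0; have [d1 d10 H1] := Hiso 0; have [d2 d20 H2] := poly_neq0_near 0 A0.
  have [|w] := @near_point _ 0 (Num.min d1 d2); first by rewrite lt_min d10.
  rewrite lt_min => /andP[n0 /andP[n1 n2]].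
  have [fw fw1] : f w <> None /\ f w <> Some w1 by apply: H1; rewrite n0.
  have Aw : A.[w] != 0 by apply: H2; rewrite n0.
  have := HE w fw1; rewrite HQ Q0 horner0 => /esym/eqP.
  rewrite mulf_eq0 (negbTE Aw) /= /G /recip (finite_partE fw) invr_eq0 subr_eq0 => /eqP E.
  by apply: fw1; rewrite (finite_partE fw) E.
(* Here [A = Q (f - w1)] is solved for [f]. *)
apply: (@rational_of_generic (A + w1%:P * Q) Q w1) => // z v fz vw.
have fz1 : f z <> Some w1 by rewrite fz => -[/eqP]; rewrite (negbTE vw).
have := HE z fz1; rewrite HQ /G /recip fz !hornerE => E.
have vw0 : v - w1 != 0 by rewrite subr_eq0.
have : Q.[z] * (v - w1) = A.[z] by rewrite E divfK.
by rewrite mulrBr => /eqP; rewrite subr_eq => /eqP ->; rewrite mulrC [w1 * _]mulrC.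
Qed.

End Assembly.

(** * Lacunary and dense sets *)

(** The infimum runs over integers, so a value below 1 yields an admissible integer at most 0; for a
    nonempty set it cannot be negative. *)
Lemma nagata_dim_le0 {R : realType} {T : Type} (d : T -> T -> R) (X : set T) :
  (forall x, d x x = 0) -> X !=set0 -> nagata_le d X 0 <-> (nagata_dim d X <= 0)%E.
Proof.
move=> dxx X0; split=> [H|H].
  by apply: ereal_inf_lbound; exists 0 => //; exact/nagata_coverP.
have : (nagata_dim d X < 1%:E)%E by apply: le_lt_trans H _; rewrite lte_fin.
case/ereal_inf_lt => _ [[n|n] Hn <-]; rewrite lte_fin.
  rewrite -[1]/(1%:~R) ltr_int; case: n Hn => [|//] Hn _.
  exact/nagata_coverP.
by move: Hn => /(nagata_cover_negz _ _ dxx)[_ XE] _; move: X0; rewrite XE => -[].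
Qed.

Section Dimension0.
Context {R : realType}.
Local Notation d := (@qdist R).

Lemma nrm1_bounds (z : R[i]) : 1 <= N z -> N z <= nrm z 1 /\ nrm z 1 ^+ 2 <= 2 * N z ^+ 2.
Proof.
move=> z1; split; first by rewrite nrmC nrm_ger.
by rewrite nrm_sqr normc1E expr1n; have := exprn_ege1 2 z1; lra.
Qed.

(** The distance of two distinct points is comparable with the inverse of the smaller modulus. At
    scale [s] the points with [1 / (4 |z|) <= s] form one class, and any other point is alone,
    farther than [s] from the rest. *)
Lemma lacunary_nagata0 (Z : set R[i]) : (forall z, Z z -> 1 <= N z) ->
  (forall z w, Z z -> Z w -> z != w -> 2 * N z <= N w \/ 2 * N w <= N z) ->
  nagata_le d (Some @` Z) 0.
Proof.
move=> Z1 Zl; apply/nagata_le_image.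
have qE z w : d (Some z) (Some w) = N (z - w) / (nrm z 1 * nrm w 1).
  by rewrite !hpt_Some qdist_hpt ?oner_eq0 ?orbT// !mulr1.
have ub z w : Z z -> Z w -> d (Some z) (Some w) <= (N z)^-1 + (N w)^-1.
  move=> Zz Zw; have [h1 _] := nrm1_bounds (Z1 _ Zz); have [h2 _] := nrm1_bounds (Z1 _ Zw).
  have z0 : 0 < N z by have := Z1 _ Zz; lra.
  have w0 : 0 < N w by have := Z1 _ Zw; lra.
  have nz : 0 < nrm z 1 by lra.
  have nw : 0 < nrm w 1 by lra.
  rewrite qE.
  apply: (@le_trans _ _ ((N z + N w) / (N z * N w))); last first.
    by rewrite le_eqVlt; apply/orP; left; apply/eqP; field; rewrite !gt_eqF.
  apply: ler_pM; rewrite ?normc_ge0 ?invr_ge0 ?mulr_ge0//; try exact: ltW.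
    by apply: (le_trans (normc_add _ _)); rewrite normc_opp.
  rewrite lef_pV2 ?posrE ?mulr_gt0//.
  by apply: ler_pM => //; exact: ltW.
have lb z w : Z z -> Z w -> 2 * N z <= N w -> (4 * N z)^-1 <= d (Some z) (Some w).
  move=> Zz Zw zw; have [_ h1] := nrm1_bounds (Z1 _ Zz); have [_ h2] := nrm1_bounds (Z1 _ Zw).
  have z0 : 0 < N z by have := Z1 _ Zz; lra.
  have w0 : 0 < N w by have := Z1 _ Zw; lra.
  have nz := nrm_gt0 (a := z) (b := 1) ltac:(by rewrite oner_eq0 orbT).
  have nw := nrm_gt0 (a := w) (b := 1) ltac:(by rewrite oner_eq0 orbT).
  rewrite qE ler_pdivlMr ?mulr_gt0// mulrC ler_pdivrMr ?mulr_gt0//.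
  have h3 : nrm z 1 * nrm w 1 <= 2 * (N z * N w).
    rewrite -(ler_pXn2r (n := 2))// ?nnegrE ?mulr_ge0 ?normc_ge0 ?(ltW nz) ?(ltW nw)//.
    rewrite exprMn (_ : (2 * _) ^+ 2 = (2 * N z ^+ 2) * (2 * N w ^+ 2)); last by ring.
    by apply: ler_pM; rewrite ?sqr_ge0.
  apply: (le_trans h3).
  have h4 : N w / 2 <= N (z - w) by rewrite normc_sub; have := normc_triB w z; lra.
  by have := ler_wpM2r (ltW z0) h4; lra.
have close z w : Z z -> Z w -> z != w -> (4 * N z)^-1 <= d (Some z) (Some w) /\
    (4 * N w)^-1 <= d (Some z) (Some w).
  move=> Zz Zw zw; have z0 : 0 < N z by have := Z1 _ Zz; lra.
  have w0 : 0 < N w by have := Z1 _ Zw; lra.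
  case: (Zl z w Zz Zw zw) => h.
    have := lb z w Zz Zw h => h1; split=> //; apply: le_trans h1.
    by rewrite lef_pV2 ?posrE ?mulr_gt0//; lra.
  have := lb w z Zw Zz h; rewrite qdistC => h1; split=> //; apply: le_trans h1.
  by rewrite lef_pV2 ?posrE ?mulr_gt0//; lra.
(* Points of the common class have [1 / |z| <= 4 s], hence mutual distance at most [8 s]. *)
exists 8 => // s s0.
pose chi z : option R[i] := if (4 * N z)^-1 <= s then None else Some z.
eexists; apply: (@labelling_class _ _ _ _ _ _ _ _ chi); split=> [z w Zz Zw|g Zg dg ginj].
  rewrite /chi; case: leP => hz; case: leP => hw //; last first.
    by move=> [->]; rewrite qdistxx mulr_ge0// ltW.
  move=> _; apply: (le_trans (ub z w Zz Zw)).
  by move: hz hw; rewrite !invfM; lra.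
have ne : g ord0 != g (lift ord0 ord0).
  by apply/eqP => E; have /(congr1 val) := ginj ord0 (lift ord0 ord0) (congr1 chi E).
have [h1 h2] := close _ _ (Zg _) (Zg _) ne.
have := dg ord0 (lift ord0 ord0) => h3.
have E : chi (g ord0) = chi (g (lift ord0 ord0)).
  by rewrite /chi (le_trans h1 h3) (le_trans h2 h3).
by have /(congr1 val) := ginj ord0 (lift ord0 ord0) E.
Qed.

(* labels are constant along chains of small steps *)
Lemma chain_not_nagata0 (Y : set (sphere R)) :
  (forall (t : R) e, 0 < e -> exists2 y, Y y & d y (Some t%:C) < e) -> ~ nagata_le d Y 0.
Proof.
move=> dense [c c0 H].
(* The points 0 and 1 are at least [1 / 2] apart; a class allows only [c s <= 1 / 8], and
   approximating both ends costs at most [2 s / 3 <= 1 / 12]. *)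
pose s := Num.min (1 / (8 * c)) (1 / 8).
have s0 : 0 < s by rewrite lt_min !divr_gt0 ?mulr_gt0//.
have cs : c * s <= 1 / 8.
  have : s <= 1 / (8 * c) by rewrite ge_min lexx.
  by rewrite ler_pdivlMr ?mulr_gt0//; lra.
have s8 : s <= 1 / 8 by rewrite ge_min lexx orbT.
have [phi [Hb Hm]] := H s s0.
pose K := Num.truncn (3 / s).
have Ks : 3 / K.+1%:R <= s.
  rewrite ler_pdivrMr ?ltr0Sn// mulrC -ler_pdivrMr//.
  exact/ltW/Num.Theory.truncnS_gt.
have k0 : 0 < K.+1%:R :> R by rewrite ltr0Sn.
have [u Eu] : exists u : R, u = 1 / K.+1%:R by eexists.
(* Neighbours in the chain are within [3 u]: two approximation errors and one step. *)
have us : 3 * u <= s by rewrite Eu mul1r.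
pose t j : R := j%:R / K.+1%:R.
have /choice[y Hy] j : exists y, Y y /\ d y (Some (t j)%:C) < u.
  by have [y Yy dy] := dense (t j) u ltac:(by rewrite Eu divr_gt0); exists y.
have tt j : d (Some (t j)%:C) (Some (t j.+1)%:C) <= u.
  apply: (le_trans (qdist_le_dist _ _)).
  rewrite Eu -rmorphB normcZ (_ : t j - t j.+1 = - (1 / K.+1%:R)); last first.
    by rewrite /t -[in j.+1%:R]natr1; field; rewrite gt_eqF.
  by rewrite normrN ger0_norm// divr_ge0// ltW.
have step j : phi (y j) = phi (y j.+1).
  apply: contrapT => ne; apply: (Hm (fun i : 'I_2 => if i == ord0 then y j else y j.+1)).
  - by move=> i; case: ifP => _; [have [] := Hy j|have [] := Hy j.+1].
  - have ds : d (y j) (y j.+1) <= s.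
      have [_ h1] := Hy j; have [_ h2] := Hy j.+1; have h3 := tt j.
      have := qdist_tri (Some (t j)%:C) (y j) (y j.+1).
      have := qdist_tri (Some (t j.+1)%:C) (Some (t j)%:C) (y j.+1).
      rewrite [d (Some (t j.+1)%:C) (y j.+1)]qdistC.
      by lra.
    by move=> i k; case: ifP => _; case: ifP => _; rewrite ?qdistxx ?(ltW s0)// qdistC.
  - move=> i k /=; have [->|i0] := eqVneq i ord0; have [->|h0] := eqVneq k ord0 => // E.
    + by case: ne.
    + by move: i0 h0; case: i => -[|[|?]] // ?; case: k => -[|[|?]] // ? _ _; exact: val_inj.
have same j : phi (y 0%N) = phi (y j) by elim: j => [//|j IH]; rewrite IH.
have [Y0 h1] := Hy 0%N; have [Y1 h2] := Hy K.+1.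
have h3 := Hb _ _ Y0 Y1 (same K.+1).
have t0 : t 0%N = 0 by rewrite /t mul0r.
have t1 : t K.+1 = 1 by rewrite /t divff// gt_eqF.
rewrite t0 in h1; rewrite t1 in h2.
have q01 : 1 / 2 <= d (Some 0%:C) (Some 1%:C).
  rewrite !hpt_Some qdist_hpt ?oner_eq0 ?orbT// !mulr1.
  rewrite -[0%:C]/(0 : R[i]) -[1%:C]/(1 : R[i]) sub0r normc_opp normc1E.
  have := nrm_le (1 : R[i]) 1; have := nrm_le (0 : R[i]) 1.
  rewrite normc0E normc1E => a1 a2.
  have a3 : 0 < nrm (0 : R[i]) 1 by rewrite nrm_gt0// oner_eq0 orbT.
  have a4 : 0 < nrm (1 : R[i]) 1 by rewrite nrm_gt0// oner_eq0 orbT.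
  rewrite ler_pdivlMr ?mulr_gt0//.
  have : nrm (0 : R[i]) 1 * nrm (1 : R[i]) 1 <= 1 * 2 by apply: ler_pM => //; lra.
  by lra.
have := qdist_tri (y 0%N) (Some 0%:C) (Some 1%:C).
have := qdist_tri (y K.+1) (y 0%N) (Some 1%:C).
rewrite [d (Some 0%:C) (y 0%N)]qdistC.
by lra.
Qed.

(** The points [zs n] at least double in modulus, while [f (zs n)] approximates the [n]-th rational
    number to the [n]-th precision. The image is then dense along the real axis, as a chain from 0
    to 1 requires. *)
Lemma dense_image_dim (f : R[i] -> sphere R) :
  (forall w e R0, 0 < e -> exists2 z, R0 < N z & d (f z) (Some w) < e) ->
  exists X : set R[i], nagata_dim d (Some @` X) <> nagata_dim d (f @` X).
Proof.
move=> dense.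
(* Every pair of a rational centre and a precision [1 / (k + 1)] occurs; numbers that decode to
   nothing get the target [(0, 1)]. *)
pose tgt n : R * R := if unpickle n is Some (rat_k) then
  (ratr (rat_k : rat * nat).1, 1 / (rat_k.2).+1%:R) else (0, 1).
have tgt0 n : 0 < (tgt n).2 by rewrite /tgt; case: unpickle => [[q k]|]//=; rewrite divr_gt0// ltr0Sn.
have /choice[phi Hphi] (Rn : R * nat) : exists z, Rn.1 < N z /\
    d (f z) (Some ((tgt Rn.2).1)%:C) < (tgt Rn.2).2.
  by have [z z1 z2] := dense ((tgt Rn.2).1)%:C _ Rn.1 (tgt0 Rn.2); exists z.
pose zs := fix zs n := if n is m.+1 then phi (2 * N (zs m), m.+1) else phi (1, 0%N).
have zs1 n : 1 < N (zs n).
  by elim: n => [|n IH] /=; [have [] := Hphi (1, 0%N)|have [/=] := Hphi (2 * N (zs n), n.+1); lra].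
have zsS n : 2 * N (zs n) < N (zs n.+1) by have [] := Hphi (2 * N (zs n), n.+1).
have zsd n : d (f (zs n)) (Some ((tgt n).1)%:C) < (tgt n).2.
  by case: n => [|n]; [have [] := Hphi (1, 0%N)|have [] := Hphi (2 * N (zs n), n.+1)].
have zsmn m n : (m < n)%N -> 2 * N (zs m) <= N (zs n).
  elim: n => // n IH; rewrite ltnS leq_eqVlt => /orP[/eqP ->|/IH h]; first exact: ltW.
  by have := zsS n; have := zs1 n; lra.
exists (range zs) => E.
have ne : Some @` range zs !=set0 by exists (Some (zs 0%N)), (zs 0%N) => //; exists 0%N.
have nef : f @` range zs !=set0 by exists (f (zs 0%N)), (zs 0%N) => //; exists 0%N.
have : nagata_le d (Some @` range zs) 0.
  apply: lacunary_nagata0 => [_ [n _ <-]|_ _ [m _ <-] [n _ <-] zz]; first exact: ltW.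
  case: (ltngtP m n) => h; [by left; exact: zsmn|by right; exact: zsmn|].
  by rewrite h eqxx in zz.
move=> /(nagata_dim_le0 (@qdistxx R) ne); rewrite E => /(nagata_dim_le0 (@qdistxx R) nef).
apply: chain_not_nagata0 => t e e0.
have [q /andP[q1 q2]] : exists q : rat, t - e / 4 < ratr q < t + e / 4.
  by have [q] := @rat_in_itvoo R (t - e / 4) (t + e / 4) ltac:(lra); rewrite in_itv /=; exists q.
pose k := Num.truncn (2 / e).
have k0 : 0 < k.+1%:R :> R by rewrite ltr0Sn.
have ke : 1 / k.+1%:R < e / 2 :> R.
  rewrite ltr_pdivrMr// mulrC -ltr_pdivrMr; last by lra.
  have -> : 1 / (e / 2) = 2 / e by field; rewrite gt_eqF.
  exact: Num.Theory.truncnS_gt.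
pose n := pickle (q, k).
exists (f (zs n)); first by exists (zs n) => //; exists n.
have h : d (f (zs n)) (Some (ratr q)%:C) < 1 / k.+1%:R.
  by have := zsd n; rewrite /tgt {2 3}/n pickleK.
apply: (le_lt_trans (qdist_tri (Some (ratr q)%:C) _ _)).
have h' : d (Some (ratr q)%:C) (Some t%:C) <= e / 4.
  apply: (le_trans (qdist_le_dist _ _)).
  by rewrite -rmorphB normcZ ler_norml; lra.
by apply: (lt_le_trans (ltr_leD (lt_trans h ke) h')); lra.
Qed.

End Dimension0.

(** * Invariance under rational maps and the converse for meromorphic functions *)

Theorem theorem1p4 (R : realType) :
  (forall r : sphere R -> sphere R, rational_map r -> nonconstant r ->
     forall X : set (sphere R),
       nagata_dim qdist X = nagata_dim qdist (r @` X))
  /\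
  (forall f : R[i] -> sphere R, meromorphic f -> nonconstant f ->
     (rational_on_plane f <->
      forall X : set R[i],
        nagata_dim qdist (Some @` X) = nagata_dim qdist (f @` X))).
Proof.
split=> [r rr nr X|f mf nf]; first exact: rational_dim.
split=> [[r rr fr] X|H].
  have nr : nonconstant r by move=> [b rb]; apply: nf; exists b => z; rewrite fr.
  rewrite (rational_dim _ rr nr) image_comp; congr (nagata_dim _ (_ @` _)).
  by apply/funext => z; rewrite fr.
apply: contrapT => nrat.
have [|X] := @dense_image_dim R f; last by apply.
move=> w e R0 e0; apply: contrapT => /forall2NP nz; apply: nrat.
apply: (@rational_of_omit _ _ mf w e R0) => // z zR.
by have [//|/negP] := nz z; rewrite -leNgt.
Qed.
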